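(* Assume that $\infty$ is regular. Consider a Feller $Q$-process $(p_{ij}(t))_{i,j\in\mathbb N}$ with the triple $(\nu,\gamma,\beta)$, where $|\nu|<\infty$ and $\beta>0$. Then $(p_{ij}(t))_{i,j\in\mathbb N}$ is the piecing out of $X^\kappa$ with respect to $\pi$, where $X^\kappa$ is the symmetrizable $Q$-process with parameter $\kappa$ (associated with the Dirichlet form $(\mathscr E^\kappa,\mathscr F^\kappa)$) and $$\kappa=\frac{|\nu|+\gamma}{\beta},\qquad \pi(\{k\})=\frac{\nu_k}{|\nu|+\gamma},\ k\in\mathbb N,\qquad \pi(\{\partial\})=\frac{\gamma}{|\nu|+\gamma}.$$
   Context: Setting. $\mathbb N=\{0,1,2,\dots\}$. Let $a_0=0$, $a_k>0$ ($k\ge1$), $b_k>0$ ($k\ge 0$), $q_k=a_k+b_k$, and let $Q=(q_{ij})_{i,j\in\mathbb N}$ be the tridiagonal matrix with $q_{kk}=-q_k$, $q_{k,k+1}=b_k$, $q_{k,k-1}=a_k$, all other entries $0$. A transition matrix $(p_{ij}(t))_{i,j\in\mathbb N,t\ge0}$ is a nonnegative semigroup of matrices with row sums $\le 1$; it is extended to an honest one (row sums $1$) on $\mathbb N\cup\{\partial\}$ by adding a trap $\partial$. It is standard if $\lim_{t\to0}p_{ij}(t)=\delta_{ij}$. A $Q$-process is a continuous-time Markov chain whose transition matrix is standard with $p_{ij}'(0)=q_{ij}$ for all $i,j\in\mathbb N$; two $Q$-processes with the same transition matrix are identified. The minimal $Q$-process has the smallest transition matrix: $p^{\min}_{ij}(t)\le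 p_{ij}(t)$ for every $Q$-process. Put $\mu_0=1$, $\mu_k=\frac{b_0\cdots b_{k-1}}{a_1\cdots a_k}$, $c_0=0$, $c_1=\frac1{2b_0}$, $c_k=\frac1{2b_0}+\sum_{i=2}^k\frac{a_1\cdots a_{i-1}}{2b_0b_1\cdots b_{i-1}}$ ($k\ge2$), $\sigma=\sum_{k\ge0}(c_{k+1}-c_k)\sum_{i=0}^k\mu_i$, $\lambda=\sum_{k\ge0}c_k\mu_k$. The boundary $\infty$ is regular if $\sigma<\infty$ and $\lambda<\infty$. Feller $Q$-process with a triple. $\Phi_{ij}(\alpha)=\int_0^\infty e^{-\alpha t}p^{\min}_{ij}(t)dt$, $u_\alpha(i)=1-\alpha\sum_j\Phi_{ij}(\alpha)$ (this is $\mathbf E_ie^{-\alpha\eta}$ with $\eta$ the lifetime of the minimal $Q$-process). A triple consists of a positive measure $\nu$ on $\mathbb N$ ($\nu_k=\nu(\{k\})$, $|\nu|=\sum_{k\ge0}\nu_k$) and constants $\gamma,\beta\ge0$ with $\sum_{k\ge0}\nu_k\big(\sum_{j=k}^\infty(c_{j+1}-c_j)\sum_{i=0}^j\mu_i\big)<\infty$ and ($|\nu|=\infty$ or $\beta>0$). A $Q$-process is the Feller $Q$-process with triple $(\nu,\gamma,\beta)$ if for all $\alpha>0$, $i,j\in\mathbb N$, $$\int_0^\infty e^{-\alpha t}p_{ij}(t)dt=\Phi_{ij}(\alpha)+u_\alpha(i)\,\frac{\sum_{k\ge0}\nu_k\Phi_{kj}(\alpha)+\beta\mu_ju_\alpha(j)}{\gamma+\sum_{k\ge0}\nu_k(1-u_\alpha(k))+\beta\alpha\sum_{k\ge0}\mu_ku_\alpha(k)}.$$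 (Such a process is realized as a Feller process on $\mathbb N\cup\{\infty\}\cup\{\partial\}$.) $X^\kappa$. $\mathbb N\cup\{\infty\}$ is the Alexandroff compactification of discrete $\mathbb N$; $\mu(\{k\})=\mu_k$, $\mu(\{\infty\})=0$. Let $\mathscr A^*(f,g)=\frac12\sum_{k\ge0}\frac{(f(k+1)-f(k))(g(k+1)-g(k))}{c_{k+1}-c_k}$, $\mathscr G^*=\{f\in L^2(\mathbb N,\mu):\mathscr A^*(f,f)<\infty\}$; for $f\in\mathscr G^*$ the limit $f(\infty)=\lim_kf(k)$ exists ($\infty$ regular). For $\kappa\in[0,\infty)$, $\mathscr F^\kappa=\mathscr G^*$ and $\mathscr E^\kappa(f,g)=\mathscr A^*(f,g)+\kappa f(\infty)g(\infty)$ is a regular Dirichlet form on $L^2(\mathbb N\cup\{\infty\},\mu)$, and $X^\kappa$ is the associated Markov process on $\mathbb N\cup\{\infty\}$, with trap $\partial$. Piecing out. Let $S$ be a locally compact Hausdorff space with countable base, $S_\Delta=S\cup\{\Delta\}$ its one-point compactification ($\Delta$ isolated if $S$ is compact), $Y=(\Omega,\mathscr F,\mathscr F_t,Y_t,\theta_t,(\mathbf P_x)_{x\in S_\Delta})$ a right continuous strong Markov process on $S_\Delta$ with lifetime $\zeta$ and trap $\Delta$, and $\pi$ a probability measure on $S_\Delta$. Let $\omega_\Delta$ be the path constantly $\Delta$; set $K(\omega,dy)=\pi(dy)$ for $\omega\ne\omega_\Delta$ and $K(\omega_\Delta,dy)=\delta_\Delta(dy)$. On $W=\Omega\times S_\Delta$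 put $\mathbf Q_x(d\omega,dy)=\mathbf P_x(d\omega)K(\omega,dy)$ and, for $w=(\omega,y)$, $\dot Y_t(w)=Y_t(\omega)$ if $t<\zeta(\omega)$, $\dot Y_t(w)=y$ if $t\ge\zeta(\omega)$. On $\tilde\Omega=W^{\{1,2,\dots\}}$ let $\tilde{\mathbf P}_x$ be the probability with $\tilde{\mathbf P}_x[dw_1,\dots,dw_n]=\mathbf Q_x[dw_1]\mathbf Q_{y_1}[dw_2]\cdots\mathbf Q_{y_{n-1}}[dw_n]$, $w_i=(\omega_i,y_i)$. The piecing out $\tilde Y=(Y,\pi)$ is $\tilde Y_t=\dot Y_t(w_1)$ for $0\le t\le\zeta(\omega_1)$, $\tilde Y_t=\dot Y_{t-(\zeta(\omega_1)+\dots+\zeta(\omega_n))}(w_{n+1})$ for $\sum_{i\le n}\zeta(\omega_i)<t\le\sum_{i\le n+1}\zeta(\omega_i)$, and $\tilde Y_t=\Delta$ for $t\ge\sum_{i=1}^{N}\zeta(\omega_i)$ with $N=\inf\{i:\zeta(\omega_i)=0\}$ ($\inf\emptyset=\infty$). Here it is applied with $S=\mathbb N\cup\{\infty\}$, $Y=X^\kappa$, $\Delta=\partial$. The assertion means that the transition matrix on $\mathbb N$ of the pieced-out process equals $(p_{ij}(t))$. Convention: if $|\nu|+\gamma=0$, then $\kappa=0$, $X^0$ has infinite lifetime, and $\pi$ plays no role (it may be any probability measure). *)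

(* Defs.v *)
From HB Require Import structures.
From mathcomp Require Import all_boot all_order all_algebra.
From mathcomp Require Import all_classical all_reals all_analysis.
Set Implicit Arguments.
Unset Strict Implicit.
Unset Printing Implicit Defensive.
Import Order.TTheory GRing.Theory Num.Theory.
Import numFieldNormedType.Exports.
Local Open Scope classical_set_scope.
Local Open Scope ring_scope.

Section BirthDeath.
Context {R : realType}.
Variables a b : nat -> R.

Definition bd_matrix (i j : nat) : R :=
  if j == i then - (a i + b i)
  else if j == i.+1 then b i
  else if i == j.+1 then a i
  else 0.

Definition bd_mu (k : nat) : R :=
  (\prod_(0 <= i < k) b i) / (\prod_(1 <= i < k.+1) a i).

Definition bd_c (k : nat) : R :=
  if k is 0%N then 0
  else (2 * b 0%N)^-1
       + \sum_(2 <= i < k.+1) (\prod_(1 <= l < i) a l)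
                              / (2 * \prod_(0 <= l < i) b l).

Definition bd_sigma_term (k : nat) : R :=
  (bd_c k.+1 - bd_c k) * \sum_(0 <= i < k.+1) bd_mu i.

Definition bd_sigma : \bar R := (\sum_(0 <= k <oo) (bd_sigma_term k)%:E)%E.

Definition bd_lambda : \bar R := (\sum_(0 <= k <oo) (bd_c k * bd_mu k)%:E)%E.

Definition regular_boundary : Prop :=
  (bd_sigma < +oo)%E /\ (bd_lambda < +oo)%E.

(* Families of matrices are indexed by all of R; only times t >= 0 matter. *)
Definition transition_matrix (p : R -> nat -> nat -> R) : Prop :=
  [/\ forall (t : R) i j, 0 <= t -> 0 <= p t i j,
      forall (t : R) i, 0 <= t -> (\sum_(0 <= j <oo) (p t i j)%:E <= 1)%E
    & forall (s t : R) i j, 0 <= s -> 0 <= t ->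
        ((p (s + t) i j)%:E = \sum_(0 <= k <oo) (p s i k * p t k j)%:E)%E].

Definition standard (p : R -> nat -> nat -> R) : Prop :=
  forall i j, p t i j @[t --> 0^'+] --> ((i == j)%:R : R).

Definition Q_process (p : R -> nat -> nat -> R) : Prop :=
  [/\ transition_matrix p,
      standard p
    & forall i j, (p t i j - p 0 i j) / t @[t --> 0^'+] --> bd_matrix i j].

Definition minimal_Q_process (pmin : R -> nat -> nat -> R) : Prop :=
  Q_process pmin /\
  forall p, Q_process p -> forall (t : R) i j, 0 <= t -> pmin t i j <= p t i j.

Definition laplace (p : R -> nat -> nat -> R) (alpha : R) (i j : nat) : R :=
  \int[lebesgue_measure]_(t in `[0, +oo[) (expR (- alpha * t) * p t i j).

Section Feller.
Variable pmin : R -> nat -> nat -> R.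

Definition Phi : R -> nat -> nat -> R := laplace pmin.

Definition u_ (alpha : R) (i : nat) : R :=
  1 - alpha * fine (\sum_(0 <= j <oo) (Phi alpha i j)%:E)%E.

Variables (nu : {measure set nat -> \bar R}) (gamma beta : R).

Definition feller_triple : Prop :=
  [/\ 0 <= gamma, 0 <= beta,
      (\sum_(0 <= k <oo)
         nu [set k] * \sum_(k <= j <oo) (bd_sigma_term j)%:E < +oo)%E
    & nu [set: nat] = +oo%E \/ 0 < beta].

Definition feller_numerator (alpha : R) (j : nat) : R :=
  fine (\sum_(0 <= k <oo) nu [set k] * (Phi alpha k j)%:E)%E
  + beta * bd_mu j * u_ alpha j.

Definition feller_denominator (alpha : R) : R :=
  gamma + fine (\sum_(0 <= k <oo) nu [set k] * (1 - u_ alpha k)%:E)%E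
  + beta * alpha * fine (\sum_(0 <= k <oo) (bd_mu k * u_ alpha k)%:E)%E.

Definition feller_Q_process (p : R -> nat -> nat -> R) : Prop :=
  [/\ feller_triple, Q_process p
    & forall (alpha : R) i j, 0 < alpha ->
        laplace p alpha i j =
        Phi alpha i j
        + u_ alpha i * (feller_numerator alpha j / feller_denominator alpha)].

End Feller.

Definition in_L2 (f : nat -> R) : Prop :=
  (\sum_(0 <= k <oo) (f k ^+ 2 * bd_mu k)%:E < +oo)%E.

Definition L2_inner (f g : nat -> R) : R :=
  limn (series (fun k => f k * g k * bd_mu k)).

Definition A_star (f g : nat -> R) : R :=
  2^-1 * limn (series (fun k =>
    (f k.+1 - f k) * (g k.+1 - g k) / (bd_c k.+1 - bd_c k))).

(* A_star f f < oo, with the sum of nonnegative terms taken in \bar R because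
   the real-valued A_star is meaningless when the series diverges. *)
Definition finite_A_star (f : nat -> R) : Prop :=
  ((2^-1)%:E * \sum_(0 <= k <oo)
     ((f k.+1 - f k) * (f k.+1 - f k) / (bd_c k.+1 - bd_c k))%:E < +oo)%E.

Definition G_star : set (nat -> R) :=
  [set f | in_L2 f /\ finite_A_star f].

Definition E_kappa (kappa : R) (f g : nat -> R) : R :=
  A_star f g + kappa * limn f * limn g.

End BirthDeath.

Notation borelType T := (g_sigma_algebraType (@open T)).

(* If S is compact, the added point None is isolated in S_Delta S. *)
Notation S_Delta S := (one_point_compactification S).
Notation borel_Delta S := (borelType (S_Delta S)).

Section StrongMarkov.
Context {R : realType}.

Definition stopping_time {Omega : Type} (F : R -> set (set Omega))
    (tau : Omega -> \bar R) : Prop :=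
  (forall omega, (0 <= tau omega)%E) /\
  forall t : R, 0 <= t -> F t [set omega | (tau omega <= t%:E)%E].

Definition stopped_events {d} {Omega : measurableType d}
    (F : R -> set (set Omega)) (tau : Omega -> \bar R) : set (set Omega) :=
  [set A | measurable A /\
     forall t : R, 0 <= t -> F t (A `&` [set omega | (tau omega <= t%:E)%E])].

(* Time is R-valued; only nonnegative times are constrained. *)
Record strong_markov_process (S : topologicalType) d
    (Omega : measurableType d) := StrongMarkovProcess {
  smp_law : R.-pker (borel_Delta S) ~> Omega ;
  smp_filt : R -> set (set Omega) ;
  smp_path : R -> Omega -> borel_Delta S ;
  smp_shift : R -> Omega -> Omega ;
  smp_filt_sigma : forall t : R, 0 <= t -> sigma_algebra setT (smp_filt t) ;
  smp_filt_sub : forall t : R, 0 <= t -> smp_filt t `<=` measurable ;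
  smp_filt_mono : forall s t : R, 0 <= s -> s <= t -> smp_filt s `<=` smp_filt t ;
  smp_adapted : forall (t : R) (B : set (borel_Delta S)), 0 <= t -> measurable B ->
    smp_filt t (smp_path t @^-1` B) ;
  smp_path_shift : forall (s t : R) omega, 0 <= s -> 0 <= t ->
    smp_path s (smp_shift t omega) = smp_path (s + t) omega ;
  smp_trap : forall (s t : R) omega, 0 <= s -> s <= t ->
    smp_path s omega = None -> smp_path t omega = None ;
  smp_right_continuous : forall omega (t : R), 0 <= t ->
    (smp_path s omega : S_Delta S) @[s --> t^'+]
      --> (smp_path t omega : S_Delta S) ;
  smp_normal : forall x, smp_law x [set omega | smp_path 0 omega = x] = 1%E ;
  smp_strong_markov : forall (tau : Omega -> \bar R) (A : set Omega) x (s : R)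
      (B : set (borel_Delta S)),
    stopping_time smp_filt tau -> stopped_events smp_filt tau A ->
    0 <= s -> measurable B ->
    smp_law x (A `&` [set omega | (tau omega < +oo)%E /\
                                  B (smp_path (fine (tau omega) + s) omega)])
    = (\int[smp_law x]_(omega in A `&` [set omega | (tau omega < +oo)%E])
         smp_law (smp_path (fine (tau omega)) omega) (smp_path s @^-1` B))%E
}.

Definition lifetime {S : topologicalType} {d} {Omega : measurableType d}
    (Y : strong_markov_process S Omega) (omega : Omega) : \bar R :=
  ereal_inf [set t%:E | t in [set t | 0 <= t /\ smp_path Y t omega = None]].

(* Functions on S are extended by 0 at the added point. *)
Definition resolvent {S : topologicalType} {d} {Omega : measurableType d}
    (Y : strong_markov_process S Omega) (alpha : R) (f : S -> R) (x : S) : R :=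
  \int[lebesgue_measure]_(t in `[0, +oo[)
    (expR (- alpha * t) *
     \int[smp_law Y (Some x)]_omega oapp f 0 (smp_path Y t omega)).

End StrongMarkov.
Arguments strong_markov_process : clear implicits.

(* The sequence space T^{1,2,...} with the product sigma-algebra; it is indexed
   from 0, so that w n stands for w_{n+1}. *)
Definition cylinders {d} (T : measurableType d) : set (set (nat -> T)) :=
  \bigcup_n preimage_set_system setT (fun w : nat -> T => w n) measurable.
Arguments cylinders {d} T.

Notation sequences T := (g_sigma_algebraType (cylinders T)).

Section PiecingOut.
Context {R : realType} {S : topologicalType} {d} {Omega : measurableType d}.
Variable Y : strong_markov_process R S d Omega.
Variable pi : probability (borel_Delta S) R.

Local Notation W := (Omega * borel_Delta S)%type.

Definition kill_kernel (omega : Omega) : probability (borel_Delta S) R :=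
  if `[< forall t : R, 0 <= t -> smp_path Y t omega = None >]
  then (dirac (None : borel_Delta S) : probability _ R) else pi.

Definition Y_dot (t : R) (w : W) : borel_Delta S :=
  if (t%:E < lifetime Y w.1)%E then smp_path Y t w.1 else w.2.

(* The integral over A of F(y) with respect to
   Q_x(d omega, dy) = P_x(d omega) K(omega, dy). *)
Definition Q_integral (A : set W) (F : borel_Delta S -> \bar R)
    (x : borel_Delta S) : \bar R :=
  (\int[smp_law Y x]_omega \int[kill_kernel omega]_y
     ((\1_A (omega, y))%:E * F y))%E.

(* Q_x[dw_1] Q_{y_1}[dw_2] ... Q_{y_{n-1}}[dw_n] on A_1 x ... x A_n *)
Definition piecing_fdd (x : borel_Delta S) (As : seq (set W)) : \bar R :=
  foldr Q_integral (fun=> 1%E) As x.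

Definition piecing_law
    (Pt : borel_Delta S -> probability (sequences W) R) : Prop :=
  forall x (As : seq (set W)),
    (forall i, (i < size As)%N -> measurable (nth set0 As i)) ->
    Pt x [set w | forall i, (i < size As)%N -> nth set0 As i (w i)]
    = piecing_fdd x As.

Definition life_sum (w : sequences W) (n : nat) : \bar R :=
  (\sum_(0 <= i < n) lifetime Y (w i).1)%E.

(* The sum of the lifetimes up to and including the first vanishing one, or of
   all of them if none vanishes. *)
Definition total_life (w : sequences W) : \bar R :=
  (\sum_(0 <= i <oo | `[< forall j, (j < i)%N ->
                           lifetime Y (w j).1 != 0%E >])
     lifetime Y (w i).1)%E.

Definition in_piece (w : sequences W) (t : R) (n : nat) : Prop :=
  (n = 0%N \/ (life_sum w n < t%:E)%E) /\ (t%:E <= life_sum w n.+1)%E.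

(* For 0 <= t < total_life w there is exactly one n with in_piece w t n, and
   then life_sum w n is finite. *)
Definition Y_tilde (t : R) (w : sequences W) : borel_Delta S :=
  if (total_life w <= t%:E)%E then None
  else let n := xget 0%N (in_piece w t) in
       Y_dot (t - fine (life_sum w n)) (w n).

End PiecingOut.

(* N_infty is the set N together with infinity; in S_Delta N_infty the state k
   is Some (Some k), infinity is Some None and the trap is None. *)
Notation N_infty := (one_point_compactification nat).

Definition state (k : nat) : borel_Delta N_infty := Some (Some k).
Definition trap : borel_Delta N_infty := None.

(* X is a process of the Dirichlet form (E_kappa, G_star): its resolvent on
   bounded Borel functions of L^2 is the resolvent of the form.  As mu does not
   charge infinity, an element of L^2 is given by its restriction to nat. *)
Definition associated {R : realType} (a b : nat -> R) (kappa : R)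
    {d} {Omega : measurableType d}
    (X : strong_markov_process R N_infty d Omega) : Prop :=
  forall (alpha : R) (f : borelType N_infty -> R), 0 < alpha ->
    measurable_fun setT f -> (exists M : R, forall x, `|f x| <= M) ->
    in_L2 a b (fun k => f (Some k)) ->
    let G := fun k : nat => resolvent X alpha f (Some k) in
    G_star a b G /\
    forall g, G_star a b g ->
      E_kappa a b kappa G g + alpha * L2_inner a b G g
      = L2_inner a b (fun k => f (Some k)) g.

Definition piecing_out_transition {R : realType} {d} {Omega : measurableType d}
    (p : R -> nat -> nat -> R)
    (X : strong_markov_process R N_infty d Omega)
    (pi : probability (borel_Delta N_infty) R) : Prop :=
  forall Pt, piecing_law X pi Pt ->
  forall (t : R) i j, 0 <= t ->
    Pt (state i) [set w | Y_tilde X t w = state j] = (p t i j)%:E.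

(* Main.v *)
(** Piecing out renews the process at each jump, so the Laplace transform
    R(i, j) of its transition probabilities satisfies
    R(i, j) = r(i, j) + h(i) sum_k pi_k R(k, j), where r is the resolvent of
    X^kappa and h(i) = E_i exp(-alpha zeta). Both r and h are read off the
    Dirichlet form: with D = kappa + alpha sum_k mu_k u(k), summation by parts
    shows that r(i, j) = Phi(i, j) + u(i) mu_j u(j) / D and
    h(i) = kappa u(i) / D. This uses that Phi is mu-symmetric and vanishes at
    infinity, while u tends to 1 there; these facts come from comparing the
    minimal process with the limit of the semigroups of the truncated
    generators, whose row sums at time t are bounded by the mean explosion
    time divided by t. Solving the renewal equation gives Feller's formula.
    Finally both transition functions are right continuous in t (for the
    pieced-out process because almost surely each new piece starts at the
    point where the previous jump landed), so they agree as soon as their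
    Laplace transforms do. *)

Require Import Defs.
From HB Require Import structures.
From mathcomp Require Import all_boot all_order all_algebra.
From mathcomp Require Import all_classical all_reals all_analysis.
From mathcomp Require Import ring lra.
From mathcomp Require Import measurable_realfun.
Set Implicit Arguments.
Unset Strict Implicit.
Unset Printing Implicit Defensive.
Import Order.TTheory GRing.Theory Num.Theory.
Import numFieldNormedType.Exports.
Local Open Scope classical_set_scope.
Local Open Scope ring_scope.

(** Three gaps between the hypotheses and the outline shape the proof. Minimality of [pmin] says
    only that it lies below every Q-process, so its decay at infinity is obtained by exhibiting one:
    the limit of the truncations, whose survival probability obeys Markov's inequality through an
    explicit solution s of Q s = -1 that tends to 0. The form determines the resolvent of [X] only
    at the points of [nat]; it says nothing about [X] started at infinity. The renewal equation
    still closes, because the prescribed masses of [pi] already add up to 1 and leave none for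
    infinity or, when |nu| + gamma = 0, because h vanishes. Finally, the law of the sequence of
    pieces is given only on cylinders, so renewal at the first landing is derived from them, one
    landing state at a time. Solving the renewal equation takes no iteration: a solution has the
    form Phi(., j) + e u with one unknown scalar e, and integration against nu gives a linear
    equation for e. Laplace transforms are compared by testing against powers of a function with a
    strict peak. *)

(** * Weights and scale of the birth-death matrix *)

Section BirthDeathBasics.
Variables (R : realType) (a b : nat -> R).
Hypothesis a_gt0 : forall k, (1 <= k)%N -> 0 < a k.
Hypothesis b_gt0 : forall k, 0 < b k.

Local Notation mu := (bd_mu a b).
Local Notation c := (bd_c a b).

Let prod_b_gt0 n : 0 < \prod_(0 <= i < n) b i.
Proof. by rewrite prodr_gt0. Qed.

Let prod_a_gt0 n : 0 < \prod_(1 <= i < n) a i.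
Proof. by rewrite big_nat_cond prodr_gt0// => i /andP[/andP[i1 _] _]; exact: a_gt0. Qed.

Lemma bd_mu_gt0 k : 0 < mu k.
Proof. by rewrite divr_gt0. Qed.

Lemma bd_mu0 : mu 0 = 1.
Proof. by rewrite /bd_mu !big_geq// divr1. Qed.

(** Detailed balance, the source of every symmetry with respect to [mu] below. *)
Lemma bd_mu_balance k : a k.+1 * mu k.+1 = b k * mu k.
Proof.
rewrite /bd_mu (big_nat_recr k 0%N)//= (big_nat_recr k.+1 1%N)//=.
have := prod_a_gt0 k.+1; have := a_gt0 (ltn0Sn k).
set x := a k.+1; set y := \prod_(1 <= i < _) _ => x0 y0.
by field; rewrite !gt_eqF.
Qed.

(** Up to the factor 2, the scale increments are the resistances of the edges of the electrical
    network with conductances [b k * mu k]. *)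
Lemma bd_cS k : c k.+1 - c k = (2 * (b k * mu k))^-1.
Proof.
case: k => [|k]; first by rewrite bd_mu0 /= big_geq// addr0 subr0 mulr1.
rewrite /= (big_nat_recr k.+2)//= addrA [X in X - _]addrC addrK.
rewrite /bd_mu (big_nat_recr k.+1 0%N)//=.
have := prod_a_gt0 k.+2; have := prod_b_gt0 k.+1; have := b_gt0 k.+1.
set x := b k.+1; set y := \prod_(1 <= i < _) _; set z := \prod_(0 <= i < _) _.
by move=> x0 y0 z0; field; rewrite !gt_eqF.
Qed.

Lemma bd_cS_gt0 k : 0 < c k.+1 - c k.
Proof. by rewrite bd_cS invr_gt0; apply: mulr_gt0 => //; apply: mulr_gt0 => //; exact: bd_mu_gt0. Qed.

Lemma bd_c_ge k : (2 * b 0%N)^-1 <= c k.+1.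
Proof.
elim: k => [|k IH]; first by rewrite /= big_geq// addr0.
by rewrite (le_trans IH)// -subr_ge0 ltW// bd_cS_gt0.
Qed.

Lemma bd_sigma_term_ge0 k : 0 <= bd_sigma_term a b k.
Proof.
rewrite mulr_ge0//; first by rewrite ltW// bd_cS_gt0.
by rewrite sumr_ge0// => i _; rewrite ltW// bd_mu_gt0.
Qed.

End BirthDeathBasics.

(** * Nonnegative series and matrix exponentials *)

Section NonnegativeSeries.
Variable R : realType.
Local Open Scope ereal_scope.

Lemma nneseries_finite_support (f : nat -> \bar R) n :
  (forall k, 0 <= f k) -> (forall k, (n <= k)%N -> f k = 0) ->
  \sum_(0 <= k <oo) f k = \sum_(0 <= k < n) f k.
Proof.
move=> f0 fn; rewrite (@nneseries_split _ _ 0%N n) ?add0n//.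
by rewrite eseries0 ?adde0// => i ni _; exact: fn.
Qed.

Lemma nneseries_shift (g : nat -> \bar R) m : (forall k, 0 <= g k) ->
  \sum_(0 <= N <oo) (if (m <= N)%N then g (N - m)%N else 0) =
  \sum_(0 <= N <oo) g N.
Proof.
move=> g0; rewrite (@nneseries_split _ _ 0%N m) ?add0n//; last by move=> k _; case: ifP.
rewrite big_nat big1 ?add0e; last by move=> i /andP[_ im]; rewrite leqNgt im.
rewrite -(add0n m) -[LHS]nneseries_addn; last by move=> k; case: ifP.
by apply: eq_eseriesr => i _; rewrite add0n leq_addl addnK.
Qed.

(** The Cauchy product: the inner sums are padded with zeros, the two summations are interchanged,
    and each column is shifted back. *)
Lemma nneseries_antidiagonal (f : nat -> nat -> \bar R) :
  (forall l m, 0 <= f l m) ->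
  \sum_(0 <= N <oo) \sum_(0 <= m < N.+1) f (N - m)%N m =
  \sum_(0 <= l <oo) \sum_(0 <= m <oo) f l m.
Proof.
move=> f0; transitivity (\sum_(0 <= N <oo) \sum_(0 <= m <oo)
    (if (m <= N)%N then f (N - m)%N m else 0)).
  apply: eq_eseriesr => N _; rewrite (@nneseries_finite_support _ N.+1).
  - rewrite !big_nat; apply: eq_bigr => i /andP[_ iN].
    by rewrite -ltnS iN.
  - by move=> k; case: ifP.
  - by move=> k Nk; rewrite leqNgt Nk.
rewrite nneseries_interchange => [|i j]; last by case: ifP.
rewrite [RHS]nneseries_interchange//; apply: eq_eseriesr => m _.
exact: (@nneseries_shift (f^~ m)).
Qed.

Lemma nneseries_expR (x : R) : (0 <= x)%R ->
  \sum_(0 <= m <oo) (x ^+ m / m`!%:R)%:E = (expR x)%:E.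
Proof.
move=> x0; rewrite /expR -EFin_lim; last exact: is_cvg_series_exp_coeff.
by congr (limn _); apply/funext => n; rewrite /= /series/= sumEFin.
Qed.

End NonnegativeSeries.

Section MatrixExponential.
Variables (R : realType) (n : nat).
Implicit Types A B : 'M[R]_n.+1.

Definition mx_ge0 A := forall i j, 0 <= A i j.

(** Entries of exp A, kept in [\bar R] so that for nonnegative matrices sums can be interchanged
    before anything is known to converge. *)
Definition mexp A i j : \bar R :=
  (\sum_(0 <= m <oo) ((A ^+ m) i j / m`!%:R)%:E)%E.

Lemma mx_ge0_id : mx_ge0 1.
Proof. by move=> i j; rewrite mxE; case: eqP. Qed.

Lemma mx_ge0_mul A B : mx_ge0 A -> mx_ge0 B -> mx_ge0 (A * B).
Proof. by move=> A0 B0 i j; rewrite mxE sumr_ge0// => k _; rewrite mulr_ge0. Qed.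

Lemma mx_ge0_exp A m : mx_ge0 A -> mx_ge0 (A ^+ m).
Proof.
move=> A0; elim: m => [|m IH]; first by rewrite expr0; exact: mx_ge0_id.
by rewrite exprS; exact: mx_ge0_mul.
Qed.

Lemma mexp_term_ge0 A i j m : mx_ge0 A -> (0 <= ((A ^+ m) i j / m`!%:R)%:E)%E.
Proof. by move=> A0; rewrite lee_fin divr_ge0//; exact: mx_ge0_exp. Qed.

Lemma mexp_ge0 A i j : mx_ge0 A -> (0 <= mexp A i j)%E.
Proof. by move=> A0; apply: nneseries_ge0 => k _ _; exact: mexp_term_ge0. Qed.

Lemma mx_exp_row_sum_le A (c : R) m : mx_ge0 A ->
  (forall i, \sum_j A i j <= c) -> forall i, \sum_j (A ^+ m) i j <= c ^+ m.
Proof.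
move=> A0 Ac; elim: m => [|m IH] i.
  rewrite !expr0 (bigD1 i)//= mxE eqxx big1 ?addr0// => j ji.
  by rewrite mxE eq_sym (negbTE ji).
under eq_bigr do rewrite exprS mxE.
rewrite exchange_big/= exprS (@le_trans _ _ (\sum_k A i k * c ^+ m))//.
  by apply: ler_sum => k _; rewrite -mulr_sumr ler_wpM2l.
rewrite -mulr_suml ler_wpM2r// exprn_ge0//.
by apply: le_trans (Ac i); apply: sumr_ge0.
Qed.

Lemma mexp_row_sum_le A (c : R) i : mx_ge0 A ->
  (forall i, \sum_j A i j <= c) -> (\sum_j mexp A i j <= (expR c)%:E)%E.
Proof.
move=> A0 Ac; have c0 : 0 <= c by apply: le_trans (Ac i); apply: sumr_ge0.
rewrite -nneseries_expR// -nneseries_sum => [|j k _]; last exact: mexp_term_ge0.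
apply: lee_nneseries => [k _ _|k _].
  by apply: sume_ge0 => j _; exact: mexp_term_ge0.
rewrite sumEFin lee_fin -mulr_suml ler_wpM2r//.
exact: mx_exp_row_sum_le.
Qed.

Lemma mexp_fin_num A i j : mx_ge0 A -> mexp A i j \is a fin_num.
Proof.
move=> A0; rewrite ge0_fin_numE ?mexp_ge0//.
have Ac k : \sum_j A k j <= \sum_i \sum_j A i j.
  by rewrite [leRHS](bigD1 k)//= lerDl sumr_ge0// => ? _; exact: sumr_ge0.
apply: le_lt_trans (ltry (expR (\sum_i \sum_j A i j))).
apply: le_trans (mexp_row_sum_le i A0 Ac).
by rewrite (bigD1 j)//= leeDl// sume_ge0// => k _; exact: mexp_ge0.
Qed.

(** Commutation gives the binomial formula, whose terms divided by N! are the antidiagonals of the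
    Cauchy product; nonnegativity takes the place of absolute convergence. *)
Lemma mexpD A B i j : mx_ge0 A -> mx_ge0 B -> GRing.comm A B ->
  mexp (A + B) i j = (\sum_k mexp A i k * mexp B k j)%E.
Proof.
move=> A0 B0 AB; rewrite /mexp.
transitivity (\sum_(0 <= l <oo) \sum_(0 <= m <oo)
   (\sum_k ((A ^+ l) i k / l`!%:R) * ((B ^+ m) k j / m`!%:R))%:E)%E.
  rewrite -nneseries_antidiagonal; last first.
    move=> l m; rewrite lee_fin sumr_ge0// => k _.
    by rewrite mulr_ge0// -lee_fin mexp_term_ge0.
  apply: eq_eseriesr => N _; rewrite sumEFin; congr EFin.
  rewrite exprDn_comm// summxE mulr_suml big_mkord.
  apply: eq_bigr => m _.
  rewrite mulmxnE mxE -[_ *+ 'C(_, _)]mulr_natl.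
  rewrite -mulrA mulr_suml mulr_sumr.
  apply: eq_bigr => k _.
  have mN : (m <= N)%N by rewrite -ltnS.
  rewrite -(bin_fact mN) !natrM.
  have := fact_gt0 m; have := fact_gt0 (N - m); have : (0 < 'C(N, m))%N by rewrite bin_gt0.
  rewrite -!(ltr0n R) => h1 h2 h3; field.
  by rewrite !gt_eqF.
transitivity (\sum_(0 <= l <oo)
   (\sum_k ((A ^+ l) i k / l`!%:R)%:E * mexp B k j))%E.
  apply: eq_eseriesr => l _.
  rewrite -(eq_eseriesr (f := fun m => \sum_k
      ((A ^+ l) i k / l`!%:R * ((B ^+ m) k j / m`!%:R))%:E)%E); last first.
    by move=> m _; rewrite sumEFin.
  rewrite nneseries_sum => [|k m _]; last first.
    by rewrite lee_fin mulr_ge0// -lee_fin mexp_term_ge0.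
  apply: eq_bigr => k _; under eq_eseriesr do rewrite EFinM.
  by rewrite nneseriesZl// => m _; exact: mexp_term_ge0.
rewrite nneseries_sum => [|k m _]; last first.
  by rewrite mule_ge0 ?mexp_term_ge0 ?mexp_ge0.
apply: eq_bigr => k _.
have [r rE] : exists r, mexp B k j = r%:E.
  by exists (fine (mexp B k j)); rewrite fineK// mexp_fin_num.
rewrite -/(mexp B k j) rE muleC -nneseriesZl => [|l _]; last exact: mexp_term_ge0.
by apply: eq_eseriesr => l _; rewrite muleC.
Qed.

Lemma mexp_scalar (c : R) i j : 0 <= c ->
  mexp c%:M i j = (if i == j then expR c else 0)%:E.
Proof.
move=> c0; rewrite /mexp; transitivity (\sum_(0 <= m <oo)
    (if i == j then c ^+ m / m`!%:R else 0)%:E)%E.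
  apply: eq_eseriesr => m _; congr EFin.
  have -> : (c%:M : 'M[R]_n.+1) ^+ m = (c ^+ m)%:M.
    elim: m => [|m IH]; first by rewrite !expr0.
    by rewrite !exprS IH [RHS]scalar_mxM.
  by rewrite mxE; case: eqP => //=; rewrite ?mulr0n ?mul0r.
case: eqP => _; first exact: nneseries_expR.
by rewrite eseries0.
Qed.

(** This is what lets the uniformization rate of a truncated generator be changed. *)
Lemma mexp_shift A (c : R) i j : mx_ge0 A -> 0 <= c ->
  mexp (c%:M + A) i j = ((expR c)%:E * mexp A i j)%E.
Proof.
move=> A0 c0; rewrite mexpD//; last exact/comm_mx_sym/comm_mx_scalar.
  rewrite (bigD1 i)//= big1 ?adde0 => [|k ki].
    by rewrite mexp_scalar// eqxx.
  by rewrite mexp_scalar// eq_sym (negbTE ki) mul0e.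
by move=> k l; rewrite mxE; case: eqP.
Qed.

End MatrixExponential.

(** * Truncated generators and their limit *)

Section Generator.
Variables (R : realType) (a b : nat -> R).
Hypothesis a0 : a 0%N = 0.
Hypothesis a_gt0 : forall k, (1 <= k)%N -> 0 < a k.
Hypothesis b_gt0 : forall k, 0 < b k.

(** The generator applied to [v]. At [i = 0] the predecessor is again [0], so the first difference
    vanishes without a case distinction. *)
Definition bd_gen (v : nat -> R) (i : nat) : R :=
  a i * (v i.-1 - v i) + b i * (v i.+1 - v i).

Lemma bd_gen_comb v w c i :
  bd_gen (fun k => v k + c * w k) i = bd_gen v i + c * bd_gen w i.
Proof. by rewrite /bd_gen; ring. Qed.

Lemma bd_gen_affine e c v i : bd_gen (fun k => e + c * v k) i = c * bd_gen v i.
Proof. by rewrite /bd_gen; ring. Qed.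

Lemma a_ge0 k : 0 <= a k.
Proof. by case: k => [|k]; rewrite ?a0// ltW// a_gt0. Qed.

Lemma bd_matrix_offdiag_ge0 i j : i != j -> 0 <= bd_matrix a b i j.
Proof.
move=> ij; rewrite /bd_matrix eq_sym (negbTE ij).
case: ifP => _; first by rewrite ltW.
by case: ifP => _; rewrite ?a_ge0.
Qed.

Lemma sum_bd_matrix (v : nat -> R) i N : (i.+1 < N)%N ->
  \sum_(0 <= j < N) bd_matrix a b i j * v j = bd_gen v i.
Proof.
move=> iN; have iN' : (i < N)%N := ltnW iN.
(* The three diagonals as indicators. For [i = 0] the index [i.-1] falls on the main diagonal, where
   the extra term is zero because [a 0 = 0]. *)
transitivity (\sum_(0 <= j < N) ((if j == i then - (a i + b i) * v j else 0)
    + (if j == i.+1 then b i * v j else 0)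
    + (if j == i.-1 then a i * v j else 0))).
  apply: eq_bigr => j _; rewrite /bd_matrix.
  have [ij|ij|ij] := ltngtP j i.
  - rewrite (ltn_eqF (ltn_trans ij (ltnSn i))) !add0r.
    case: i iN iN' ij => // i _ _ ij; rewrite eqSS eq_sym.
    by case: eqP; rewrite ?mul0r.
  - rewrite add0r; have -> : (j == i.-1) = false.
      by rewrite gtn_eqF// (leq_ltn_trans (leq_pred i)).
    have -> : (i == j.+1) = false by rewrite ltn_eqF// (ltn_trans ij).
    by case: eqP => _; rewrite ?mul0r addr0.
  - rewrite ij ltn_eqF// addr0.
    case: i {iN iN'} ij => [|i] ij; first by rewrite a0 mul0r addr0.
    by rewrite gtn_eqF ?addr0.
rewrite !big_split/= -!big_mkcond !big_nat1_eq/= iN iN'.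
rewrite (leq_ltn_trans (leq_pred i) iN') /bd_gen; ring.
Qed.

Lemma bd_matrix_row_sum i N : (i.+1 < N)%N ->
  \sum_(0 <= j < N) bd_matrix a b i j = 0.
Proof.
move=> iN; have := sum_bd_matrix (fun=> 1) iN.
rewrite /bd_gen !subrr !mulr0 addr0 => H.
by rewrite -[RHS]H; apply: eq_bigr => j _; rewrite mulr1.
Qed.

(** Cutting the row at [n] drops only an off-diagonal term, which is nonnegative. *)
Lemma trunc_sum_bd_matrix (v : nat -> R) i n : (i <= n)%N ->
  (forall k, 0 <= v k) -> \sum_(j < n.+1) bd_matrix a b i j * v j <= bd_gen v i.
Proof.
move=> iLn v0; rewrite -(@sum_bd_matrix v i n.+2)// big_nat_recr//= big_mkord.
by rewrite lerDl mulr_ge0// bd_matrix_offdiag_ge0// ltn_eqF.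
Qed.

(* The mean explosion time from [i]. *)
Definition mean_lifetime (i : nat) : R :=
  fine (\sum_(i <= k <oo) (2 * bd_sigma_term a b k)%:E)%E.

Section MeanLifetime.
Hypothesis sigma_fin : (bd_sigma a b < +oo)%E.

Let tail_ge0 i : (0 <= \sum_(i <= k <oo) (2 * bd_sigma_term a b k)%:E)%E.
Proof.
by apply: nneseries_ge0 => k _ _; rewrite lee_fin mulr_ge0// bd_sigma_term_ge0.
Qed.

Let total_fin : (\sum_(0 <= k <oo) (2 * bd_sigma_term a b k)%:E < +oo)%E.
Proof.
under eq_eseriesr do rewrite EFinM.
rewrite nneseriesZl => [|k _]; last by rewrite lee_fin bd_sigma_term_ge0.
by rewrite lte_mul_pinfty// ?lee_fin.
Qed.

Let tail_fin i : (\sum_(i <= k <oo) (2 * bd_sigma_term a b k)%:E)%E \is a fin_num.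
Proof.
rewrite ge0_fin_numE// (le_lt_trans _ total_fin)//.
rewrite [leRHS](@nneseries_split _ _ 0%N i) => [|k _]; last first.
  by rewrite lee_fin mulr_ge0// bd_sigma_term_ge0.
by rewrite add0n leeDr// sume_ge0// => k _; rewrite lee_fin mulr_ge0// bd_sigma_term_ge0.
Qed.

Lemma mean_lifetime_ge0 i : 0 <= mean_lifetime i.
Proof. exact: fine_ge0. Qed.

Lemma mean_lifetimeS i :
  mean_lifetime i = 2 * bd_sigma_term a b i + mean_lifetime i.+1.
Proof.
rewrite /mean_lifetime (@nneseries_split _ _ i 1) => [|k _]; last first.
  by rewrite lee_fin mulr_ge0// bd_sigma_term_ge0.
by rewrite addn1 big_nat1 fineD.
Qed.

Lemma mean_lifetime_cvg0 : mean_lifetime @ \oo --> (0 : R).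
Proof.
have := @nneseries_tail_cvg R (fun k => (2 * bd_sigma_term a b k)%:E) xpredT.
move=> /(_ total_fin) H; apply: fine_cvg.
by apply: H => k _; rewrite lee_fin mulr_ge0// bd_sigma_term_ge0.
Qed.

(** By [mE], b_k mu_k times the increment of [mean_lifetime] at [k] is minus the [mu]-mass of
    [0..k]; the factor 2 in its definition cancels the one in the scale. Two consecutive such values
    differ by -mu_i, and division by mu_i leaves -1. *)
Lemma bd_gen_mean_lifetime i : bd_gen mean_lifetime i = -1.
Proof.
have mE k : b k * (mean_lifetime k.+1 - mean_lifetime k) =
    - ((\sum_(0 <= l < k.+1) bd_mu a b l) / bd_mu a b k).
  rewrite [mean_lifetime k]mean_lifetimeS /bd_sigma_term bd_cS//.
  have := b_gt0 k; have := bd_mu_gt0 a_gt0 b_gt0 k.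
  set x := bd_mu a b k; set S := \sum_(0 <= _ < _) _ => x0 y0.
  by field; rewrite !gt_eqF.
rewrite /bd_gen mE; case: i => [|i].
  by rewrite a0 mul0r add0r big_nat1 divff// gt_eqF// bd_mu_gt0.
rewrite /= big_nat_recr//=.
have -> : a i.+1 * (mean_lifetime i - mean_lifetime i.+1) =
    (\sum_(0 <= l < i.+1) bd_mu a b l) / bd_mu a b i.+1.
  have aE : a i.+1 = b i * bd_mu a b i / bd_mu a b i.+1.
    by rewrite -bd_mu_balance// mulfK// gt_eqF// bd_mu_gt0.
  have H : b i * (mean_lifetime i - mean_lifetime i.+1) =
      (\sum_(0 <= l < i.+1) bd_mu a b l) / bd_mu a b i.
    by rewrite -[_ - _]opprB mulrN mE opprK.
  rewrite aE; move: H.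
  have := bd_mu_gt0 a_gt0 b_gt0 i; have := bd_mu_gt0 a_gt0 b_gt0 i.+1.
  set x := bd_mu a b i; set y := bd_mu a b i.+1; set S := \sum_(0 <= _ < _) _.
  set d := mean_lifetime i - _ => y0 x0 H.
  rewrite mulrAC [_ * x]mulrC -mulrA -mulrA (mulrA (b i)) H.
  by field; rewrite !gt_eqF.
have := bd_mu_gt0 a_gt0 b_gt0 i.+1.
set y := bd_mu a b i.+1; set S := \sum_(0 <= _ < _) _ => y0.
by field; rewrite gt_eqF.
Qed.

End MeanLifetime.
End Generator.

Section TruncatedSemigroup.
Variables (R : realType) (a b : nat -> R).
Hypothesis a0 : a 0%N = 0.
Hypothesis a_gt0 : forall k, (1 <= k)%N -> 0 < a k.
Hypothesis b_gt0 : forall k, 0 < b k.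

(** A bound for all exit rates up to [n]. The sum makes monotonicity in [n] immediate, and the 1
    makes it positive. *)
Definition unif_rate n : R := 1 + \sum_(0 <= k < n.+1) (a k + b k).

Definition unif_mx (q : R) n : 'M[R]_n.+1 :=
  q%:M + \matrix_(i, j) bd_matrix a b i j.

(* [exp (t Q_n)] for the n-th truncation [Q_n] of the generator, written
   [exp (- q t) exp (t (q + Q_n))] so that all the terms are nonnegative. *)
Definition trunc_exp (q : R) n (t : R) (i j : 'I_n.+1) : R :=
  expR (- (q * t)) * fine (mexp (t *: unif_mx q n) i j).

Lemma unif_rate_gt0 n : 0 < unif_rate n.
Proof.
rewrite ltr_pwDl// sumr_ge0// => k _.
by rewrite addr_ge0 ?(a_ge0 a0)// ltW.
Qed.

Lemma unif_rateS n : unif_rate n <= unif_rate n.+1.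
Proof.
rewrite /unif_rate [in leRHS]big_nat_recr//= addrA lerDl.
by rewrite addr_ge0 ?(a_ge0 a0)// ltW.
Qed.

Lemma le_unif_rate n k : (k <= n)%N -> a k + b k <= unif_rate n.
Proof.
move=> kn; rewrite /unif_rate big_mkord (bigD1 (Ordinal (kn : (k < n.+1)%N)))//=.
set x := \sum_(_ < _ | _) _; have : 0 <= x; last lra.
by apply: sumr_ge0 => l _; rewrite addr_ge0 ?(a_ge0 a0)// ltW.
Qed.

Section FixedTruncation.
Variables (q : R) (n : nat).
Hypothesis qn : unif_rate n <= q.
Local Notation B := (unif_mx q n).

Let q_ge0 : 0 <= q. Proof. by rewrite (le_trans _ qn)// ltW// unif_rate_gt0. Qed.

Lemma unif_mx_ge0 : mx_ge0 B.
Proof.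
move=> i j; rewrite !mxE.
have [<-|ij] := eqVneq i j.
  rewrite /bd_matrix eqxx mulr1n subr_ge0 (le_trans _ qn)// le_unif_rate//.
  by rewrite -ltnS.
by rewrite mulr0n add0r bd_matrix_offdiag_ge0.
Qed.

Let scale_ge0 t : 0 <= t -> mx_ge0 (t *: B).
Proof. by move=> t0 i j; rewrite mxE mulr_ge0// unif_mx_ge0. Qed.

Let fine_mexpK t i j : 0 <= t ->
  (fine (mexp (t *: B) i j))%:E = mexp (t *: B) i j.
Proof. by move=> t0; rewrite fineK// mexp_fin_num//; exact: scale_ge0. Qed.

Lemma unif_mx_sum (v : nat -> R) (i : 'I_n.+1) : (forall k, 0 <= v k) ->
  \sum_(j < n.+1) B i j * v j <= q * v i + bd_gen a b v i.
Proof.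
move=> v0; under eq_bigr do rewrite !mxE mulrDl.
rewrite big_split/= (bigD1 i)//= eqxx mulr1n [X in _ + X + _]big1 ?addr0.
  by rewrite lerD2l trunc_sum_bd_matrix// -ltnS.
by move=> j ji; rewrite eq_sym (negbTE ji) mulr0n mul0r.
Qed.

Lemma unif_mx_row_sum (i : 'I_n.+1) : \sum_(j < n.+1) B i j <= q.
Proof.
have := @unif_mx_sum (fun=> 1) i (fun=> ler01).
rewrite /bd_gen !subrr !mulr0 !addr0 mulr1.
by under eq_bigr do rewrite mulr1.
Qed.

Lemma trunc_exp_ge0 t (i j : 'I_n.+1) : 0 <= t -> 0 <= trunc_exp q t i j.
Proof.
move=> t0; rewrite mulr_ge0 ?expR_ge0// fine_ge0// mexp_ge0//.
exact: scale_ge0.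
Qed.

Lemma trunc_exp_row_sum t (i : 'I_n.+1) : 0 <= t -> \sum_j trunc_exp q t i j <= 1.
Proof.
move=> t0; rewrite -mulr_sumr -lee_fin EFinM -sumEFin.
under eq_bigr do rewrite fine_mexpK//.
apply: (@le_trans _ _ ((expR (- (q * t)))%:E * (expR (q * t))%:E)%E).
  apply: lee_wpmul2l; first by rewrite lee_fin expR_ge0.
  apply: mexp_row_sum_le => [|k]; first exact: scale_ge0.
  under eq_bigr do rewrite mxE.
  by rewrite -mulr_sumr mulrC ler_wpM2r// unif_mx_row_sum.
by rewrite -EFinM -expRD addNr expR0.
Qed.

Lemma trunc_expD s t (i j : 'I_n.+1) : 0 <= s -> 0 <= t ->
  trunc_exp q (s + t) i j = \sum_k trunc_exp q s i k * trunc_exp q t k j.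
Proof.
move=> s0 t0; apply: EFin_inj; rewrite /trunc_exp EFinM fine_mexpK ?addr_ge0//.
rewrite scalerDl mexpD; [|exact: scale_ge0|exact: scale_ge0|]; last first.
  by rewrite /GRing.comm -!scalerAl -!scalerAr scalerA mulrC -scalerA.
under eq_bigr do rewrite -fine_mexpK// -[X in (_ * X)%E]fine_mexpK// -EFinM.
rewrite sumEFin -EFinM; congr EFin; rewrite mulr_sumr; apply: eq_bigr => k _.
rewrite mulrACA -expRD; congr (expR _ * _); ring.
Qed.

Lemma trunc_exp0 (i j : 'I_n.+1) : trunc_exp q 0 i j = (i == j)%:R.
Proof.
rewrite /trunc_exp mulr0 oppr0 expR0 mul1r scale0r.
have -> : (0 : 'M[R]_n.+1) = 0%:M by rewrite raddf0.
by rewrite mexp_scalar// expR0; case: eqP.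
Qed.

(** From exp(-qt) >= 1 - qt and the first two terms of the exponential series. The matching upper
    bound comes later, from the row sums. *)
Lemma trunc_exp_ge t (i j : 'I_n.+1) : 0 <= t ->
  (i == j)%:R + t * bd_matrix a b i j - q * B i j * t ^+ 2
    <= trunc_exp q t i j.
Proof.
move=> t0; apply: (@le_trans _ _ ((1 - q * t) * ((i == j)%:R + t * B i j))).
  (* Expanding with B = q + Q_n shows that the two sides are equal. *)
  rewrite !mxE le_eqVlt; apply/orP; left; apply/eqP; ring.
apply: (@le_trans _ _ (expR (- (q * t)) * ((i == j)%:R + t * B i j))).
  rewrite ler_wpM2r//; last by rewrite -[1 - _]/(1 + - (q * t)) expR_ge1Dx.
  by rewrite addr_ge0// mulr_ge0// unif_mx_ge0.
rewrite ler_wpM2l ?expR_ge0// -lee_fin fine_mexpK//.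
apply: le_trans (nneseries_lim_ge 2 _); last first.
  by move=> k _ _; apply: mexp_term_ge0; exact: scale_ge0.
rewrite !big_nat_recr//= big_geq// add0e expr0 expr1 !mxE !divr1 -EFinD.
by [].
Qed.

(** Markov's inequality for the uniformized chain. Let r_m and S_m be the sums over j of the row [i]
    of B^m with weights 1 and s. Since B s <= q s - 1, S_{m+1} <= q S_m - r_m, while r_{m+1} <= q
    r_m. The induction carries the stronger bound (m+1) r_m + S_{m+1} <= q^(m+1) s_i. *)
Lemma unif_mx_exp_row_sum (s : nat -> R) (i : 'I_n.+1) m :
  (forall k, 0 <= s k) -> (forall k, bd_gen a b s k = -1) ->
  m.+1%:R * \sum_j (B ^+ m) i j <= q ^+ m.+1 * s i.
Proof.
move=> s0 sE; pose r m := \sum_j (B ^+ m) i j.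
pose S m := \sum_j (B ^+ m) i j * s j.
have Bm m' := mx_ge0_exp m' unif_mx_ge0.
have rS m' : r m'.+1 <= q * r m'.
  rewrite /r; under eq_bigr do rewrite exprSr mxE.
  rewrite exchange_big/= mulr_sumr; apply: ler_sum => k _.
  by rewrite -mulr_sumr mulrC ler_wpM2r// ?unif_mx_row_sum// Bm.
have SS m' : S m'.+1 <= q * S m' - r m'.
  rewrite /S; under eq_bigr do rewrite exprSr mxE mulr_suml.
  rewrite exchange_big/= mulr_sumr -sumrB; apply: ler_sum => k _.
  under eq_bigr do rewrite -mulrA.
  rewrite -mulr_sumr mulrCA -[X in _ - X]mulr1 -mulrBr ler_wpM2l ?Bm//.
  by rewrite (le_trans (unif_mx_sum _ s0))// sE.
have r0 m' : 0 <= r m' by apply: sumr_ge0 => k _; exact: Bm.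
have S0 m' : 0 <= S m' by apply: sumr_ge0 => k _; rewrite mulr_ge0 ?Bm.
suff : m.+1%:R * r m + S m.+1 <= q ^+ m.+1 * s i.
  by apply: le_trans; rewrite lerDl.
elim: m => [|m IH].
  have := SS 0%N; rewrite mul1r expr1.
  have -> : S 0%N = s i.
    rewrite /S (bigD1 i)//= expr0 mxE eqxx mul1r big1 ?addr0// => j ji.
    by rewrite mxE eq_sym (negbTE ji) mul0r.
  lra.
have := SS m.+1; have := rS m; rewrite [q ^+ m.+2]exprS -mulrA.
have := ler_wpM2l q_ge0 IH => H1 H2 H3.
apply: le_trans H1; rewrite mulrDr mulrCA.
have := ler_wpM2l (ler0n R m.+1) H2.
have -> : m.+2%:R = m.+1%:R + 1 :> R by rewrite -[in LHS]addn1 natrD.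
lra.
Qed.

(** The bound on (m+1) r_m says that the m-th term of the row sum of the exponential is at most s_i
    / t times the (m+1)-st term of the series of exp(qt). *)
Lemma trunc_exp_row_sum_le (s : nat -> R) t (i : 'I_n.+1) :
  (forall k, 0 <= s k) -> (forall k, bd_gen a b s k = -1) -> 0 < t ->
  \sum_j trunc_exp q t i j <= s i / t.
Proof.
move=> s0 sE t0; have t0' := ltW t0.
rewrite -mulr_sumr -lee_fin EFinM -sumEFin.
under eq_bigr do rewrite fine_mexpK//.
have H : (\sum_j mexp (t *: B) i j <= (s i / t * expR (q * t))%:E)%E.
  rewrite EFinM -nneseries_expR; last by rewrite mulr_ge0.
  rewrite -nneseries_sum => [|j k _]; last by apply: mexp_term_ge0; exact: scale_ge0.
  rewrite -nneseriesZl => [|k _]; last by rewrite lee_fin divr_ge0// exprn_ge0// mulr_ge0.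
  (* The comparison is between terms [m] and [m.+1], so a zero term is put in front of the left
     series. *)
  rewrite -(@nneseries_shift _ _ 1); last first.
    move=> m; apply: sume_ge0 => j _.
    by apply: mexp_term_ge0; exact: scale_ge0.
  apply: lee_nneseries => [k _ _|[|m] _]; first case: ifP => // _.
  - apply: sume_ge0 => j _; apply: mexp_term_ge0; exact: scale_ge0.
  - by rewrite -EFinM lee_fin mulr_ge0// divr_ge0// exprn_ge0// mulr_ge0.
  rewrite subSS subn0 /= sumEFin -EFinM lee_fin.
  under eq_bigr do rewrite exprZn mxE.
  rewrite -mulr_suml -mulr_sumr.
  have := unif_mx_exp_row_sum i m s0 sE; set r := \sum_j _ => Hr.
  rewrite exprMn [t ^+ m.+1]exprS factS natrM.
  have mf : 0 < (m`!)%:R :> R by rewrite ltr0n fact_gt0.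
  have m1 : 0 < (m.+1)%:R :> R by rewrite ltr0n.
  have -> : s i / t * (q ^+ m.+1 * (t * t ^+ m) / (m.+1%:R * m`!%:R)) =
      t ^+ m * (q ^+ m.+1 * s i / m.+1%:R) / m`!%:R.
    by field; rewrite !gt_eqF.
  rewrite ler_wpM2r ?invr_ge0// ler_wpM2l ?exprn_ge0//.
  by rewrite ler_pdivlMr// mulrC.
apply: le_trans (lee_wpmul2l _ H) _; first by rewrite lee_fin expR_ge0.
rewrite -EFinM lee_fin mulrCA -expRD addNr expR0 mulr1//.
Qed.

End FixedTruncation.
End TruncatedSemigroup.

Section LimitProcess.
Variables (R : realType) (a b : nat -> R).
Hypothesis a0 : a 0%N = 0.
Hypothesis a_gt0 : forall k, (1 <= k)%N -> 0 < a k.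
Hypothesis b_gt0 : forall k, 0 < b k.

Local Notation rate := (unif_rate a b).

(** In each matrix product the additional intermediate index contributes a nonnegative term, so
    powers grow with the truncation level. *)
Lemma mexp_le_widen n (A : 'M[R]_n.+1) (A' : 'M[R]_n.+2) :
  mx_ge0 A -> mx_ge0 A' ->
  (forall i j, A i j <= A' (widen_ord (leqnSn _) i) (widen_ord (leqnSn _) j)) ->
  forall i j, (mexp A i j <=
    mexp A' (widen_ord (leqnSn _) i) (widen_ord (leqnSn _) j))%E.
Proof.
move=> A0 A'0 AA'; pose w := widen_ord (leqnSn n.+1).
have H m i j : (A ^+ m) i j <= (A' ^+ m) (w i) (w j).
  elim: m i j => [|m IH] i j; first by rewrite !expr0 !mxE.
  rewrite !exprS !mxE [leRHS]big_ord_recr/= -[leLHS]addr0 lerD//.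
    apply: ler_sum => k _; apply: ler_pM => //.
    exact: mx_ge0_exp.
  by rewrite mulr_ge0// mx_ge0_exp.
move=> i j; apply: lee_nneseries => [k _ _|k _]; first exact: mexp_term_ge0.
by rewrite lee_fin ler_wpM2r.
Qed.

(** A larger rate multiplies the series by exp(t (q' - q)), which the prefactor cancels. Consecutive
    truncations can thus be compared at a common rate. *)
Lemma trunc_exp_rate (q q' : R) n t (i j : 'I_n.+1) : rate n <= q -> q <= q' ->
  0 <= t -> trunc_exp a b q t i j = trunc_exp a b q' t i j.
Proof.
move=> nq qq' t0; apply: EFin_inj; rewrite /trunc_exp !EFinM.
have qB : mx_ge0 (t *: unif_mx a b q n).
  by move=> k l; rewrite mxE mulr_ge0// unif_mx_ge0.
have q'B : mx_ge0 (t *: unif_mx a b q' n).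
  by move=> k l; rewrite mxE mulr_ge0// unif_mx_ge0// (le_trans nq).
rewrite !fineK ?mexp_fin_num//.
have -> : t *: unif_mx a b q' n = (t * (q' - q))%:M + t *: unif_mx a b q n.
  rewrite /unif_mx !scalerDr addrA !scale_scalar_mx -raddfD/= -mulrDr subrK.
  by [].
rewrite mexp_shift ?mulr_ge0 ?subr_ge0// muleA -EFinM -expRD.
by congr ((expR _)%:E * _)%E; ring.
Qed.

(** Extension by zero puts all truncations on the same index set, where they increase with [n]. *)
Definition trunc_proc n t i j : R :=
  if (i <= n)%N && (j <= n)%N
  then trunc_exp a b (rate n) t (inord i : 'I_n.+1) (inord j) else 0.

Lemma trunc_proc_ge0 n t i j : 0 <= t -> 0 <= trunc_proc n t i j.
Proof. by move=> t0; rewrite /trunc_proc; case: ifP => // _; exact: trunc_exp_ge0. Qed.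

Lemma trunc_procS n t i j : 0 <= t -> trunc_proc n t i j <= trunc_proc n.+1 t i j.
Proof.
move=> t0; rewrite {1}/trunc_proc; case: ifP => [/andP[iLn jn]|_]; last first.
  exact: trunc_proc_ge0.
rewrite /trunc_proc (leq_trans iLn)// (leq_trans jn)//=.
rewrite (@trunc_exp_rate _ (rate n.+1))//; last exact: unif_rateS.
have r1 : rate n <= rate n.+1 by exact: unif_rateS.
have B1 : mx_ge0 (t *: unif_mx a b (rate n.+1) n).
  by move=> k l; rewrite mxE mulr_ge0// unif_mx_ge0.
have B2 : mx_ge0 (t *: unif_mx a b (rate n.+1) n.+1).
  by move=> k l; rewrite mxE mulr_ge0// unif_mx_ge0.
have wE k : (k <= n)%N ->
    (inord k : 'I_n.+2) = widen_ord (leqnSn _) (inord k : 'I_n.+1).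
  by move=> kn; apply: val_inj; rewrite /= !inordK// ltnS// leqW.
rewrite /trunc_exp ler_wpM2l ?expR_ge0// fine_le ?mexp_fin_num//.
rewrite (wE i)// (wE j)//; apply: mexp_le_widen => // k l.
by rewrite !mxE.
Qed.

Lemma trunc_proc_sum n t i : 0 <= t ->
  \sum_(0 <= j < n.+1) trunc_proc n t i j =
  if (i <= n)%N
  then \sum_j trunc_exp a b (rate n) t (inord i : 'I_n.+1) j else 0.
Proof.
move=> t0; rewrite big_mkord; case: ifP => iLn; last first.
  by rewrite big1// => j _; rewrite /trunc_proc iLn.
by apply: eq_bigr => j _; rewrite /trunc_proc iLn -ltnS ltn_ord inord_val.
Qed.

Lemma trunc_proc_row_sum n t i N : 0 <= t ->
  \sum_(0 <= j < N) trunc_proc n t i j <= \sum_(0 <= j < n.+1) trunc_proc n t i j.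
Proof.
move=> t0; have p0 j : 0 <= trunc_proc n t i j by exact: trunc_proc_ge0.
have [Nn|nN] := leqP N n.+1.
  by rewrite [leRHS](big_cat_nat _ Nn)//= lerDl sumr_ge0.
rewrite (big_cat_nat _ (ltnW nN))//= gerDl big_nat big1// => j /andP[nj _].
by rewrite /trunc_proc [X in _ && X]leqNgt nj andbF.
Qed.

Lemma trunc_proc_row_sum_le1 n t i N : 0 <= t ->
  \sum_(0 <= j < N) trunc_proc n t i j <= 1.
Proof.
move=> t0; apply: le_trans (trunc_proc_row_sum n i N t0) _.
by rewrite trunc_proc_sum//; case: ifP => // _; exact: trunc_exp_row_sum.
Qed.

Lemma trunc_proc_row_sum_le n (s : nat -> R) t i N :
  (forall k, 0 <= s k) -> (forall k, bd_gen a b s k = -1) -> 0 < t ->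
  \sum_(0 <= j < N) trunc_proc n t i j <= s i / t.
Proof.
move=> s0 sE t0; apply: le_trans (trunc_proc_row_sum n i N (ltW t0)) _.
rewrite trunc_proc_sum; last exact: ltW.
case: ifP => iLn; last by rewrite divr_ge0// ltW.
have -> : s i = s (inord i : 'I_n.+1) by rewrite inordK.
exact: trunc_exp_row_sum_le.
Qed.

Lemma trunc_procD n s t i j : 0 <= s -> 0 <= t ->
  trunc_proc n (s + t) i j =
  \sum_(0 <= k < n.+1) trunc_proc n s i k * trunc_proc n t k j.
Proof.
move=> s0 t0; rewrite big_mkord /trunc_proc; case: ifP => [/andP[iLn jn]|ij].
  rewrite trunc_expD//; apply: eq_bigr => k _.
  by rewrite iLn jn -ltnS ltn_ord/= inord_val.
rewrite big1// => k _; rewrite -[(k <= n)%N]ltnS ltn_ord andbT/=.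
by move: ij; do 2 case: (_ <= n)%N; rewrite ?mul0r ?mulr0.
Qed.

Definition lim_proc t i j : R := limn (fun n => trunc_proc n t i j).

Lemma trunc_proc_nd t i j : 0 <= t ->
  nondecreasing_seq (fun n => trunc_proc n t i j).
Proof. by move=> t0; apply/nondecreasing_seqP => n; exact: trunc_procS. Qed.

Lemma trunc_proc_le1 n t i j : 0 <= t -> trunc_proc n t i j <= 1.
Proof.
move=> t0; have := trunc_proc_row_sum_le1 n i j.+1 t0.
apply: le_trans; rewrite big_nat_recr//= lerDr sumr_ge0// => k _.
exact: trunc_proc_ge0.
Qed.

Lemma trunc_proc_cvg t i j : 0 <= t ->
  trunc_proc n t i j @[n --> \oo] --> lim_proc t i j.
Proof.
move=> t0; apply: nondecreasing_is_cvgn; first exact: trunc_proc_nd.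
by exists 1 => _ [n _ <-]; exact: trunc_proc_le1.
Qed.

Lemma trunc_proc_le n t i j : 0 <= t -> trunc_proc n t i j <= lim_proc t i j.
Proof.
move=> t0; apply: (@nondecreasing_cvgn_le _ (fun n => trunc_proc n t i j)).
  exact: trunc_proc_nd.
by apply: cvgP; exact: trunc_proc_cvg.
Qed.

Lemma lim_proc_ge0 t i j : 0 <= t -> 0 <= lim_proc t i j.
Proof. by move=> t0; apply: le_trans (trunc_proc_le 0 i j t0); exact: trunc_proc_ge0. Qed.

Lemma lim_proc_sum_cvg t i N : 0 <= t ->
  \sum_(0 <= j < N) trunc_proc n t i j @[n --> \oo] -->
  \sum_(0 <= j < N) lim_proc t i j.
Proof.
move=> t0; elim: N => [|N IH].
  by under eq_fun do rewrite big_geq//; rewrite big_geq//; exact: cvg_cst.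
under eq_fun do rewrite big_nat_recr//=.
by rewrite big_nat_recr//=; apply: cvgD => //; exact: trunc_proc_cvg.
Qed.

Lemma lim_proc_row_sum_ub t i (M : R) : 0 <= t ->
  (forall n N, \sum_(0 <= j < N) trunc_proc n t i j <= M) ->
  (\sum_(0 <= j <oo) (lim_proc t i j)%:E <= M%:E)%E.
Proof.
move=> t0 HM; apply: lime_le.
  by apply: is_cvg_nneseries => k _ _; rewrite lee_fin lim_proc_ge0.
apply: nearW => N; rewrite sumEFin lee_fin.
have H := @lim_proc_sum_cvg t i N t0.
rewrite -(cvg_lim _ H)//; apply: limr_le; first exact: cvgP H.
exact: nearW.
Qed.

(** Monotone convergence in both directions: each truncated sum lies below the full series of
    limits, and each partial sum of that series is a limit of partial sums of truncations. *)
Lemma lim_procD s t i j : 0 <= s -> 0 <= t ->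
  ((lim_proc (s + t) i j)%:E =
   \sum_(0 <= k <oo) (lim_proc s i k * lim_proc t k j)%:E)%E.
Proof.
move=> s0 t0; have st0 := addr_ge0 s0 t0.
have p0 k : 0 <= lim_proc s i k * lim_proc t k j.
  by rewrite mulr_ge0// lim_proc_ge0.
apply/eqP; rewrite eq_le; apply/andP; split.
  have H := @trunc_proc_cvg _ i j st0.
  rewrite -(cvg_lim _ H)// -EFin_lim; last exact: cvgP H.
  apply: lime_le.
    by apply: (cvgP (lim_proc (s + t) i j)%:E); apply: cvg_EFin; [exact: nearW|exact: H].
  apply: nearW => n /=; rewrite trunc_procD// -sumEFin.
  apply: le_trans (nneseries_lim_ge n.+1 _) => [|k _ _]; last by rewrite lee_fin.
  apply: lee_sum => k _; rewrite lee_fin.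
  by apply: ler_pM; rewrite ?trunc_proc_ge0 ?trunc_proc_le.
apply: lime_le; first by apply: is_cvg_nneseries => k _ _; rewrite lee_fin.
apply: nearW => N; rewrite sumEFin lee_fin.
have H : \sum_(0 <= k < N) trunc_proc n s i k * trunc_proc n t k j @[n --> \oo]
    --> \sum_(0 <= k < N) lim_proc s i k * lim_proc t k j.
  elim: N => [|N IH].
    by under eq_fun do rewrite big_geq//; rewrite big_geq//; exact: cvg_cst.
  under eq_fun do rewrite big_nat_recr//=.
  rewrite big_nat_recr//=; apply: cvgD => //.
  by apply: cvgM; exact: trunc_proc_cvg.
rewrite -(cvg_lim _ H)//; apply: limr_le; first exact: cvgP H.
near=> n.
have Nn : (N <= n.+1)%N by near: n; exists N => // k /= Nk; rewrite (leq_trans Nk).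
apply: le_trans (trunc_proc_le n i j st0).
rewrite trunc_procD// [leRHS](big_cat_nat _ Nn)//= lerDl sumr_ge0// => k _.
by rewrite mulr_ge0 ?trunc_proc_ge0.
Unshelve. all: by end_near. Qed.

Lemma lim_proc0 i j : lim_proc 0 i j = (i == j)%:R.
Proof.
apply/cvg_lim => //; apply: cvg_near_cst; near=> n.
have iLn : (i <= n)%N by near: n; exists i.
have jn : (j <= n)%N by near: n; exists j.
rewrite /trunc_proc iLn jn trunc_exp0; congr (_%:R); congr nat_of_bool.
by apply/eqP/eqP => [/(congr1 val)|->//]; rewrite /= !inordK.
Unshelve. all: by end_near. Qed.

Lemma lim_proc_ge n t i j : (i <= n)%N -> (j <= n)%N -> 0 <= t ->
  (i == j)%:R + t * bd_matrix a b i j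
    - rate n * (rate n *+ (i == j) + bd_matrix a b i j) * t ^+ 2 <= lim_proc t i j.
Proof.
move=> iLn jn t0; apply: le_trans (trunc_proc_le n i j t0).
rewrite /trunc_proc iLn jn/=.
apply: le_trans (trunc_exp_ge _ _ _ _ _ _ _) => //.
have E : ((inord i : 'I_n.+1) == inord j) = (i == j).
  by apply/eqP/eqP => [/(congr1 val)|->//]; rewrite /= !inordK.
by rewrite !mxE !inordK// E.
Qed.

(** Rows of Q sum to zero, so the lower bounds of [lim_proc_ge] over the first N columns sum to 1 -
    S t^2. The row of [lim_proc] has mass at most 1, hence no entry can exceed its lower bound by
    more than S t^2. *)
Lemma lim_proc_near0 i j : exists C : R, 0 <= C /\ forall t, 0 <= t ->
  `|lim_proc t i j - (i == j)%:R - t * bd_matrix a b i j| <= C * t ^+ 2.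
Proof.
(* Large enough for the first N columns to contain the column [j] and the whole support of the row
   [i] of Q. *)
pose N := (maxn i j).+2.
have iN : (i < N.-1)%N by rewrite ltnS leq_maxl.
have jN : (j < N)%N by rewrite ltnS (leq_trans (leq_maxr i j)).
pose C k := rate N * (rate N *+ (i == k) + bd_matrix a b i k).
have C0 k : (k < N)%N -> 0 <= C k.
  move=> kN; have := @unif_mx_ge0 _ _ _ a0 a_gt0 b_gt0 (rate N) N (lexx _) (inord i) (inord k).
  have rN := unif_rate_gt0 a0 a_gt0 b_gt0 N.
  rewrite !mxE !inordK; [|by rewrite ltnS ltnW| by rewrite ltnS (leq_trans (leq_maxl i j))// ltnW].
  have -> : ((inord i : 'I_N.+1) == inord k) = (i == k).
    apply/eqP/eqP => [/(congr1 val)|->//].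
    by rewrite /= !inordK // ltnS ?(ltnW kN)// (leq_trans (leq_maxl i j))// ltnW.
  by move=> H; rewrite mulr_ge0// ltW.
have lb k t : (k < N)%N -> 0 <= t ->
    (i == k)%:R + t * bd_matrix a b i k - C k * t ^+ 2 <= lim_proc t i k.
  move=> kN t0; apply: lim_proc_ge => //; last exact: ltnW.
  by rewrite (leq_trans (leq_maxl i j))// ltnW.
pose S := \sum_(0 <= k < N) C k.
have S0 : 0 <= S.
  by rewrite /S big_nat_cond sumr_ge0// => k /andP[/andP[_ kN] _]; exact: C0.
have CS : C j <= S.
  rewrite /S big_mkord (bigD1 (Ordinal jN))//= lerDl sumr_ge0// => k _.
  exact: C0.
exists S; split => // t t0; have t20 : 0 <= t ^+ 2 by exact: exprn_ge0.
have H1 := lb j t jN t0; have H2 : C j * t ^+ 2 <= S * t ^+ 2 by rewrite ler_wpM2r.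
have H3 : \sum_(0 <= k < N) lim_proc t i k <= 1.
  rewrite -lee_fin -sumEFin.
  apply: le_trans (nneseries_lim_ge N _) _ => [k _ _|].
    by rewrite lee_fin lim_proc_ge0.
  by apply: lim_proc_row_sum_ub => // n M; exact: trunc_proc_row_sum_le1.
have H4 : 1 - S * t ^+ 2 = \sum_(0 <= k < N)
    ((i == k)%:R + t * bd_matrix a b i k - C k * t ^+ 2).
  rewrite sumrB big_split/= -mulr_sumr -mulr_suml bd_matrix_row_sum//.
  rewrite mulr0 addr0; congr (_ - _).
  rewrite big_mkord (bigD1 (Ordinal (ltn_trans iN (ltnSn _))))//= eqxx.
  rewrite big1 ?addr0// => k; rewrite -val_eqE/= => ki.
  by rewrite eq_sym (negbTE ki).
move: H3 H4; rewrite !big_mkord (bigD1 (Ordinal jN))//= => H3.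
rewrite (bigD1 (Ordinal jN))//= => H4.
have H5 : \sum_(k < N | k != Ordinal jN)
    ((i == k)%:R + t * bd_matrix a b i k - C k * t ^+ 2) <=
    \sum_(k < N | k != Ordinal jN) lim_proc t i k.
  by apply: ler_sum => k _; exact: lb.
rewrite ler_norml; apply/andP; split; first lra.
have : 0 <= C j * t ^+ 2 by rewrite mulr_ge0// C0.
lra.
Qed.

(** This makes [lim_proc] a competitor in the definition of minimality, so that [pmin] inherits its
    row-sum bound. *)
Lemma lim_proc_Q_process : Q_process a b lim_proc.
Proof.
split.
- split; first by move=> t i j; exact: lim_proc_ge0.
  + move=> t i t0; apply: lim_proc_row_sum_ub => // n N.
    exact: trunc_proc_row_sum_le1.
  + by move=> s t i j; exact: lim_procD.
- move=> i j; have [C [C0 HC]] := lim_proc_near0 i j.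
  set d := (i == j)%:R; set m := bd_matrix a b i j in HC.
  have H0 (k : R) : (fun t : R => k * t) @ 0^'+ --> k * 0.
    by apply: cvgM; [exact: cvg_cst|apply: cvg_within_filter; exact: cvg_id].
  apply: (@squeeze_cvgr _ _ _ _ (fun t => d + t * m - (C * t) * t)
     (fun t => d + t * m + (C * t) * t)).
  + near=> t; have t0 : 0 <= t by [].
    have := HC t t0; rewrite ler_norml => /andP[]; rewrite -/d expr2; lra.
  + rewrite -[X in _ --> X](_ : d + 0 * m - (C * 0) * 0 = d); last by ring.
    apply: cvgB; last by apply: cvgM; [exact: H0|apply: cvg_within_filter; exact: cvg_id].
    apply: cvgD; first exact: cvg_cst.
    by apply: cvgMl; apply: cvg_within_filter; exact: cvg_id.
  + rewrite -[X in _ --> X](_ : d + 0 * m + (C * 0) * 0 = d); last by ring.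
    apply: cvgD; last by apply: cvgM; [exact: H0|apply: cvg_within_filter; exact: cvg_id].
    apply: cvgD; first exact: cvg_cst.
    by apply: cvgMl; apply: cvg_within_filter; exact: cvg_id.
- move=> i j; have [C [C0 HC]] := lim_proc_near0 i j.
  rewrite lim_proc0; set d := (i == j)%:R in HC *; set m := bd_matrix a b i j in HC *.
  have H0 (k : R) : (fun t : R => k * t) @ 0^'+ --> k * 0.
    by apply: cvgM; [exact: cvg_cst|apply: cvg_within_filter; exact: cvg_id].
  apply: (@squeeze_cvgr _ _ _ _ (fun t => m - C * t) (fun t => m + C * t)).
  + near=> t; have t0 : 0 < t by [].
    have := HC t (ltW t0); rewrite ler_norml => /andP[].
    rewrite ler_pdivlMr// ler_pdivrMr// expr2; lra.
  + rewrite -[X in _ --> X](_ : m - C * 0 = m); last by ring.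
    by apply: cvgB; [exact: cvg_cst|exact: H0].
  + rewrite -[X in _ --> X](_ : m + C * 0 = m); last by ring.
    by apply: cvgD; [exact: cvg_cst|exact: H0].
Unshelve. all: by end_near. Qed.

Lemma lim_proc_row_sum_le (s : nat -> R) t i :
  (forall k, 0 <= s k) -> (forall k, bd_gen a b s k = -1) -> 0 < t ->
  (\sum_(0 <= j <oo) (lim_proc t i j)%:E <= (s i / t)%:E)%E.
Proof.
move=> s0 sE t0; apply: lim_proc_row_sum_ub; first exact: ltW.
by move=> n N; exact: trunc_proc_row_sum_le.
Qed.

End LimitProcess.

(** * Laplace transforms of Q-processes *)

Section LaplaceIntegral.
Variable R : realType.
Local Notation leb := (@lebesgue_measure R).
Local Open Scope ereal_scope.

Lemma measurable_expRM (al : R) : measurable_fun setT (fun t : R => expR (al * t)).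
Proof.
apply: continuous_measurable_fun => t.
apply: continuous_comp; last exact: continuous_expR.
by apply: continuousM => //; exact: cst_continuous.
Qed.

(** Extended-valued, so that Tonelli's theorem and sums of nonnegative terms apply without
    integrability conditions. *)
Definition elaplace (al : R) (f : R -> \bar R) : \bar R :=
  \int[leb]_(t in `[0%R, +oo[) ((expR (- al * t))%:E * f t).

Lemma elaplace_cst (al : R) : (0 < al)%R -> elaplace al (cst 1) = (al^-1)%:E.
Proof.
move=> al0; have := integral_exponential_pdf al0.
have -> : (fun x => (exponential_pdf al x)%:E) =
    ((fun x : R => (al * expR (- al * x))%:E) \_ `[0%R, +oo[).
  by apply/funext => x; rewrite restrict_EFin.
rewrite -integral_mkcond; under eq_integral do rewrite EFinM.
rewrite ge0_integralZl//; last 2 first.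
- by apply/measurable_EFinP; apply: measurable_funTS; exact: measurable_expRM.
- by rewrite lee_fin ltW.
move=> H; rewrite /elaplace; under eq_integral do rewrite mule1.
rewrite -[LHS]mul1e -[X in X%:E * _](mulVf (lt0r_neq0 al0)).
by rewrite EFinM -muleA H mule1.
Qed.

Lemma elaplace_ge0 al f : (forall t, (0 <= t)%R -> 0 <= f t) ->
  0 <= elaplace al f.
Proof.
move=> f0; apply: integral_ge0 => t /=; rewrite in_itv/= andbT => t0.
by rewrite mule_ge0 ?f0// lee_fin expR_ge0.
Qed.

Lemma measurable_elaplace (al : R) (f : R -> \bar R) (D : set R) :
  measurable_fun D f -> measurable_fun D (fun t => (expR (- al * t))%:E * f t).
Proof.
move=> mf; apply: emeasurable_funM => //.
by apply/measurable_EFinP; apply: measurable_funTS; exact: measurable_expRM.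
Qed.

Lemma le_elaplace al f g : (forall t, (0 <= t)%R -> 0 <= f t) ->
  measurable_fun (`[0%R, +oo[ : set R) f -> measurable_fun (`[0%R, +oo[ : set R) g ->
  (forall t, (0 <= t)%R -> f t <= g t) -> elaplace al f <= elaplace al g.
Proof.
move=> f0 mf mg fg; apply: ge0_le_integral => //.
- move=> t /=; rewrite in_itv/= andbT => t0.
  by rewrite mule_ge0 ?f0// lee_fin expR_ge0.
- exact: measurable_elaplace.
- exact: measurable_elaplace.
- move=> t /=; rewrite in_itv/= andbT => t0.
  by rewrite lee_wpmul2l ?fg// lee_fin expR_ge0.
Qed.

Lemma elaplaceZ al (c : R) f : (0 <= c)%R -> (forall t, (0 <= t)%R -> 0 <= f t) ->
  measurable_fun (`[0%R, +oo[ : set R) f ->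
  elaplace al (fun t => c%:E * f t) = c%:E * elaplace al f.
Proof.
move=> c0 f0 mf; rewrite /elaplace -ge0_integralZl//.
- by apply: eq_integral => t _; rewrite muleCA.
- exact: measurable_elaplace.
- move=> t /=; rewrite in_itv/= andbT => t0.
  by rewrite mule_ge0 ?f0// lee_fin expR_ge0.
Qed.

Lemma elaplace_nneseries al (f : nat -> R -> \bar R) :
  (forall k t, (0 <= t)%R -> 0 <= f k t) ->
  (forall k, measurable_fun (`[0%R, +oo[ : set R) (f k)) ->
  elaplace al (fun t => \sum_(0 <= k <oo) f k t) =
  \sum_(0 <= k <oo) elaplace al (f k).
Proof.
move=> f0 mf; rewrite /elaplace -integral_nneseries//; last 2 first.
- by move=> k; exact: measurable_elaplace.
- move=> k t /=; rewrite in_itv/= andbT => t0.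
  by rewrite mule_ge0 ?f0// lee_fin expR_ge0.
apply: eq_integral => t; rewrite inE/= in_itv/= andbT => t0.
by rewrite nneseriesZl// => k _; exact: f0.
Qed.

Definition shift_fun (c : R) : measurableTypeR R -> measurableTypeR R :=
  fun t => (t - c)%R.

Lemma measurable_shift_fun c : measurable_fun setT (shift_fun c).
Proof. by apply: measurable_funB. Qed.

HB.instance Definition _ c :=
  isMeasurableFun.Build _ _ _ _ (shift_fun c) (measurable_shift_fun c).

Lemma lebesgue_measure_shift (c : R) (A : set R) : measurable A ->
  pushforward leb (shift_fun c) A = leb A.
Proof.
move=> mA; apply/esym/lebesgue_measure_unique => //= _ [[x y]] _ <-.
rewrite /pushforward/=.
have -> : shift_fun c @^-1` `]x, y] = [set` `](x + c)%R, (y + c)%R]].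
  by apply/seteqP; split => t /=; rewrite /shift_fun !in_itv/= ltrBrDr lerBlDr.
rewrite !lebesgue_measure_itv/= !lte_fin ltrD2r; case: ifP => // _.
by rewrite -!EFinB; congr EFin; ring.
Qed.

Lemma ge0_integral_shift (c : R) (f : R -> \bar R) :
  measurable_fun setT f -> (forall t, 0 <= f t) ->
  \int[leb]_(t in `[c, +oo[) f (t - c)%R = \int[leb]_(t in `[0%R, +oo[) f t.
Proof.
move=> mf f0.
have -> : `[c, +oo[%classic = shift_fun c @^-1` (`[0%R, +oo[ : set R).
  by apply/seteqP; split => t /=; rewrite /shift_fun !in_itv/= !andbT subr_ge0.
transitivity (\int[pushforward leb (shift_fun c)]_(t in `[0%R, +oo[) f t).
  rewrite (ge0_integral_pushforward (measurable_shift_fun c))//.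
  exact: measurable_funTS.
by apply: eq_measure_integral => //= A mA _; exact: lebesgue_measure_shift.
Qed.

Lemma elaplace_shift al (c : R) (f : R -> \bar R) :
  measurable_fun setT f -> (forall t, 0 <= f t) ->
  \int[leb]_(t in `[c, +oo[) ((expR (- al * t))%:E * f (t - c)%R) =
  (expR (- al * c))%:E * elaplace al f.
Proof.
move=> mf f0; rewrite /elaplace.
have f0' t : 0 <= (expR (- al * t))%:E * f t.
  by rewrite mule_ge0// lee_fin expR_ge0.
rewrite -(@ge0_integral_shift c)//; last exact: measurable_elaplace.
rewrite -ge0_integralZl//; last first.
  have mF : measurable_fun setT (fun t => (expR (- al * t))%:E * f t).
    exact: measurable_elaplace.
  exact: (measurableT_comp mF (measurable_funTS (measurable_shift_fun c))).
by apply: eq_integral => t _; rewrite muleA -EFinM -expRD; congr ((expR _)%:E * _); ring.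
Qed.

Lemma elaplace_split al (c : R) (f : R -> \bar R) : (0 <= c)%R ->
  measurable_fun (`[0%R, +oo[ : set R) f -> (forall t, (0 <= t)%R -> 0 <= f t) ->
  elaplace al f = \int[leb]_(t in `[0%R, c[) ((expR (- al * t))%:E * f t)
                + \int[leb]_(t in `[c, +oo[) ((expR (- al * t))%:E * f t).
Proof.
move=> c0 mf f0; rewrite /elaplace.
have -> : `[0%R, +oo[%classic = `[0%R, c[ `|` `[c, +oo[ :> set R.
  apply/seteqP; split => t /=; rewrite !in_itv/= !andbT.
    by move=> t0; rewrite t0/=; case: (ltP t c); [left|right].
  by move=> [/andP[]//|]; exact: le_trans.
rewrite ge0_integral_setU//.
- apply: measurable_elaplace.
  apply: measurable_funS mf => // t /=; rewrite !in_itv/= !andbT.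
  by move=> [/andP[]//|]; exact: le_trans.
- move=> t /=; rewrite !in_itv/= andbT => H.
  rewrite mule_ge0 ?lee_fin ?expR_ge0// f0//.
  by case: H => [/andP[]//|]; exact: le_trans.
- apply/disj_setPS => t /= []; rewrite !in_itv/= andbT => /andP[_ tc].
  by rewrite leNgt tc.
Qed.

End LaplaceIntegral.

Section QProcessFacts.
Variables (R : realType) (a b : nat -> R) (p : R -> nat -> nat -> R).
Hypothesis hQ : Q_process a b p.

Let hT : transition_matrix p. Proof. by case: hQ. Qed.

Lemma Q_process_ge0 t i j : 0 <= t -> 0 <= p t i j.
Proof. by case: hT => + _ _; exact. Qed.

Lemma Q_process_row_sum t i N : 0 <= t -> \sum_(0 <= j < N) p t i j <= 1.
Proof.
move=> t0; rewrite -lee_fin -sumEFin.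
apply: le_trans (nneseries_lim_ge N _) _ => [k _ _|].
  by rewrite lee_fin Q_process_ge0.
by case: hT => _ + _; exact.
Qed.

Lemma Q_process_le1 t i j : 0 <= t -> p t i j <= 1.
Proof.
move=> t0; apply: le_trans (Q_process_row_sum i j.+1 t0).
by rewrite big_nat_recr//= lerDr sumr_ge0// => k _; exact: Q_process_ge0.
Qed.

(** Standardness concerns positive times only. The value at 0 is recovered from the difference
    quotient: its convergence forces p t - p 0 to tend to 0. *)
Lemma Q_process0 i j : p 0 i j = (i == j)%:R.
Proof.
have [_ hS hD] := hQ.
have H : p t i j - p 0 i j @[t --> 0^'+] --> (0 : R).
  rewrite -[X in _ --> X](mulr0 (bd_matrix a b i j)).
  apply: (@cvg_trans _ ((p t i j - p 0 i j) / t * t @[t --> 0^'+])).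
    apply: near_eq_cvg; near=> t; rewrite divfK// gt_eqF//.
  by apply: cvgM; [exact: hD|apply: cvg_within_filter; exact: cvg_id].
have H' : p t i j - p 0 i j @[t --> 0^'+] --> (i == j)%:R - p 0 i j.
  by apply: cvgB; [exact: hS|exact: cvg_cst].
have E : (i == j)%:R - p 0 i j = 0.
  by rewrite -(cvg_lim (@Rhausdorff R) H') (cvg_lim (@Rhausdorff R) H).
by apply/esym/eqP; rewrite -subr_eq0 E.
Unshelve. all: by end_near. Qed.

(** In Chapman-Kolmogorov over the first time span [s], staying at [i] contributes
    [p s i i * p t i j] and all other states together at most [1 - p s i i]. The resulting modulus
    is uniform in [t] and [j]. *)
Lemma Q_process_modulus s t i j : 0 <= s -> 0 <= t ->
  `|p (s + t) i j - p t i j| <= 1 - p s i i.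
Proof.
move=> s0 t0; case: (hT) => _ _ CK.
have p0 k : 0 <= p s i k * p t k j by rewrite mulr_ge0 ?Q_process_ge0.
have := Q_process_le1 i i s0; have := Q_process_le1 i j t0.
have := Q_process_ge0 i i s0; have := Q_process_ge0 i j t0 => h1 h2 h3 h4.
have lb : p s i i * p t i j <= p (s + t) i j.
  rewrite -lee_fin CK//; apply: le_trans (nneseries_lim_ge i.+1 _).
    by rewrite big_nat_recr//= leeDr// sume_ge0// => k _; rewrite lee_fin.
  by move=> k _ _; rewrite lee_fin.
have ub : p (s + t) i j <= p s i i * p t i j + (1 - p s i i).
  rewrite -lee_fin CK//; apply: lime_le.
    by apply: is_cvg_nneseries => k _ _; rewrite lee_fin.
  near=> N; have iN : (i < N)%N by near: N; exists i.+1.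
  rewrite sumEFin lee_fin big_mkord (bigD1 (Ordinal iN))//= lerD2l.
  apply: (@le_trans _ _ (\sum_(k < N | k != Ordinal iN) p s i k)).
    apply: ler_sum => k _; rewrite -[leRHS]mulr1 ler_wpM2l ?Q_process_ge0//.
    exact: Q_process_le1.
  have := Q_process_row_sum i N s0; rewrite big_mkord (bigD1 (Ordinal iN))//=.
  lra.
rewrite ler_norml; apply/andP; split; nra.
Unshelve. all: by end_near. Qed.

Lemma Q_process_near0 i j : exists C, exists2 eta, 0 < eta &
  0 <= C /\ forall t, 0 <= t -> t < eta -> `|p t i j - (i == j)%:R| <= C * t.
Proof.
have [_ _ hD] := hQ; have := hD i j => /cvgrPdist_lt/(_ 1 ltr01).
rewrite near_withinE => -[eta/= eta0 H].
exists (`|bd_matrix a b i j| + 1), eta => //; split; first by rewrite addr_ge0.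
move=> t; rewrite le_eqVlt => /predU1P[<- _|t0 te].
  by rewrite Q_process0 subrr normr0 mulr0.
have := H t; rewrite /= sub0r normrN gtr0_norm// Q_process0 => /(_ te t0).
set x := (_ - _) / t; set y := bd_matrix a b i j => H1.
rewrite -ler_pdivrMr// -[X in _ / X]gtr0_norm// -normf_div -/x.
have -> : x = y - (y - x) by ring.
by apply: le_trans (ler_normB _ _) _; rewrite lerD2l ltW.
Qed.

(** Negative times are unconstrained; the absolute value gives a function that is continuous, hence
    measurable, on the whole line. *)
Lemma Q_process_continuous i j : continuous (fun t : R => p `|t| i j).
Proof.
move=> x; apply/cvgrPdist_lt => e e0.
have [C [eta eta0 [C0 HC]]] := Q_process_near0 i i.
have eC : 0 < e / (C + 1) by rewrite divr_gt0// ltr_wpDl.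
near=> y; have := Q_process_modulus.
have xy : `|x - y| < Num.min eta (e / (C + 1)).
  near: y; apply: (@nbhsx_ballx _ R^o x (Num.min eta (e / (C + 1)))).
  by rewrite lt_min eta0.
move: xy; rewrite lt_min => /andP[xy1 xy2] M.
pose s := `| `|x| - `|y| |; have s0 : 0 <= s by exact: normr_ge0.
have sxy : s <= `|x - y| by exact: ler_dist_dist.
have H : `|p `|x| i j - p `|y| i j| <= 1 - p s i i.
  have [xLy|yLx] := leP `|x| `|y|.
    have sE : s = `|y| - `|x| by rewrite /s distrC ger0_norm ?subr_ge0.
    by have := M s `|x| i j s0 (normr_ge0 _); rewrite {1}sE subrK distrC.
  have sE : s = `|x| - `|y| by rewrite /s ger0_norm// subr_ge0 ltW.
  by have := M s `|y| i j s0 (normr_ge0 _); rewrite {1}sE subrK.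
apply: le_lt_trans H _.
have := HC s s0 (le_lt_trans sxy xy1); rewrite eqxx distrC => /(le_trans (ler_norm _)).
move=> /le_lt_trans; apply; apply: (@le_lt_trans _ _ ((C + 1) * `|x - y|)).
  by apply: ler_pM => //; rewrite lerDl.
by rewrite mulrC -ltr_pdivlMr// ltr_wpDl.
Unshelve. all: by end_near. Qed.

Lemma Q_process_measurable i j :
  measurable_fun (`[0, +oo[ : set R) (fun t => p t i j).
Proof.
apply: (@eq_measurable_fun _ _ _ _ _ (fun t : R => p `|t| i j)).
  by move=> t; rewrite inE/= in_itv/= andbT => t0; rewrite ger0_norm.
apply: measurable_funTS; apply: continuous_measurable_fun.
exact: Q_process_continuous.
Qed.

Let mp i j : measurable_fun (`[0, +oo[ : set R) (fun t => (p t i j)%:E).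
Proof. by apply/measurable_EFinP; exact: Q_process_measurable. Qed.

Section Laplace.
Variable al : R.
Hypothesis al0 : 0 < al.
Local Notation Phi := (laplace p al).

Lemma elaplace_row_sum i :
  (\sum_(0 <= j <oo) elaplace al (fun t => (p t i j)%:E) <= (al^-1)%:E)%E.
Proof.
rewrite -elaplace_nneseries; last 2 first.
- by move=> k t t0; rewrite lee_fin Q_process_ge0.
- by move=> k; exact: mp.
rewrite -elaplace_cst//; apply: le_elaplace.
- by move=> t t0; apply: nneseries_ge0 => k _ _; rewrite lee_fin Q_process_ge0.
- apply: ge0_emeasurable_sum => // k t; rewrite /= in_itv/= andbT => t0 _.
  by rewrite lee_fin Q_process_ge0.
- exact: measurable_cst.
- by move=> t t0; case: hT => _ + _; exact.
Qed.

Let elaplace_p_ge0 i j : (0 <= elaplace al (fun t => (p t i j)%:E))%E.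
Proof. by apply: elaplace_ge0 => t t0; rewrite lee_fin Q_process_ge0. Qed.

Lemma laplaceE i j : (Phi i j)%:E = elaplace al (fun t => (p t i j)%:E).
Proof.
rewrite /laplace /Rintegral fineK//.
have E : (\int[lebesgue_measure]_(t in `[0%R, +oo[) (expR (- al * t) * p t i j)%:E)%E
    = elaplace al (fun t => (p t i j)%:E).
  by apply: eq_integral => t _; rewrite EFinM.
rewrite E ge0_fin_numE//; apply: le_lt_trans (ltry (al^-1)).
apply: le_trans (elaplace_row_sum i).
apply: le_trans (nneseries_lim_ge j.+1 _) => //.
by rewrite big_nat_recr//= leeDr// sume_ge0.
Qed.

Lemma laplace_ge0 i j : 0 <= Phi i j.
Proof. by rewrite -lee_fin laplaceE. Qed.

Lemma laplace_row_sum i :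
  (\sum_(0 <= j <oo) (Phi i j)%:E <= (al^-1)%:E)%E.
Proof. by under eq_eseriesr do rewrite laplaceE; exact: elaplace_row_sum. Qed.

Lemma laplace_le i j : Phi i j <= al^-1.
Proof.
rewrite -lee_fin; apply: le_trans (laplace_row_sum i).
apply: le_trans (nneseries_lim_ge j.+1 _); last first.
  by move=> k _ _; rewrite lee_fin laplace_ge0.
by rewrite big_nat_recr//= leeDr// sume_ge0// => k _; rewrite lee_fin laplace_ge0.
Qed.

(** Splitting the integral at [s] and shifting the tail; the first-order expansion at s = 0 will be
    the backward equation. *)
Lemma laplace_CK s i j : 0 <= s ->
  ((Phi i j)%:E =
   \int[lebesgue_measure]_(t in `[0%R, s[) (expR (- al * t) * p t i j)%:E +
   (expR (- al * s))%:E * \sum_(0 <= k <oo) (p s i k * Phi k j)%:E)%E.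
Proof.
move=> s0; rewrite laplaceE (@elaplace_split _ _ s)//; last first.
  by move=> t t0; rewrite lee_fin Q_process_ge0.
congr (_ + _)%E.
have mf : measurable_fun setT (fun t : R => (p (s + `|t|) i j)%:E).
  apply/measurable_EFinP.
  apply: continuous_measurable_fun => t.
  have -> : (fun t : R => p (s + `|t|) i j) =
      (fun t : R => p `|t| i j) \o (fun t => s + `|t|).
    apply/funext => x /=; congr (p _ i j); apply/esym/ger0_norm.
    by rewrite addr_ge0.
  apply: continuous_comp; last exact: Q_process_continuous.
  by apply: cvgD; [exact: cvg_cst|exact: norm_continuous].
transitivity (\int[lebesgue_measure]_(t in `[s, +oo[)
    ((expR (- al * t))%:E * (p (s + `|t - s|) i j)%:E))%E.
  apply: eq_integral => t; rewrite inE/= in_itv/= andbT => st.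
  by rewrite ger0_norm ?subr_ge0// addrC subrK.
rewrite (@elaplace_shift _ al s (fun t => (p (s + `|t|) i j)%:E))//; last first.
  by move=> t; rewrite lee_fin Q_process_ge0// addr_ge0.
congr (_ * _)%E.
transitivity (elaplace al (fun t => \sum_(0 <= k <oo)
    (p s i k)%:E * (p t k j)%:E)%E).
  apply: eq_integral => t; rewrite inE/= in_itv/= andbT => t0.
  case: hT => _ _ ->//; rewrite ger0_norm//; congr (_ * _)%E.
rewrite elaplace_nneseries; last 2 first.
- by move=> k t t0; rewrite -EFinM lee_fin mulr_ge0// Q_process_ge0.
- by move=> k; apply: emeasurable_funM => //; exact: mp.
apply: eq_eseriesr => k _; rewrite elaplaceZ ?Q_process_ge0//.
- by rewrite EFinM laplaceE.
- by move=> t t0; rewrite lee_fin Q_process_ge0.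
Qed.

End Laplace.
End QProcessFacts.

Lemma cvg_big_nat (R : realType) (T : Type) (F : set_system T) {FF : Filter F}
    (f : nat -> T -> R) (l : nat -> R) m n :
  (forall k, f k x @[x --> F] --> l k) ->
  \sum_(m <= k < n) f k x @[x --> F] --> \sum_(m <= k < n) l k.
Proof.
move=> fl; elim: n => [|n IH].
  by under eq_fun do rewrite big_geq//; rewrite big_geq//; exact: cvg_cst.
have [mn|nm] := leqP m n.
  under eq_fun do rewrite big_nat_recr//=.
  by rewrite big_nat_recr//=; exact: cvgD.
by under eq_fun do rewrite big_geq//; rewrite big_geq//; exact: cvg_cst.
Qed.

Lemma expR_mul_cvg1 (R : realType) (al : R) :
  expR (al * s) @[s --> (0 : R)^'+] --> (1 : R).
Proof.
apply: cvg_at_right_filter; rewrite -[X in _ --> X](_ : expR (al * 0) = 1).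
  apply: continuous_comp; last exact: continuous_expR.
  by apply: cvgM; [exact: cvg_cst|exact: cvg_id].
by rewrite mulr0 expR0.
Qed.

Lemma expR_quotient_cvg (R : realType) (al : R) : 0 <= al ->
  (expR (al * s) - 1) / s @[s --> 0^'+] --> al.
Proof.
move=> al0; have H := expR_mul_cvg1 al.
apply: (@squeeze_cvgr _ _ _ _ (fun=> al) (fun s => al * expR (al * s))).
- near=> s; have s0 : 0 < s by [].
  rewrite ler_pdivlMr// ler_pdivrMr//; apply/andP; split.
    by have := expR_ge1Dx (al * s); lra.
  have := expR_ge1Dx (- (al * s)); rewrite expRN.
  have e0 := expR_gt0 (al * s); rewrite -(ler_pM2r e0) mulVf ?gt_eqF//.
  nra.
- exact: cvg_cst.
- by rewrite -[X in _ --> X]mulr1; apply: cvgM => //; exact: cvg_cst.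
Unshelve. all: by end_near. Qed.

(** * The backward equation for Laplace transforms *)

Section Backward.
Variables (R : realType) (a b : nat -> R) (p : R -> nat -> nat -> R).
Hypothesis a0 : a 0%N = 0.
Hypothesis hQ : Q_process a b p.
Variable al : R.
Hypothesis al0 : 0 < al.
Local Notation Phi := (laplace p al).

Let head_integral i j s : \bar R :=
  (\int[lebesgue_measure]_(t in `[0%R, s[) (expR (- al * t) * p t i j)%:E)%E.

Let mhead i j s : measurable_fun (`[0, s[ : set R)
  (fun t => (expR (- al * t) * p t i j)%:E).
Proof.
apply/measurable_EFinP; apply: measurable_funM.
  by apply: measurable_funTS; exact: measurable_expRM.
apply: measurable_funS (Q_process_measurable hQ i j) => // t /=.
by rewrite !in_itv/= andbT => /andP[].
Qed.

(** The head of the integral is s times the Kronecker delta, up to an error of order s^2. *)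
Let head_integral_bounds i j : exists C, exists2 eta, 0 < eta & 0 <= C /\
  forall s, 0 < s -> s < eta -> exists J, [/\ head_integral i j s = J%:E,
    expR (- al * s) * ((i == j)%:R - C * s) * s <= J & J <= ((i == j)%:R + C * s) * s].
Proof.
have [C [eta eta0 [C0 HC]]] := Q_process_near0 hQ i j.
exists C, eta => //; split => // s s0 se.
have ub : (head_integral i j s <= (((i == j)%:R + C * s) * s)%:E)%E.
  apply: (@le_trans _ _ (\int[lebesgue_measure]_(t in `[0%R, s[)
      ((i == j)%:R + C * s)%:E)%E); last by rewrite integral_cst//= lebesgue_measure_itv/= lte_fin s0 sube0 -EFinM.
  apply: ge0_le_integral => //.
  - move=> t /=; rewrite in_itv/= => /andP[t0 _].
    by rewrite lee_fin mulr_ge0 ?expR_ge0// (Q_process_ge0 hQ).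
  - exact: mhead.
  - move=> t /=; rewrite in_itv/= => /andP[t0 ts]; rewrite lee_fin.
    have := HC t t0 (lt_trans ts se); rewrite ler_norml => /andP[_ H].
    have p0 := Q_process_ge0 hQ i j t0.
    apply: (@le_trans _ _ (1 * p t i j)).
      rewrite ler_wpM2r// -expR0 ler_expR mulNr oppr_le0 mulr_ge0// ltW//.
    have : C * t <= C * s by rewrite ler_wpM2l// ltW.
    lra.
(* The maximum with 0 keeps the constant minorant nonnegative, as comparison of nonnegative
   integrals requires. *)
pose m := expR (- al * s) * Num.max 0 ((i == j)%:R - C * s).
have m0 : 0 <= m by rewrite mulr_ge0 ?expR_ge0// le_max lexx.
have lb : ((m * s)%:E <= head_integral i j s)%E.
  apply: (@le_trans _ _ (\int[lebesgue_measure]_(t in `[0%R, s[) m%:E)%E).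
    by rewrite integral_cst//= lebesgue_measure_itv/= lte_fin s0 sube0 -EFinM.
  apply: ge0_le_integral => //; first exact: mhead.
  move=> t /=; rewrite in_itv/= => /andP[t0 ts]; rewrite lee_fin.
  have := HC t t0 (lt_trans ts se); rewrite ler_norml => /andP[H _].
  have p0 := Q_process_ge0 hQ i j t0.
  apply: ler_pM; rewrite ?expR_ge0 ?le_max ?lexx//.
    by rewrite ler_expR !mulNr lerN2 ler_pM2l// ltW.
  rewrite ge_max p0/=; have : C * t <= C * s by rewrite ler_wpM2l// ltW.
  lra.
have fin : head_integral i j s \is a fin_num.
  rewrite ge0_fin_numE ?(le_lt_trans ub) ?ltry//.
  by apply: le_trans lb; rewrite lee_fin mulr_ge0// ltW.
exists (fine (head_integral i j s)); split; first by rewrite fineK.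
- rewrite -lee_fin fineK//; apply: le_trans lb; rewrite lee_fin.
  apply: ler_wpM2r; first exact: ltW.
  by apply: ler_wpM2l; rewrite ?expR_ge0// le_max lexx orbT.
- by rewrite -lee_fin fineK.
Qed.

(** Divide [laplace_CK] by s and let s tend to 0. The columns below N = i + 2 carry all of the row
    [i] of Q. The remaining ones contribute at most 1/al times the missing mass 1 - sum_{k < N}
    p_ik(s), which is -s S(s), and S tends to the row sum of Q, that is to 0. So no limit is
    exchanged with an infinite sum. *)
Lemma laplace_backward i j :
  al * Phi i j - (i == j)%:R = bd_gen a b (fun k => Phi k j) i.
Proof.
pose N := i.+2; have iN : (i.+1 < N)%N by [].
have [_ _ hD] := hQ.
have Phi0 k : 0 <= Phi k j by exact: (laplace_ge0 hQ).
have [C [eta eta0 [C0 HJ]]] := head_integral_bounds i j.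
pose S s := \sum_(0 <= k < N) (p s i k - p 0 i k) / s.
pose T s := \sum_(0 <= k < N) (p s i k - p 0 i k) / s * Phi k j.
have S_cvg : S s @[s --> 0^'+] --> (0 : R).
  rewrite -[X in _ --> X](@bd_matrix_row_sum _ a b a0 i N iN).
  exact: cvg_big_nat.
have T_cvg : T s @[s --> 0^'+] --> bd_gen a b (fun k => Phi k j) i.
  rewrite -(@sum_bd_matrix _ a b a0 _ i N iN).
  by apply: cvg_big_nat => k; apply: cvgM; [exact: hD|exact: cvg_cst].
pose E (s : R) := expR (al * s).
have E_cvg : E s @[s --> 0^'+] --> (1 : R) by exact: expR_mul_cvg1.
have E1_cvg := expR_quotient_cvg (ltW al0).
set d : R := (i == j)%:R.
have Cs_cvg : C * s @[s --> 0^'+] --> (0 : R).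
  rewrite -[X in _ --> X](mulr0 C); apply: cvgM; first exact: cvg_cst.
  by apply: cvg_within_filter; exact: cvg_id.
(* For small [s], [(E s - 1) / s * Phi i j - x = T s + y] with [x] close to [d]
   and [y] close to [0]. *)
have key : \forall s \near 0^'+,
    d - C * s + T s <= (E s - 1) / s * Phi i j /\
    (E s - 1) / s * Phi i j <= E s * (d + C * s) + T s - al^-1 * S s.
  near=> s.
  have s0 : 0 < s by [].
  have se : s < eta by near: s; exact: nbhs_right_lt.
  have [J [JE Jlb Jub]] := HJ s s0 se.
  have p0 k : 0 <= p s i k * Phi k j.
    by rewrite mulr_ge0// (Q_process_ge0 hQ)// ltW.
  pose Z := (\sum_(N <= k <oo) (p s i k * Phi k j)%:E)%E.
  have pN := Q_process_row_sum hQ i N (ltW s0).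
  have Z0 : (0 <= Z)%E by apply: nneseries_ge0 => k _ _; rewrite lee_fin.
  have Zub : (Z <= (al^-1 * (1 - \sum_(0 <= k < N) p s i k))%:E)%E.
    apply: (@le_trans _ _ (\sum_(N <= k <oo) (al^-1)%:E * (p s i k)%:E)%E).
      apply: lee_nneseries => k _; first by rewrite lee_fin.
      rewrite -EFinM lee_fin mulrC ler_wpM2r ?(laplace_le hQ)//.
      by rewrite (Q_process_ge0 hQ)// ltW.
    rewrite nneseriesZl => [|k _]; last first.
      by rewrite lee_fin (Q_process_ge0 hQ)// ltW.
    rewrite EFinM lee_wpmul2l//.
      by rewrite lee_fin invr_ge0 ltW.
    rewrite EFinB leeBrDl// -sumEFin.
    have := @nneseries_split _ (fun k => (p s i k)%:E) 0 N.
    rewrite add0n => <- => [|k _]; last by rewrite lee_fin (Q_process_ge0 hQ)// ltW.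
    by case: hQ => -[_ + _] _ _; apply; exact: ltW.
  have [z ZE] : exists z, Z = z%:E.
    exists (fine Z); rewrite fineK// ge0_fin_numE//.
    exact: le_lt_trans Zub (ltry _).
  have := laplace_CK hQ al0 i j (ltW s0).
  rewrite -/(head_integral i j s) JE.
  rewrite (@nneseries_split _ (fun k => (p s i k * Phi k j)%:E) 0 N)//; last first.
    by move=> k _; rewrite lee_fin.
  rewrite add0n -/Z ZE sumEFin => -[] H.
  move: Zub Z0; rewrite ZE !lee_fin => zub z0.
  have SE : S s = (\sum_(0 <= k < N) p s i k - 1) / s.
    rewrite /S -mulr_suml sumrB; congr ((_ - _) / _).
    under eq_bigr do rewrite (Q_process0 hQ).
    rewrite big_mkord (bigD1 (Ordinal (ltnW iN)))//= eqxx big1 ?addr0// => k.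
    by rewrite -val_eqE/= eq_sym => /negbTE ->.
  have TE : T s = (\sum_(0 <= k < N) p s i k * Phi k j - Phi i j) / s.
    rewrite /T; under eq_bigr do rewrite mulrAC mulrBl.
    rewrite -mulr_suml sumrB; congr ((_ - _) / _).
    under eq_bigr do rewrite (Q_process0 hQ).
    rewrite big_mkord (bigD1 (Ordinal (ltnW iN)))//= eqxx mul1r big1 ?addr0// => k.
    by rewrite -val_eqE/= eq_sym => /negbTE ->; rewrite mul0r.
  have E0 : 0 < E s by exact: expR_gt0.
  have EV : expR (- al * s) = (E s)^-1 by rewrite mulNr expRN.
  rewrite EV in H Jlb.
  have EH : E s * Phi i j = E s * J + \sum_(0 <= k < N) p s i k * Phi k j + z.
    by rewrite H mulrDr mulrA mulfV ?gt_eqF// mul1r addrA.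
  have -> : (E s - 1) / s * Phi i j = E s * J / s + T s + z / s.
    by rewrite TE mulrAC mulrBl EH mul1r; field; rewrite gt_eqF.
  have EJ1 : d - C * s <= E s * J / s.
    rewrite ler_pdivlMr// -[leLHS]mul1r -(mulfV (lt0r_neq0 E0)) -mulrA.
    by apply: ler_wpM2l; [exact: ltW|rewrite mulrA].
  have EJ2 : E s * J / s <= E s * (d + C * s).
    by rewrite ler_pdivrMr// -mulrA ler_wpM2l// ltW.
  have z1 : 0 <= z / s by rewrite divr_ge0// ltW.
  have z2 : z / s <= - (al^-1 * S s).
    by rewrite SE mulrA -mulNr -mulrN opprB ler_wpM2r// invr_ge0 ltW.
  split; lra.
have L1 : d - C * s + T s @[s --> 0^'+] --> d - 0 + bd_gen a b (fun k => Phi k j) i.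
  by apply: cvgD => //; apply: cvgB => //; exact: cvg_cst.
have L2 : E s * (d + C * s) + T s - al^-1 * S s @[s --> 0^'+] -->
    1 * (d + 0) + bd_gen a b (fun k => Phi k j) i - al^-1 * 0.
  apply: cvgB; last by apply: cvgM => //; exact: cvg_cst.
  by apply: cvgD => //; apply: cvgM => //; apply: cvgD => //; exact: cvg_cst.
have L3 : (E s - 1) / s * Phi i j @[s --> 0^'+] --> al * Phi i j.
  by apply: cvgM => //; exact: cvg_cst.
have B1 := ler_lim (cvgP _ L1) (cvgP _ L3) (filterS (fun s H => proj1 H) key).
have B2 := ler_lim (cvgP _ L3) (cvgP _ L2) (filterS (fun s H => proj2 H) key).
move: B1 B2; rewrite (cvg_lim (@Rhausdorff R) L1) (cvg_lim (@Rhausdorff R) L2) (cvg_lim (@Rhausdorff R) L3).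
rewrite mulr0 => B1 B2.
have FF : ProperFilter ((0 : R)^'+) by exact: at_right_proper_filter.
have {B1} := B1 FF (@filter_filter _ _ FF); have {B2} := B2 FF (@filter_filter _ _ FF).
set g := bd_gen _ _ _ _ => B1 B2.
by apply/eqP; rewrite eq_le; apply/andP; split; lra.
Unshelve. all: by end_near. Qed.

Definition laplace_total i : R := fine (\sum_(0 <= j <oo) (Phi i j)%:E)%E.

Lemma laplace_totalE i :
  (\sum_(0 <= j <oo) (Phi i j)%:E)%E = (laplace_total i)%:E.
Proof.
rewrite fineK// ge0_fin_numE; last first.
  by apply: nneseries_ge0 => j _ _; rewrite lee_fin (laplace_ge0 hQ).
exact: le_lt_trans (laplace_row_sum hQ al0 i) (ltry _).
Qed.

Lemma laplace_total_cvg i :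
  \sum_(0 <= j < N) Phi i j @[N --> \oo] --> laplace_total i.
Proof.
have H : (\sum_(0 <= j < N) (Phi i j)%:E)%E @[N --> \oo] --> (laplace_total i)%:E.
  rewrite -laplace_totalE; apply: is_cvg_nneseries => j _ _.
  by rewrite lee_fin (laplace_ge0 hQ).
move/fine_cvgP : H => [_]; apply: cvg_trans.
by apply: near_eq_cvg; apply: nearW => N /=; rewrite sumEFin.
Qed.

Lemma laplace_total_ge0 i : 0 <= laplace_total i.
Proof.
by rewrite fine_ge0// nneseries_ge0// => j _ _; rewrite lee_fin (laplace_ge0 hQ).
Qed.

Lemma laplace_total_le i : laplace_total i <= al^-1.
Proof. by rewrite -lee_fin -laplace_totalE; exact: (laplace_row_sum hQ al0 i). Qed.

Lemma laplace_le_total i j : Phi i j <= laplace_total i.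
Proof.
rewrite -lee_fin -laplace_totalE; apply: le_trans (nneseries_lim_ge j.+1 _); last first.
  by move=> k _ _; rewrite lee_fin (laplace_ge0 hQ).
rewrite big_nat_recr//= leeDr// sume_ge0// => k _.
by rewrite lee_fin (laplace_ge0 hQ).
Qed.

(** The backward equation summed over the targets. The generator involves at most three starting
    points, so it commutes with the limit of the partial sums. *)
Lemma bd_gen_laplace_total i :
  bd_gen a b laplace_total i = al * laplace_total i - 1.
Proof.
pose w N i := \sum_(0 <= j < N) Phi i j.
have w_cvg k := laplace_total_cvg k.
have L : bd_gen a b (w N) i @[N --> \oo] --> bd_gen a b laplace_total i.
  by apply: cvgD; (apply: cvgM; [exact: cvg_cst|apply: cvgB; exact: w_cvg]).
have L' : bd_gen a b (w N) i @[N --> \oo] --> al * laplace_total i - 1.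
  apply: (@cvg_trans _ (al * w N i - 1 @[N --> \oo])); last first.
    apply: cvgB; last exact: cvg_cst.
    by apply: cvgM; [exact: cvg_cst|exact: w_cvg].
  apply: near_eq_cvg; near=> N; have iN : (i < N)%N by near: N; exists i.+1.
  have -> : bd_gen a b (w N) i = \sum_(0 <= j < N) bd_gen a b (fun k => Phi k j) i.
    by rewrite /bd_gen /w big_split/= -!mulr_sumr !sumrB.
  under eq_bigr do rewrite -laplace_backward.
  rewrite sumrB -mulr_sumr; congr (_ - _).
  rewrite big_mkord (bigD1 (Ordinal iN))//= eqxx big1 ?addr0// => k.
  by rewrite -val_eqE/= eq_sym => /negbTE ->.
by rewrite -(cvg_lim (@Rhausdorff R) L) (cvg_lim (@Rhausdorff R) L').
Unshelve. all: by end_near. Qed.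

(** Before time [d] the row mass is at most 1, afterwards at most s_i / d. *)
Lemma laplace_total_bound (s : nat -> R) i d : 0 < d ->
  (forall t, 0 < t -> (\sum_(0 <= j <oo) (p t i j)%:E <= (s i / t)%:E)%E) ->
  laplace_total i <= d + s i / d / al.
Proof.
move=> d0 Hs; rewrite -lee_fin -laplace_totalE.
under eq_eseriesr do rewrite (laplaceE hQ al0).
have mp j : measurable_fun (`[0, +oo[ : set R) (fun t => (p t i j)%:E).
  by apply/measurable_EFinP; exact: (Q_process_measurable hQ).
have f0 t : 0 <= t -> (0 <= \sum_(0 <= j <oo) (p t i j)%:E)%E.
  by move=> t0; apply: nneseries_ge0 => j _ _; rewrite lee_fin (Q_process_ge0 hQ).
have f1 t : 0 <= t -> (\sum_(0 <= j <oo) (p t i j)%:E <= 1)%E.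
  by case: hQ => -[_ + _] _ _; exact.
have mf : measurable_fun (`[0, +oo[ : set R) (fun t => \sum_(0 <= j <oo) (p t i j)%:E)%E.
  apply: ge0_emeasurable_sum => // k t; rewrite /= in_itv/= andbT => t0 _.
  by rewrite lee_fin (Q_process_ge0 hQ).
have s0 : 0 <= s i / d.
  by rewrite -lee_fin; apply: le_trans (Hs d d0); apply: f0; exact: ltW.
rewrite -elaplace_nneseries; last 2 first.
- by move=> k t t0; rewrite lee_fin (Q_process_ge0 hQ).
- by move=> k; exact: mp.
rewrite (elaplace_split _ (ltW d0))// EFinD.
have sub1 : (`[0, d[ : set R) `<=` `[0, +oo[.
  by move=> t /=; rewrite !in_itv/= andbT => /andP[].
have sub2 : (`[d, +oo[ : set R) `<=` `[0, +oo[.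
  by move=> t /=; rewrite !in_itv/= !andbT; apply: le_trans; exact: ltW.
have e0 (t : R) : (0 <= (expR (- al * t))%:E)%E by rewrite lee_fin expR_ge0.
apply: leeD.
  apply: (@le_trans _ _ (\int[lebesgue_measure]_(t in `[0%R, d[) 1)%E).
    apply: ge0_le_integral => //.
    - by move=> t /sub1 /=; rewrite in_itv/= andbT => t0; rewrite mule_ge0// f0.
    - apply: measurable_elaplace; exact: measurable_funS mf.
    - move=> t /sub1 /=; rewrite in_itv/= andbT => t0; rewrite -[leRHS]mule1.
      apply: lee_pmul => //; [exact: f0| |exact: f1].
      by rewrite lee_fin -expR0 ler_expR mulNr oppr_le0 mulr_ge0// ltW.
  by rewrite integral_cst//= mul1e lebesgue_measure_itv/= lte_fin d0 sube0.
rewrite [(_ / al)%:E]EFinM -elaplace_cst// -elaplaceZ//=.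
apply: (@le_trans _ _ (\int[lebesgue_measure]_(t in `[d, +oo[)
   ((expR (- al * t))%:E * ((s i / d)%:E * 1)))%E).
  apply: ge0_le_integral => //.
  - by move=> t /sub2 /=; rewrite in_itv/= andbT => t0; rewrite mule_ge0// f0.
  - apply: measurable_elaplace; exact: measurable_funS mf.
  - by apply: measurable_elaplace; exact: measurable_cst.
  - move=> t /=; rewrite in_itv/= andbT => dt; rewrite lee_wpmul2l// mule1.
    apply: le_trans (Hs t (lt_le_trans d0 dt)) _; rewrite lee_fin.
    rewrite ler_wpM2l//; last by rewrite lef_pV2// posrE// (lt_le_trans d0).
    by move: s0; rewrite pmulr_lge0// invr_gt0.
apply: ge0_subset_integral => //.
- by apply: measurable_elaplace; exact: measurable_cst.
- by move=> t _; rewrite mule1 mule_ge0.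
Qed.

End Backward.

(** * The minimal process *)

Section Flux.
Variables (R : realType) (a b : nat -> R).
Hypothesis a0 : a 0%N = 0.
Hypothesis a_gt0 : forall k, (1 <= k)%N -> 0 < a k.
Hypothesis b_gt0 : forall k, 0 < b k.
Local Notation mu := (bd_mu a b).

(** Half the derivative of [v] with respect to the scale [bd_c]; its limit is the normal derivative
    at the boundary point infinity. *)
Definition bd_flux (v : nat -> R) n := b n * mu n * (v n.+1 - v n).

Lemma bd_flux_comb v w c n :
  bd_flux (fun k => v k + c * w k) n = bd_flux v n + c * bd_flux w n.
Proof. by rewrite /bd_flux; ring. Qed.

Lemma bd_flux_affine e c v n : bd_flux (fun k => e + c * v k) n = c * bd_flux v n.
Proof. by rewrite /bd_flux; ring. Qed.

Lemma sum_mu_bd_gen v n :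
  \sum_(0 <= k < n.+1) mu k * bd_gen a b v k = bd_flux v n.
Proof.
elim: n => [|n IH].
  by rewrite big_nat1 /bd_gen a0 mul0r add0r /bd_flux bd_mu0; ring.
rewrite big_nat_recr//= IH /bd_flux /bd_gen /= -bd_mu_balance//; ring.
Qed.

(** Abel summation: the flux is the partial sum of [mu k * bd_gen a b v k]. *)
Lemma sum_flux_diff v g n :
  \sum_(0 <= k < n.+1) bd_flux v k * (g k.+1 - g k) =
  bd_flux v n * g n.+1 - \sum_(0 <= k < n.+1) mu k * bd_gen a b v k * g k.
Proof.
elim: n => [|n IH].
  rewrite !big_nat1; have := sum_mu_bd_gen v 0; rewrite big_nat1 => ->; ring.
rewrite big_nat_recr//= IH [in RHS]big_nat_recr//=.
have := sum_mu_bd_gen v n.+1; rewrite big_nat_recr//= sum_mu_bd_gen => <-; ring.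
Qed.

Lemma bd_green v g n :
  \sum_(0 <= k < n.+1) mu k * (bd_gen a b v k * g k - v k * bd_gen a b g k) =
  bd_flux v n * g n.+1 - bd_flux g n * v n.+1.
Proof.
have H1 := sum_flux_diff v g n; have H2 := sum_flux_diff g v n.
have H3 : \sum_(0 <= k < n.+1) bd_flux v k * (g k.+1 - g k) =
    \sum_(0 <= k < n.+1) bd_flux g k * (v k.+1 - v k).
  by apply: eq_bigr => k _; rewrite /bd_flux; ring.
have -> : \sum_(0 <= k < n.+1) mu k * (bd_gen a b v k * g k - v k * bd_gen a b g k) =
   \sum_(0 <= k < n.+1) mu k * bd_gen a b v k * g k -
   \sum_(0 <= k < n.+1) mu k * bd_gen a b g k * v k.
  by rewrite -sumrB; apply: eq_bigr => k _; ring.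
lra.
Qed.

Section Regular.
Hypothesis hregular : regular_boundary a b.

(** Beyond the state 0 the scale is at least 1 / (2 b_0), so [bd_lambda] controls the mass; the
    state 0, where the scale vanishes, is split off. *)
Lemma bd_mu_summable : (\sum_(0 <= k <oo) (mu k)%:E < +oo)%E.
Proof.
have mu_ge0 k : (0 <= (mu k)%:E)%E by rewrite lee_fin ltW// bd_mu_gt0.
have b0 : 0 < 2 * b 0%N by rewrite mulr_gt0.
apply: (@le_lt_trans _ _ (1 + (2 * b 0%N)%:E * bd_lambda a b)%E).
  rewrite (@nneseries_split _ _ 0%N 1)// add0n big_nat1 bd_mu0 leeD2l//.
  have cmu k : (0 <= (bd_c a b k * mu k)%:E)%E.
    rewrite lee_fin mulr_ge0//; last by rewrite ltW// bd_mu_gt0.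
    case: k => // k; rewrite (le_trans _ (bd_c_ge a_gt0 b_gt0 k))//.
    by rewrite invr_ge0 ltW.
  rewrite -nneseriesZl//.
  rewrite [leRHS](@nneseries_split _ _ 0%N 1)//; last first.
    by move=> k _; rewrite mule_ge0// lee_fin ltW.
  rewrite add0n big_nat1 /= mul0r mule0 add0e.
  rewrite -(nneseries_addn (f := fun k => (mu k)%:E) 1)//.
  rewrite -(nneseries_addn (f := fun k => (2 * b 0%N)%:E * (bd_c a b k * mu k)%:E)%E 1)//.
    apply: lee_nneseries => // k _; rewrite addn1 -EFinM lee_fin mulrA.
    rewrite -[leLHS]mul1r ler_wpM2r//; first by rewrite ltW// bd_mu_gt0.
    by rewrite -ler_pdivrMl// mulr1 bd_c_ge.
  by move=> k; rewrite mule_ge0// lee_fin ltW.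
have [_ lam] := hregular.
by rewrite lte_add_pinfty// ?ltry// lte_mul_pinfty// lee_fin ltW.
Qed.

Lemma bd_mu_cvg : cvgn (series mu).
Proof. by apply: nnseries_is_cvg bd_mu_summable => k; rewrite ltW// bd_mu_gt0. Qed.

Definition bd_mass := limn (series mu).

Lemma bd_mass_ge n : \sum_(0 <= k < n) mu k <= bd_mass.
Proof.
apply: (@nondecreasing_cvgn_le _ (series mu)); last exact: bd_mu_cvg.
by apply: nondecreasing_series => k _ _; rewrite ltW// bd_mu_gt0.
Qed.

Lemma series_mu_bounded_cvg (f : nat -> R) B : (forall k, `|f k| <= B) ->
  cvgn (series (fun k => f k * mu k)).
Proof.
move=> fB; apply: normed_cvg.
apply: (@series_le_cvg _ _ (fun k => B * mu k)).
- by move=> k /=.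
- by move=> k; rewrite mulr_ge0// ?(le_trans _ (fB k))// ltW// bd_mu_gt0.
- by move=> k; rewrite /= normrM (gtr0_norm (bd_mu_gt0 _ _ _))// ler_wpM2r// ltW// bd_mu_gt0.
- exact: is_cvg_seriesZ bd_mu_cvg.
Qed.

End Regular.
End Flux.

Section MinimalProcess.
Variables (R : realType) (a b : nat -> R).
Hypothesis a0 : a 0%N = 0.
Hypothesis a_gt0 : forall k, (1 <= k)%N -> 0 < a k.
Hypothesis b_gt0 : forall k, 0 < b k.
Hypothesis hregular : regular_boundary a b.
Variable pmin : R -> nat -> nat -> R.
Hypothesis hmin : minimal_Q_process a b pmin.
Variable al : R.
Hypothesis al0 : 0 < al.

Local Notation mu := (bd_mu a b).
Local Notation Phi := (laplace pmin al).
Local Notation u := (u_ pmin al).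
Local Notation w := (laplace_total pmin al).

Let hQ : Q_process a b pmin. Proof. by case: hmin. Qed.

Lemma uE i : u i = 1 - al * w i. Proof. by []. Qed.

Lemma u_ge0 i : 0 <= u i.
Proof.
by rewrite uE subr_ge0 -ler_pdivlMl// mulr1; exact: (laplace_total_le hQ al0 i).
Qed.

Lemma u_le1 i : u i <= 1.
Proof. by rewrite uE gerBl mulr_ge0 ?(laplace_total_ge0 hQ)// ltW. Qed.

Lemma bd_gen_u i : bd_gen a b u i = al * u i.
Proof.
have := bd_gen_laplace_total a0 hQ al0 i; rewrite /bd_gen !uE => H.
transitivity (- al * (al * w i - 1)); last by ring.
rewrite -H; ring.
Qed.

Lemma minimal_row_sum_le t i : 0 < t ->
  (\sum_(0 <= j <oo) (pmin t i j)%:E <= (mean_lifetime a b i / t)%:E)%E.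
Proof.
move=> t0; have [sig _] := hregular.
have H := lim_proc_row_sum_le a0 a_gt0 b_gt0 i
  (mean_lifetime_ge0 a_gt0 b_gt0) (bd_gen_mean_lifetime a0 a_gt0 b_gt0 sig) t0.
apply: le_trans H; apply: lee_nneseries => [k _ _|k _].
  by rewrite lee_fin (Q_process_ge0 hQ)// ltW.
rewrite lee_fin; case: hmin => _; apply; last exact: ltW.
exact: lim_proc_Q_process.
Qed.

Lemma laplace_total_cvg0 : w i @[i --> \oo] --> (0 : R).
Proof.
apply/cvgrPdist_le => e e0.
have [sig _] := hregular.
have := mean_lifetime_cvg0 a_gt0 b_gt0 sig => /cvgrPdist_le.
(* With the cut at time d = e/2, this bound on the mean lifetime makes the second term of
   [laplace_total_bound] at most e/2 as well. *)
pose e' := e / 2 * (e / 2) * al.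
have e'0 : 0 < e' by rewrite !mulr_gt0// ?divr_gt0.
move=> /(_ e' e'0) H; near=> i.
have Hi : `|0 - mean_lifetime a b i| <= e' by near: i.
rewrite sub0r normrN ger0_norm; last exact: (laplace_total_ge0 hQ).
move: Hi; rewrite sub0r normrN ger0_norm; last exact: mean_lifetime_ge0.
move=> Hi.
have e2 : 0 < e / 2 by rewrite divr_gt0.
apply: le_trans (laplace_total_bound hQ al0 e2
  (fun t t0 => minimal_row_sum_le i t0)) _.
have : mean_lifetime a b i / (e / 2) / al <= e / 2.
  by rewrite ler_pdivrMr// ler_pdivrMr// mulrAC.
by move=> H'; rewrite [leRHS](splitr e) lerD2l.
Unshelve. all: by end_near. Qed.

Lemma u_cvg1 : u i @[i --> \oo] --> (1 : R).
Proof.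
rewrite -[X in _ --> X](_ : 1 - al * 0 = 1); last by rewrite mulr0 subr0.
apply: cvgB; first exact: cvg_cst.
by apply: cvgM; [exact: cvg_cst|exact: laplace_total_cvg0].
Qed.

Lemma Phi_cvg0 j : Phi i j @[i --> \oo] --> (0 : R).
Proof.
apply: (@squeeze_cvgr _ _ _ _ (fun=> 0) w).
- apply: nearW => i; apply/andP; split; first exact: (laplace_ge0 hQ al0).
  exact: (laplace_le_total hQ al0).
- exact: cvg_cst.
- exact: laplace_total_cvg0.
Qed.

Lemma bd_gen_Phi i j :
  bd_gen a b (fun k => Phi k j) i = al * Phi i j - (i == j)%:R.
Proof. by rewrite -(laplace_backward a0 hQ al0). Qed.

Lemma sum_mu_delta (f : nat -> R) j n : (j <= n)%N ->
  \sum_(0 <= k < n.+1) mu k * (k == j)%:R * f k = mu j * f j.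
Proof.
move=> jn; rewrite big_mkord (bigD1 (Ordinal (jn : (j < n.+1)%N)))//= eqxx mulr1.
by rewrite big1 ?addr0// => k; rewrite -val_eqE/= => /negbTE ->; rewrite mulr0 mul0r.
Qed.

Lemma bd_flux_Phi j n : (j <= n)%N ->
  bd_flux a b (fun k => Phi k j) n = al * \sum_(0 <= k < n.+1) mu k * Phi k j - mu j.
Proof.
move=> jn; rewrite -sum_mu_bd_gen//; under eq_bigr do rewrite bd_gen_Phi mulrBr.
rewrite sumrB; congr (_ - _); first by rewrite mulr_sumr; apply: eq_bigr => k _; ring.
rewrite -[RHS]mulr1 -(sum_mu_delta (fun=> 1) jn).
by apply: eq_bigr => k _; rewrite mulr1.
Qed.

Lemma bd_flux_Phi_bounded j n : (j <= n)%N ->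
  `|bd_flux a b (fun k => Phi k j) n| <= bd_mass a b + mu j.
Proof.
move=> jn; rewrite bd_flux_Phi//; apply: le_trans (ler_normB _ _) _.
rewrite (gtr0_norm (bd_mu_gt0 _ _ _))// lerD2r ger0_norm.
  apply: le_trans (bd_mass_ge a_gt0 b_gt0 hregular n.+1).
  rewrite mulr_sumr; apply: ler_sum => k _.
  rewrite mulrCA -[leRHS]mulr1; apply: ler_wpM2l; first by rewrite ltW// bd_mu_gt0.
  by rewrite -ler_pdivlMl// mulr1; exact: (laplace_le hQ al0 k j).
rewrite mulr_ge0 ?(ltW al0)// sumr_ge0// => k _.
by rewrite mulr_ge0 ?(laplace_ge0 hQ)// ltW// bd_mu_gt0.
Qed.

(* Green's identity on [0..n]: the boundary terms vanish as the fluxes are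
   bounded and [Phi] tends to 0 at infinity. *)
Lemma Phi_symmetric i j : mu i * Phi i j = mu j * Phi j i.
Proof.
pose D n := bd_flux a b (fun k => Phi k j) n * Phi n.+1 i -
            bd_flux a b (fun k => Phi k i) n * Phi n.+1 j.
have DE n : (i <= n)%N -> (j <= n)%N -> D n = mu i * Phi i j - mu j * Phi j i.
  move=> iLn jn; rewrite /D -bd_green//.
  rewrite -(sum_mu_delta (fun k => Phi k j) iLn) -(sum_mu_delta (fun k => Phi k i) jn).
  by rewrite -sumrB; apply: eq_bigr => k _; rewrite !bd_gen_Phi; ring.
have D0 : D n @[n --> \oo] --> (0 : R).
  have H k l : bd_flux a b (fun m => Phi m k) n * Phi n.+1 l @[n --> \oo] --> (0 : R).
    apply: (@squeeze_cvgr _ _ _ _ (fun n => - ((bd_mass a b + mu k) * Phi n.+1 l))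
      (fun n => (bd_mass a b + mu k) * Phi n.+1 l)).
    - near=> n; rewrite -ler_norml normrM (ger0_norm (laplace_ge0 hQ al0 _ _)).
      rewrite ler_wpM2r ?(laplace_ge0 hQ)// bd_flux_Phi_bounded//.
      by near: n; exists k.
    - rewrite -oppr0; apply: cvgN; rewrite -[X in _ --> X](mulr0 (bd_mass a b + mu k)).
      apply: cvgM; first exact: cvg_cst.
      by rewrite (cvg_shiftS (fun n => Phi n l)); exact: Phi_cvg0.
    - rewrite -[X in _ --> X](mulr0 (bd_mass a b + mu k)).
      apply: cvgM; first exact: cvg_cst.
      by rewrite (cvg_shiftS (fun n => Phi n l)); exact: Phi_cvg0.
  by rewrite -[X in _ --> X](subr0 0); apply: cvgB; exact: H.
have D1 : D n @[n --> \oo] --> mu i * Phi i j - mu j * Phi j i.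
  apply: cvg_near_cst; near=> n.
  by apply: DE; near: n; [exists i|exists j].
apply/eqP; rewrite -subr_eq0.
by rewrite -(cvg_lim (@Rhausdorff R) D1) (cvg_lim (@Rhausdorff R) D0).
Unshelve. all: by end_near. Qed.

(** Symmetry turns the [mu]-weighted column sum in the flux into mu_j times a row sum, which
    converges to the total w_j, and al w_j - 1 = - u_j. *)
Lemma bd_flux_Phi_cvg j :
  bd_flux a b (fun k => Phi k j) n @[n --> \oo] --> - (mu j * u j).
Proof.
have L : al * (mu j * \sum_(0 <= k < n.+1) Phi j k) - mu j @[n --> \oo] -->
    al * (mu j * w j) - mu j.
  apply: cvgB; last exact: cvg_cst.
  apply: cvgM; first exact: cvg_cst.
  apply: cvgM; first exact: cvg_cst.
  rewrite (cvg_shiftS (fun n => \sum_(0 <= k < n) Phi j k)).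
  exact: (laplace_total_cvg hQ al0).
rewrite (_ : - (mu j * u j) = al * (mu j * w j) - mu j); last by rewrite uE; ring.
apply: cvg_trans L.
apply: near_eq_cvg; near=> n; have jn : (j <= n)%N by near: n; exists j.
rewrite bd_flux_Phi//; congr (al * _ - _); rewrite mulr_sumr.
by apply: eq_bigr => k _; rewrite Phi_symmetric.
Unshelve. all: by end_near. Qed.

Lemma series_mu_u_cvg : cvgn (series (fun k => mu k * u k)).
Proof.
under eq_fun do rewrite mulrC.
apply: (series_mu_bounded_cvg a_gt0 b_gt0 hregular (B := 1)) => k.
by rewrite ger0_norm ?u_ge0 ?u_le1.
Qed.

Definition bd_mass_u := limn (series (fun k => mu k * u k)).

Lemma bd_mass_u_gt0 : 0 < bd_mass_u.
Proof.
have := u_cvg1 => /cvgrPdist_lt/(_ 1 ltr01) [n _ /(_ n (leqnn n))] /= H.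
have un : 0 < u n by move: H; rewrite ltr_norml => /andP[_]; lra.
apply: (@lt_le_trans _ _ (series (fun k => mu k * u k) n.+1)).
  rewrite /series/= big_nat_recr//=; apply: ltr_wpDl; last by rewrite mulr_gt0// bd_mu_gt0.
  by rewrite sumr_ge0// => k _; rewrite mulr_ge0 ?u_ge0// ltW// bd_mu_gt0.
apply: (@nondecreasing_cvgn_le _ (series (fun k => mu k * u k))).
  by apply: nondecreasing_series => k _ _; rewrite mulr_ge0 ?u_ge0// ltW// bd_mu_gt0.
exact: series_mu_u_cvg.
Qed.

Lemma bd_flux_u_cvg : bd_flux a b u n @[n --> \oo] --> al * bd_mass_u.
Proof.
have -> : bd_flux a b u = (fun n => al * series (fun k => mu k * u k) n.+1).
  apply/funext => n; rewrite -sum_mu_bd_gen// /series/= mulr_sumr.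
  by apply: eq_bigr => k _; rewrite bd_gen_u; ring.
apply: cvgM; first exact: cvg_cst.
by rewrite (cvg_shiftS (series (fun k => mu k * u k))); exact: series_mu_u_cvg.
Qed.

End MinimalProcess.

(** * The Dirichlet form *)

Section DirichletForm.
Variables (R : realType) (a b : nat -> R).
Hypothesis a0 : a 0%N = 0.
Hypothesis a_gt0 : forall k, (1 <= k)%N -> 0 < a k.
Hypothesis b_gt0 : forall k, 0 < b k.
Hypothesis hregular : regular_boundary a b.
Local Notation mu := (bd_mu a b).
Local Notation dc k := (bd_c a b k.+1 - bd_c a b k).

Let dc_gt0 k : 0 < dc k. Proof. exact: bd_cS_gt0. Qed.
Let mu_gt0 k : 0 < mu k. Proof. exact: bd_mu_gt0. Qed.

Lemma bd_dc_summable : (\sum_(0 <= k <oo) (dc k)%:E < +oo)%E.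
Proof.
have [sig _] := hregular; apply: le_lt_trans sig.
apply: lee_nneseries => [k _ _|k _]; first by rewrite lee_fin ltW.
rewrite lee_fin /bd_sigma_term -[leLHS]mulr1 ler_wpM2l ?(ltW (dc_gt0 _))//.
by rewrite big_nat_recl// bd_mu0// lerDl sumr_ge0// => i _; rewrite ltW.
Qed.

Lemma bd_dc_cvg : cvgn (series (fun k => dc k)).
Proof. by apply: nnseries_is_cvg bd_dc_summable => k; rewrite ltW. Qed.

Lemma finite_energy (g : nat -> R) : finite_A_star a b g ->
  (\sum_(0 <= k <oo) ((g k.+1 - g k) * (g k.+1 - g k) / dc k)%:E < +oo)%E.
Proof.
move=> gA; rewrite ltNge leye_eq; apply/negP => /eqP E; move: gA.
by rewrite /finite_A_star E mulry gtr0_sg ?mul1e ?ltxx// invr_gt0.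
Qed.

Lemma nneseries_lty_comb (x y z : nat -> R) :
  (forall k, 0 <= x k) -> (forall k, 0 <= y k) -> (forall k, 0 <= z k) ->
  (forall k, z k <= 2 * x k + 2 * y k) ->
  (\sum_(0 <= k <oo) (x k)%:E < +oo)%E -> (\sum_(0 <= k <oo) (y k)%:E < +oo)%E ->
  (\sum_(0 <= k <oo) (z k)%:E < +oo)%E.
Proof.
move=> x0 y0 z0 zxy xoo yoo.
apply: (@le_lt_trans _ _ (2%:E * (\sum_(0 <= k <oo) (x k)%:E) +
    2%:E * (\sum_(0 <= k <oo) (y k)%:E))%E).
  rewrite -nneseriesZl; last by move=> k _; rewrite lee_fin.
  rewrite -nneseriesZl; last by move=> k _; rewrite lee_fin.
  rewrite -nneseriesD; [|by move=> k _ _; rewrite mule_ge0// lee_fin..].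
  by apply: lee_nneseries => k _; rewrite lee_fin//; exact: zxy.
by rewrite lte_add_pinfty// lte_mul_pinfty// lee_fin.
Qed.

Lemma G_star_energy_cvg g : G_star a b g ->
  cvgn (series (fun k => (g k.+1 - g k) * (g k.+1 - g k) / dc k)).
Proof.
move=> [_ /finite_energy gA]; apply: nnseries_is_cvg => [k|//].
by rewrite divr_ge0 ?(ltW (dc_gt0 _))// -expr2 sqr_ge0.
Qed.

Lemma G_star_norm_cvg g : G_star a b g -> cvgn (series (fun k => g k * g k * mu k)).
Proof.
move=> [gL _]; apply: nnseries_is_cvg => [k|].
  by rewrite mulr_ge0 ?(ltW (mu_gt0 _))// -expr2 sqr_ge0.
by apply: le_lt_trans gL; apply: lee_nneseries => k _ //=; rewrite lee_fin mulr_ge0 ?(ltW (mu_gt0 _))// -expr2 sqr_ge0.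
Qed.

Lemma is_cvg_seriesM_sq (x y z : nat -> R) : (forall k, 0 <= z k) ->
  cvgn (series (fun k => x k * x k * z k)) ->
  cvgn (series (fun k => y k * y k * z k)) ->
  cvgn (series (fun k => x k * y k * z k)).
Proof.
move=> z0 cx cy; apply: normed_cvg.
apply: (@series_le_cvg _ _ (fun k => x k * x k * z k + y k * y k * z k)).
- by move=> k /=.
- move=> k; rewrite addr_ge0// mulr_ge0// -expr2 sqr_ge0//.
- move=> k; rewrite /= !normrM (ger0_norm (z0 k)) -mulrDl ler_wpM2r//.
  rewrite -[x k * x k]expr2 -[y k * y k]expr2 -(real_normK (num_real (x k))) -(real_normK (num_real (y k))).
  have := sqr_ge0 (`|x k| - `|y k|); nra.
- exact: is_cvg_seriesD.
Qed.

Lemma G_star_cross_cvg f g : G_star a b f -> G_star a b g ->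
  cvgn (series (fun k => (f k.+1 - f k) * (g k.+1 - g k) / dc k)).
Proof.
move=> /G_star_energy_cvg hf /G_star_energy_cvg hg.
by apply: is_cvg_seriesM_sq => // k; rewrite invr_ge0 ltW.
Qed.

Lemma G_star_inner_cvg f g : G_star a b f -> G_star a b g ->
  cvgn (series (fun k => f k * g k * mu k)).
Proof.
move=> /G_star_norm_cvg hf /G_star_norm_cvg hg.
by apply: is_cvg_seriesM_sq => // k; rewrite ltW.
Qed.

(** For an increment x over a scale step d, |x| <= x^2 / d + d. Finite energy and finite total scale
    thus make the increments absolutely summable. *)
Lemma G_star_cvg g : G_star a b g -> cvgn g.
Proof.
move=> /G_star_energy_cvg hg.
have H : cvgn (series (fun k => g k.+1 - g k)).
  apply: normed_cvg.
  apply: (@series_le_cvg _ _ (fun k => (g k.+1 - g k) * (g k.+1 - g k) / dc k + dc k)).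
  - by move=> k /=.
  - by move=> k; rewrite addr_ge0 ?divr_ge0 ?(ltW (dc_gt0 _))// -expr2 sqr_ge0.
  - move=> k /=; have d0 := dc_gt0 k; set x := g k.+1 - g k; set d := dc k in d0 *.
    rewrite -[x * x]expr2 -(real_normK (num_real x)) -(ler_pM2r d0) mulrDl divfK ?gt_eqF//.
    have := sqr_ge0 (`|x| - d); have := normr_ge0 x; nra.
  - exact: is_cvg_seriesD hg bd_dc_cvg.
have -> : g = (fun n => g 0%N + series (fun k => g k.+1 - g k) n).
  by apply/funext => n; rewrite /series/= telescope_sumr// addrC subrK.
by apply: is_cvgD => //; exact: is_cvg_cst.
Qed.

Lemma G_star_bounded g : G_star a b g -> exists B, forall k, `|g k| <= B.
Proof.
move=> /G_star_cvg /cvg_seq_bounded [M [_ HM]].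
by exists (M + 1) => k; apply: HM => //; rewrite ltrDl.
Qed.

Lemma G_starB f g : G_star a b f -> G_star a b g -> G_star a b (fun k => f k - g k).
Proof.
move=> [f1 f2] [g1 g2].
have sq (x y z : R) : 0 <= z ->
    (x - y) * (x - y) * z <= 2 * (x * x * z) + 2 * (y * y * z).
  by move=> z0; have := mulr_ge0 (sqr_ge0 (x + y)) z0; nra.
split.
  have sq0 (h : nat -> R) k : 0 <= h k ^+ 2 * mu k.
    by apply: mulr_ge0; [exact: sqr_ge0|exact: ltW].
  apply: (nneseries_lty_comb (sq0 f) (sq0 g) (sq0 (fun k => f k - g k)) _ f1 g1) => k.
  by rewrite !expr2 sq// ltW.
have sq0 (h : nat -> R) k : 0 <= (h k.+1 - h k) * (h k.+1 - h k) / dc k.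
  by rewrite -expr2; apply: divr_ge0; [exact: sqr_ge0|exact: ltW].
rewrite /finite_A_star lte_mul_pinfty//.
apply: (nneseries_lty_comb (sq0 f) (sq0 g) (sq0 (fun k => f k - g k)) _
  (finite_energy f2) (finite_energy g2)) => k.
have dck : 0 <= (dc k)^-1 by rewrite invr_ge0 ltW.
have := sq (f k.+1 - f k) (g k.+1 - g k) _ dck.
by have -> : f k.+1 - g k.+1 - (f k - g k) = f k.+1 - f k - (g k.+1 - g k) by ring.
Qed.

Section Solution.
Variables (v f : nat -> R) (al kappa phi l B Bf : R).
Hypothesis vB : forall k, `|v k| <= B.
Hypothesis fB : forall k, `|f k| <= Bf.
Hypothesis v_gen : forall k, bd_gen a b v k = al * v k - f k.
Hypothesis v_flux : bd_flux a b v n @[n --> \oo] --> phi.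
Hypothesis v_lim : v n @[n --> \oo] --> l.
Hypothesis v_bnd : phi + kappa * l = 0.

Let diff_flux k : v k.+1 - v k = bd_flux a b v k * (2 * dc k).
Proof.
rewrite /bd_flux bd_cS//; have := mu_gt0 k; have := b_gt0 k.
by set x := b k; set y := mu k => x0 y0; field; rewrite !gt_eqF.
Qed.

(** A bounded function is square summable because [mu] is finite; a bounded flux has finite energy
    because the total scale is finite. *)
Lemma form_solution_G_star : G_star a b v.
Proof.
have B0 : 0 <= B by apply: le_trans (vB 0%N).
split.
  apply: (@le_lt_trans _ _ ((B ^+ 2)%:E * \sum_(0 <= k <oo) (mu k)%:E)%E).
    rewrite -nneseriesZl => [|k _]; last by rewrite lee_fin ltW.
    apply: lee_nneseries => [k _ _|k _]; first by rewrite lee_fin mulr_ge0 ?sqr_ge0// (ltW (mu_gt0 _)).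
    rewrite -EFinM lee_fin ler_wpM2r ?(ltW (mu_gt0 _))//.
    by rewrite -real_normK ?num_real// lerXn2r// ?nnegrE.
  by rewrite lte_mul_pinfty// ?lee_fin ?sqr_ge0//; exact: bd_mu_summable.
have [M [_ HM]] := cvg_seq_bounded (cvgP _ v_flux).
have {}HM k : `|bd_flux a b v k| <= M + 1 by apply: HM => //; rewrite ltrDl.
have M0 : 0 <= M + 1 by apply: le_trans (HM 0%N).
apply: (@le_lt_trans _ _ (2^-1%:E * ((4 * (M + 1) ^+ 2)%:E * \sum_(0 <= k <oo) (dc k)%:E))%E).
  apply: lee_wpmul2l; first by rewrite lee_fin.
  rewrite -nneseriesZl => [|k _]; last by rewrite lee_fin ltW.
  apply: lee_nneseries => [k _ _|k _].
    by rewrite lee_fin divr_ge0 ?(ltW (dc_gt0 _))// -expr2 sqr_ge0.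
  rewrite -EFinM lee_fin diff_flux; set x := bd_flux _ _ _ _.
  have -> : x * (2 * dc k) * (x * (2 * dc k)) / dc k = 4 * x ^+ 2 * dc k.
    by have := dc_gt0 k; set d := dc k => d0; field; rewrite gt_eqF.
  rewrite ler_wpM2r ?(ltW (dc_gt0 _))// ler_wpM2l//.
  rewrite -real_normK ?num_real// lerXn2r ?nnegrE//; exact: HM.
rewrite !lte_mul_pinfty ?lee_fin ?mulr_ge0 ?sqr_ge0//; exact: bd_dc_summable.
Qed.

(** Here [v] solves the equation pointwise with the elastic condition phi + kappa l = 0 at infinity.
    Summation by parts leaves the boundary term phi g(infinity), which the term kappa l g(infinity)
    of the form cancels. *)
Lemma form_solution_eq g : G_star a b g ->
  E_kappa a b kappa v g + al * L2_inner a b v g = L2_inner a b f g.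
Proof.
move=> gG; have gc := G_star_cvg gG; have [Bg gB] := G_star_bounded gG.
have cvg_fg (h : nat -> R) Bh : (forall k, `|h k| <= Bh) ->
    series (fun k => h k * g k * mu k) n @[n --> \oo] --> L2_inner a b h g.
  move=> hB; apply: (series_mu_bounded_cvg a_gt0 b_gt0 hregular (B := Bh * Bg)) => k.
  by rewrite normrM ler_pM.
have cv := cvg_fg _ _ vB; have cf := cvg_fg _ _ fB.
have A : A_star a b v g = phi * limn g - (al * L2_inner a b v g - L2_inner a b f g).
  have L : 2^-1 * series (fun k => (v k.+1 - v k) * (g k.+1 - g k) / dc k) n.+1
      @[n --> \oo] --> phi * limn g - (al * L2_inner a b v g - L2_inner a b f g).
    rewrite (_ : (fun n : nat => _) = (fun n => bd_flux a b v n * g n.+1 -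
       (al * series (fun k => v k * g k * mu k) n.+1 -
        series (fun k => f k * g k * mu k) n.+1))); last first.
      apply/funext => n; rewrite /series/=.
      have -> : al * (\sum_(0 <= k < n.+1) v k * g k * mu k) -
         \sum_(0 <= k < n.+1) f k * g k * mu k =
         \sum_(0 <= k < n.+1) mu k * bd_gen a b v k * g k.
        rewrite mulr_sumr -sumrB; apply: eq_bigr => k _; rewrite v_gen; ring.
      rewrite -sum_flux_diff// mulr_sumr; apply: eq_bigr => k _.
      rewrite diff_flux; have := dc_gt0 k; set d := dc k => d0.
      by field; rewrite gt_eqF.
    apply: cvgB.
      apply: cvgM => //.
      by rewrite (cvg_shiftS g).
    apply: cvgB; last by rewrite (cvg_shiftS (series (fun k => f k * g k * mu k))).
    apply: cvgM; first exact: cvg_cst.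
    by rewrite (cvg_shiftS (series (fun k => v k * g k * mu k))).
  have L' : 2^-1 * series (fun k => (v k.+1 - v k) * (g k.+1 - g k) / dc k) n.+1
      @[n --> \oo] --> A_star a b v g.
    apply: cvgM; first exact: cvg_cst.
    rewrite (cvg_shiftS (series (fun k => (v k.+1 - v k) * (g k.+1 - g k) / dc k))).
    exact: G_star_cross_cvg form_solution_G_star gG.
  by rewrite -(cvg_lim (@Rhausdorff R) L) (cvg_lim (@Rhausdorff R) L').
rewrite /E_kappa A (cvg_lim (@Rhausdorff R) v_lim).
have -> : phi = - (kappa * l) by apply/eqP; rewrite -addr_eq0 v_bnd.
ring.
Qed.

End Solution.

(** Tested with the difference d of the solutions, the equations give A(d, d) + kappa d(infinity)^2
    + al |d|^2 = 0, a sum of nonnegative terms. The convergence lemmas above supply the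
    bilinearity. *)
Lemma form_unique (al kappa : R) (v1 v2 : nat -> R) (rhs : (nat -> R) -> R) :
  0 < al -> 0 <= kappa -> G_star a b v1 -> G_star a b v2 ->
  (forall g, G_star a b g ->
     E_kappa a b kappa v1 g + al * L2_inner a b v1 g = rhs g) ->
  (forall g, G_star a b g ->
     E_kappa a b kappa v2 g + al * L2_inner a b v2 g = rhs g) ->
  v1 =1 v2.
Proof.
move=> al0 k0 h1 h2 e1 e2; pose d k := v1 k - v2 k.
have hd : G_star a b d by exact: G_starB.
have := etrans (e1 d hd) (esym (e2 d hd)).
have AE : A_star a b v1 d - A_star a b v2 d = A_star a b d d.
  rewrite /A_star -mulrBr; congr (_ * _); apply/esym/cvg_lim => //.
  rewrite (_ : series _ = series (fun k => (v1 k.+1 - v1 k) * (d k.+1 - d k) / dc k)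
    - series (fun k => (v2 k.+1 - v2 k) * (d k.+1 - d k) / dc k)).
    by apply: cvgB; apply: G_star_cross_cvg.
  apply/funext => n; rewrite !fctE /series/= -sumrB; apply: eq_bigr => k _.
  by rewrite {1 2}/d; ring.
have LE : L2_inner a b v1 d - L2_inner a b v2 d = L2_inner a b d d.
  apply/esym/cvg_lim => //.
  rewrite (_ : series _ = series (fun k => v1 k * d k * mu k)
    - series (fun k => v2 k * d k * mu k)).
    by apply: cvgB; apply: G_star_inner_cvg.
  apply/funext => n; rewrite !fctE /series/= -sumrB; apply: eq_bigr => k _.
  by rewrite {1}/d; ring.
have dE : limn v1 - limn v2 = limn d.
  apply/esym/cvg_lim => //; apply: cvgB; exact: G_star_cvg.
have A0 : 0 <= A_star a b d d.
  rewrite mulr_ge0//; apply: limr_ge; first exact: G_star_energy_cvg.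
  apply: nearW => n; rewrite /series/= sumr_ge0// => k _.
  by rewrite divr_ge0 ?(ltW (dc_gt0 _))// -expr2 sqr_ge0.
have l0 : 0 <= kappa * (limn d * limn d) by rewrite mulr_ge0// -expr2 sqr_ge0.
rewrite /E_kappa => E.
have Ld0 : L2_inner a b d d <= 0.
  rewrite -(ler_pM2l al0) mulr0 -LE.
  have : kappa * (limn d * limn d) = kappa * limn v1 * limn d - kappa * limn v2 * limn d.
    by rewrite -{1}dE; ring.
  by move=> xE; rewrite xE in l0; lra.
move=> k; apply/eqP; rewrite -subr_eq0 -/(d k) -sqrf_eq0 eq_le sqr_ge0 andbT.
rewrite -(ler_pM2r (mu_gt0 k)) mul0r; apply: le_trans Ld0.
apply: (@le_trans _ _ (series (fun k => d k * d k * mu k) k.+1)).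
  rewrite /series/= big_nat_recr//= -expr2 lerDr sumr_ge0// => i _.
  by rewrite mulr_ge0 ?(ltW (mu_gt0 _))// -expr2 sqr_ge0.
apply: (@nondecreasing_cvgn_le _ (series (fun k => d k * d k * mu k))).
  by apply: nondecreasing_series => i _ _; rewrite mulr_ge0 ?(ltW (mu_gt0 _))// -expr2 sqr_ge0.
exact: G_star_norm_cvg.
Qed.

End DirichletForm.

(** * The process X and its resolvent *)

Section StateSpace.

Lemma opc_open_some (T : topologicalType) (U : set T) :
  open U -> @open (one_point_compactification T) (Some @` U).
Proof. exact: one_point_compactification_open_some. Qed.

Lemma opc_closed_some (T : topologicalType) (U : set T) : compact U -> closed U ->
  @closed (one_point_compactification T) (Some @` U).
Proof.
move=> cptU clU; rewrite -openC openE => -[x|].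
- move=> /= Ux; have Ux' : ~ U x by move=> Ux'; apply: Ux; exists x.
  have N : nbhs x (~` U) by apply: open_nbhs_nbhs; split => //; exact: closed_openC.
  have := @one_point_compactification_some_nbhs T x _ N.
  apply: (@filterS _ (nbhs (Some x : one_point_compactification T))).
  by move=> _ [y Uy <-] [z Uz [zy]]; apply: Uy; rewrite -zy.
- move=> _; exists U => //= _ [[y Uy <-]|->]; last by case.
  by move=> [z Uz [zy]]; apply: Uy; rewrite -zy.
Qed.

Lemma opc_compact_some (T : topologicalType) (U : set T) : compact U ->
  @compact (one_point_compactification T) (Some @` U).
Proof.
apply: (@continuous_compact T (one_point_compactification T)).
apply: continuous_subspaceT.
exact: one_point_compactification_some_continuous.
Qed.

Lemma state_set1 k : [set (state k : S_Delta N_infty)] =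
  Some @` (Some @` [set k] : set N_infty).
Proof. by rewrite !image_set1. Qed.

Lemma open_state k : @open (S_Delta N_infty) [set state k].
Proof. by rewrite state_set1; do 2 apply: opc_open_some; exact: discrete_open. Qed.

Lemma closed_state k : @closed (S_Delta N_infty) [set state k].
Proof.
rewrite state_set1; apply: opc_closed_some; first apply: opc_compact_some.
- exact: compact_set1.
- by apply: opc_closed_some; [exact: compact_set1|exact: discrete_closed].
Qed.

(** [N_infty] is itself compact, so its whole image is an admissible set to remove from a
    neighborhood of the trap, which is thus isolated. *)
Lemma open_trap : @open (S_Delta N_infty) [set trap].
Proof.
rewrite openE => _ ->; exists setT.
  by split; [exact: one_point_compactification_compact|exact: closedT].
by move=> x [[y ny]|->//]; case: ny.
Qed.

Lemma closed_trap : @closed (S_Delta N_infty) [set trap].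
Proof.
rewrite -openC (_ : ~` _ = Some @` [set: N_infty]); first exact/opc_open_some/openT.
apply/seteqP; split => [[x _|H]|_ [x _ <-]//]; first by exists x.
by case: H.
Qed.

Lemma measurable_countable d (T : measurableType d) (f : T -> nat) : injective f ->
  (forall s : T, measurable [set s]) -> forall A : set T, measurable A.
Proof.
move=> f_inj m1 A; rewrite (_ : A = \bigcup_n (A `&` [set x | f x = n])); last first.
  by apply/seteqP; split => [x Ax|x [n _ []]//]; exists (f x).
apply: bigcupT_measurable => n.
have [[x [Ax xn]]|H] := pselect (exists x, A x /\ f x = n).
  rewrite (_ : _ `&` _ = [set x])//; apply/seteqP; split => [y [_ /=]|_ ->//].
  by rewrite -xn => /f_inj.
by rewrite (_ : _ `&` _ = set0)// -subset0 => x Ax; apply: H; exists x.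
Qed.

(** The space is countable and its points are Borel, infinity being the complement of all the
    others. Functions of the landing point are therefore measurable at no cost. *)
Lemma measurable_borel_Delta (A : set (borel_Delta N_infty)) : measurable A.
Proof.
apply: (@measurable_countable _ (borel_Delta N_infty) _
  (pcan_inj (@pickleK (option (option nat))))) => s.
have mk k : measurable [set state k : borel_Delta N_infty].
  by apply: sub_sigma_algebra; exact: open_state.
have m0 : measurable [set trap : borel_Delta N_infty].
  by apply: sub_sigma_algebra; exact: open_trap.
case: s => [[k|]|]; [exact: mk| |exact: m0].
rewrite (_ : [set _] = ~` ([set trap] `|` \bigcup_k [set state k])).
  by apply: measurableC; apply: measurableU => //; exact: bigcupT_measurable.
apply/seteqP; split => [_ -> /= [//|[]//]|[[k|]|]//= H].
- by case: H; right; exists k.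
- by case: H; left.
Qed.

Lemma measurable_N_infty (A : set (borelType N_infty)) : measurable A.
Proof.
apply: (@measurable_countable _ (borelType N_infty) _
  (pcan_inj (@pickleK (option nat)))) => s.
have mk k : measurable [set Some k : borelType N_infty].
  apply: sub_sigma_algebra; rewrite -(image_set1 Some).
  by apply: opc_open_some; exact: discrete_open.
case: s => [k|]; first exact: mk.
rewrite (_ : [set _] = ~` (\bigcup_k [set Some k])).
  by apply: measurableC; exact: bigcupT_measurable.
by apply/seteqP; split => [_ -> /= []//|[k|]//= H]; case: H; exists k.
Qed.

End StateSpace.

(** * Joint measurability of the paths, and the lifetime *)

Section Paths.
Context {R : realType} {d : measure_display} {Omega : measurableType d}.
Variable X : strong_markov_process R N_infty d Omega.

Lemma measurable_path t (B : set (borel_Delta N_infty)) : 0 <= t ->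
  measurable (smp_path X t @^-1` B).
Proof.
move=> t0; apply: (smp_filt_sub t0); apply: smp_adapted => //.
exact: measurable_borel_Delta.
Qed.

Lemma path_open_right t omega (B : set (S_Delta N_infty)) : 0 <= t -> open B ->
  B (smp_path X t omega) ->
  exists2 e, 0 < e & forall r, t <= r -> r < t + e -> B (smp_path X r omega).
Proof.
move=> t0 oB Bt; have H := @smp_right_continuous _ _ _ _ X omega t t0.
have nB : nbhs (smp_path X t omega : S_Delta N_infty) B by exact: open_nbhs_nbhs.
have [e /= e0 He] := H B nB.
exists e => // r; rewrite le_eqVlt => /predU1P[<-//|tr re].
by apply: He => //=; rewrite distrC gtr0_norm ?subr_gt0// ltrBlDl.
Qed.

Definition grid_point (n k : nat) : R := k%:R / n.+1%:R.

(** Time is replaced by the right end point of its grid cell. Right continuity shows that a path in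
    [B] at [t] is in [B] at these end points for all fine grids, since [B] is open, and conversely,
    since its complement is open too. *)
Lemma measurable_path_joint (B : set (S_Delta N_infty)) : open B -> closed B ->
  measurable [set z : R * Omega | 0 <= z.1 /\ B (smp_path X z.1 z.2)].
Proof.
move=> oB cB; pose E := \bigcup_N \bigcap_(n in [set n | (N <= n)%N]) \bigcup_k
  ([set` `[grid_point n k, grid_point n k.+1[] `*`
   (smp_path X (grid_point n k.+1) @^-1` B)).
have dp_ge0 n k : 0 <= grid_point n k by rewrite divr_ge0.
have dpS n k : grid_point n k.+1 = grid_point n k + n.+1%:R^-1.
  by rewrite /grid_point -natr1 mulrDl mul1r.
have small (e : R) : 0 < e -> exists N, forall n, (N <= n)%N -> n.+1%:R^-1 < e.
  move=> e0; exists (Num.bound e^-1) => n Nn.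
  rewrite invf_plt ?posrE//; apply: lt_le_trans (archi_boundP _) _.
    by rewrite invr_ge0 ltW.
  by rewrite ler_nat leqW.
rewrite (_ : [set z | _] = E).
  apply: bigcupT_measurable => N; apply: bigcap_measurable; first by exists N => /=.
  move=> n _; apply: bigcupT_measurable => k; apply: measurableX => //.
  exact: measurable_path.
apply/seteqP; split => [[t om] /= [t0 Bt]|[t om] [N _ H]].
  have [e e0 He] := path_open_right t0 oB Bt.
  have [N HN] := small e e0; exists N => // n /= Nn.
  have n0 : 0 < n.+1%:R :> R by [].
  exists (Num.truncn (t * n.+1%:R)) => //.
  have /andP[h1 h2] := truncn_itv (mulr_ge0 t0 (ltW n0)).
  have h3 : grid_point n (Num.truncn (t * n.+1%:R)) <= t by rewrite ler_pdivrMr.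
  have h4 : t < grid_point n (Num.truncn (t * n.+1%:R)).+1 by rewrite ltr_pdivlMr.
  split; first by rewrite /= in_itv/= h3 h4.
  apply: He; first exact: ltW.
  by rewrite dpS (le_lt_trans (y := t + n.+1%:R^-1)) ?lerD2r ?ltrD2l ?HN.
have t0 : 0 <= t.
  have [k _ [/=]] := H N (leqnn N); rewrite in_itv/= => /andP[+ _] _.
  exact: le_trans.
split => //=; apply: contrapT => nB.
have [e e0 He] := path_open_right t0 (closed_openC cB) nB.
have [M HM] := small e e0.
have [k _ [/=]] := H (maxn N M) (leq_maxl N M).
rewrite in_itv/= => /andP[kt tk]; apply: He; first exact: ltW.
rewrite dpS (le_lt_trans (y := t + (maxn N M).+1%:R^-1)) ?lerD2r ?ltrD2l//.
by rewrite HM// leq_maxr.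
Qed.

(** The infimum is attained: a path off the trap at [t] stays off it for some time after [t], by
    right continuity, and was off it before, since the trap absorbs. *)
Lemma lifetime_le t omega : 0 <= t ->
  (lifetime X omega <= t%:E)%E <-> smp_path X t omega = trap.
Proof.
move=> t0; split=> [lt|Xt]; last first.
  by apply: ereal_inf_lbound; exists t.
apply: contrapT => Xt.
have [e e0 He] := path_open_right t0 (closed_openC closed_trap) Xt.
have : ((t + e)%:E <= lifetime X omega)%E.
  apply: le_ereal_inf_tmp => _ [s [s0 Xs] <-]; rewrite lee_fin leNgt; apply/negP => se.
  have [ts|st] := leP t s; first exact: He Xs.
  by apply: Xt; apply: smp_trap Xs => //; exact: ltW.
by move=> /le_trans /(_ lt); rewrite lee_fin leNgt ltrDl e0.
Qed.

Lemma lifetime_gt t omega : 0 <= t ->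
  (t%:E < lifetime X omega)%E <-> smp_path X t omega <> trap.
Proof.
move=> t0; split=> [tl /(lifetime_le omega t0)|H].
  by rewrite leNgt tl.
by rewrite ltNge; apply/negP => /(lifetime_le omega t0).
Qed.

Lemma lifetime_ge0 omega : (0 <= lifetime X omega)%E.
Proof. by apply: le_ereal_inf_tmp => _ [t [t0 _] <-]; rewrite lee_fin. Qed.

Lemma lifetime_eq0 omega : lifetime X omega = 0%E <-> smp_path X 0 omega = trap.
Proof.
rewrite -lifetime_le//; split=> [->//|H].
by apply/eqP; rewrite eq_le H lifetime_ge0.
Qed.

Lemma measurable_lifetime : measurable_fun setT (lifetime X).
Proof.
apply: (measurability _ (ErealGenOInfty.measurableE R)) => _ [_ [r ->] <-].
have [r0|r0] := leP 0 r.
  rewrite (_ : _ `&` _ = smp_path X r @^-1` ~` [set trap]); first exact: measurable_path.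
  apply/seteqP; split => om /=.
    by move=> [_]; rewrite in_itv/= andbT => /(lifetime_gt om r0).
  by move=> H; split => //; rewrite in_itv/= andbT; apply/(lifetime_gt om r0).
rewrite (_ : _ `&` _ = setT)//; apply/seteqP; split => om //= _; split => //.
by rewrite in_itv/= andbT (lt_le_trans _ (lifetime_ge0 om))// lte_fin.
Qed.

End Paths.

(** * Discounted occupation times *)

Section Occupation.
Context {R : realType} {d : measure_display} {T : measurableType d}.
Variables (al : R) (E : set (R * T)).
Hypothesis mE : measurable E.

(** The discounted time that the sample point [x] spends in [E]. The type [T] is generic because it
    will be both the space of single paths and that of sequences of pieces. *)
Definition occupation (x : T) : \bar R :=
  elaplace al (fun t => (\1_E (t, x))%:E).

Let E' := E `&` [set z | 0 <= z.1].

Let mE' : measurable E'.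
Proof.
apply: measurableI => //; rewrite (_ : [set z | _] = `[0, +oo[ `*` setT).
  exact: measurableX.
by apply/seteqP; split => z /=; rewrite in_itv/= andbT // => -[].
Qed.

Let F (z : R * T) : \bar R := ((expR (- al * z.1))%:E * (\1_E' z)%:E)%E.

Let mF : measurable_fun setT F.
Proof.
apply: emeasurable_funM; apply/measurable_EFinP.
  by apply: (measurableT_comp (measurable_expRM (- al))); exact: measurable_fst.
exact: measurable_indic.
Qed.

Let F0 z : (0 <= F z)%E. Proof. by rewrite mule_ge0// lee_fin ?expR_ge0. Qed.

Let occupationE x : occupation x = (\int[lebesgue_measure]_t F (t, x))%E.
Proof.
rewrite /occupation /elaplace integral_mkcond; apply: eq_integral => t _.
rewrite patchE mem_setE in_itv/= andbT /F /= indicE.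
have [t0|t0] := boolP (0 <= t).
  congr (_ * _%:R%:E)%E; congr nat_of_bool; apply/idP/idP; rewrite !inE//.
  by case.
by rewrite indicE memNset ?mule0//; case=> _ /= t1; rewrite t1 in t0.
Qed.

Lemma measurable_occupation : measurable_fun setT occupation.
Proof.
rewrite (_ : occupation = fun x => \int[lebesgue_measure]_t F (t, x))%E.
  exact: (@measurable_fun_fubini_tonelli_G _ _ _ _ _ lebesgue_measure F mF F0).
by apply/funext => x; exact: occupationE.
Qed.

Lemma occupation_ge0 x : (0 <= occupation x)%E.
Proof. by apply: elaplace_ge0 => t _; rewrite lee_fin. Qed.

Lemma occupation_le x : 0 < al -> (occupation x <= (al^-1)%:E)%E.
Proof.
move=> al0; rewrite -elaplace_cst//; apply: le_elaplace => //.
  apply/measurable_EFinP; apply: measurable_funTS.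
  apply: (measurableT_comp (f := (\1_E : R * T -> R))) => //.
by move=> t _; rewrite lee_fin indicE; case: (_ \in _).
Qed.

Lemma integral_occupation (P : probability T R) :
  (\int[P]_x occupation x = elaplace al (fun t => P (xsection E t)))%E.
Proof.
under eq_integral do rewrite occupationE.
rewrite -(@fubini_tonelli _ _ _ _ _ lebesgue_measure P F mF F0).
rewrite /elaplace [RHS]integral_mkcond; apply: eq_integral => t _.
rewrite patchE mem_setE in_itv/= andbT /F /=.
rewrite ge0_integralZl//; last first.
  apply/measurable_EFinP.
  by apply: (measurableT_comp (f := (\1_E' : R * T -> R))); [exact: measurable_indic|exact: measurable_pair1].
have -> : (\int[P]_y (\1_E' (t, y))%:E = P (xsection E' t))%E.
  rewrite -[in RHS](setIT (xsection E' t)) -integral_indic//; last exact: measurable_xsection.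
  by apply: eq_integral => y _; rewrite !indicE mem_xsection.
have [t0|t0] := boolP (0 <= t).
  congr (_ * P _)%E; apply/seteqP; split => y; rewrite /xsection /= !inE => //.
  by case.
rewrite (_ : xsection E' t = set0) ?measure0 ?mule0//.
by rewrite -subset0 => y; rewrite /xsection /= inE => -[_ /= t1]; rewrite t1 in t0.
Qed.

End Occupation.

Section StartLaw.
Context {R : realType} {d : measure_display} {Omega : measurableType d}.
Variable X : strong_markov_process R N_infty d Omega.

(** The measure [smp_law X x] under a name of its own, to which a probability structure can be
    attached. *)
Definition start_law (x : borel_Delta N_infty) : set Omega -> \bar R := smp_law X x.

HB.instance Definition _ x := Measure.on (start_law x).
HB.instance Definition _ x :=
  Measure_isProbability.Build _ _ _ (start_law x) (prob_kernel x).

Definition path_in (B : set (borel_Delta N_infty)) : set (R * Omega) :=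
  [set z | 0 <= z.1 /\ B (smp_path X z.1 z.2)].

Lemma xsection_path_in B t : 0 <= t ->
  xsection (path_in B) t = smp_path X t @^-1` B.
Proof.
move=> t0; apply/seteqP; split => om; rewrite /xsection /= inE.
  by case.
by move=> H; split.
Qed.

Lemma resolvent_indic al (f : N_infty -> R) (B : set (S_Delta N_infty)) x :
  0 < al -> open B -> closed B ->
  (forall y : borel_Delta N_infty, oapp f 0 y = \1_B y) ->
  (resolvent X al f x)%:E =
  (\int[start_law (Some x)]_om occupation al (path_in B) om)%E.
Proof.
move=> al0 oB cB fB; have mB := measurable_path_joint X oB cB.
pose P : probability Omega R := start_law (Some x).
have mt t : 0 <= t -> measurable (smp_path X t @^-1` B) by exact: measurable_path.
have PE t : 0 <= t -> (\int[smp_law X (Some x)]_om oapp f 0 (smp_path X t om))%:E =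
    P (smp_path X t @^-1` B).
  move=> t0; rewrite /Rintegral.
  rewrite (_ : (\int[smp_law X (Some x)]_om (oapp f 0 (smp_path X t om))%:E)%E =
     P (smp_path X t @^-1` B)).
    by rewrite fineK// fin_num_measure//; exact: mt.
  rewrite -[in RHS](setIT (_ @^-1` _)) -integral_indic//; last exact: mt.
  apply: eq_integral => om _; by rewrite fB.
have E : (\int[lebesgue_measure]_(t in `[0%R, +oo[)
   (expR (- al * t) * \int[smp_law X (Some x)]_om oapp f 0 (smp_path X t om))%:E)%E =
   (\int[P]_om occupation al (path_in B) om)%E.
  rewrite (integral_occupation al mB P).
  apply: eq_integral => t; rewrite inE/= in_itv/= andbT => t0.
  by rewrite EFinM PE// xsection_path_in.
rewrite /resolvent {1}/Rintegral fineK; first exact: E.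
rewrite E ge0_fin_numE; last by apply: integral_ge0 => om _; exact: occupation_ge0.
apply: (@le_lt_trans _ _ (\int[P]_om (al^-1)%:E)%E).
  apply: ge0_le_integral => //.
  - by move=> om _; exact: occupation_ge0.
  - exact: measurable_occupation.
  - by move=> om _; exact: occupation_le.
by rewrite integral_cst//= [X in (_ * X)%E](@probability_setT _ _ _ P) mule1 ltry.
Qed.

End StartLaw.

Section Discount.
Context {R : realType} {d : measure_display} {Omega : measurableType d}.
Variable X : strong_markov_process R N_infty d Omega.
Variable al : R.
Hypothesis al0 : 0 < al.

(** For an infinite lifetime the value 0 is the limit of exp(-al r), not merely a default. *)
Definition discount (omega : Omega) : R :=
  if lifetime X omega is r%:E then expR (- al * r) else 0.

Let alive := path_in X (~` [set trap]).

Let malive : measurable alive.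
Proof.
apply: measurable_path_joint.
- by rewrite openC; exact: closed_trap.
- by rewrite closedC; exact: open_trap.
Qed.

Lemma discount_ge0 omega : 0 <= discount omega.
Proof. by rewrite /discount; case: (lifetime X omega) => // r; exact: expR_ge0. Qed.

(** The integral of exp(-al t) over [0, r) is (1 - exp(-al r)) / al. This relates the discount to
    the resolvent of the constant 1, which the form determines. *)
Lemma discount_occupation omega :
  (occupation al alive omega + (al^-1 * discount omega)%:E = (al^-1)%:E)%E.
Proof.
have z0 := lifetime_ge0 X omega.
have aliveE t : 0 <= t -> (t%:E < lifetime X omega)%E -> \1_alive (t, omega) = 1 :> R.
  by move=> t0 tl; rewrite indicE mem_set//; split => //; apply/(lifetime_gt X omega t0).
have deadE t : (lifetime X omega <= t%:E)%E -> \1_alive (t, omega) = 0 :> R.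
  move=> tl; rewrite indicE memNset// => -[/= t0] /(lifetime_gt X omega t0).
  by rewrite ltNge tl.
have m1 : measurable_fun (`[0, +oo[ : set R) (fun t => (\1_alive (t, omega) : R)%:E).
  apply/measurable_EFinP; apply: measurable_funTS.
  by apply: (measurableT_comp (f := (\1_alive : R * Omega -> R))).
rewrite /discount /occupation; case Hl : (lifetime X omega) z0 => [r| |] // z0.
  have r0 : 0 <= r by rewrite -lee_fin.
  rewrite (elaplace_split al r0)//.
  rewrite [X in (_ + X + _)%E]integral0_eq ?adde0; last first.
    by move=> t; rewrite /= in_itv/= andbT => rt; rewrite deadE ?mule0// Hl lee_fin.
  rewrite -[RHS](elaplace_cst al0) (elaplace_split al r0)//.
  congr (_ + _)%E.
    apply: eq_integral => t; rewrite inE/= in_itv/= => /andP[t0 tr].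
    by rewrite aliveE// Hl lte_fin.
  have m1' : measurable_fun [set: R] (cst 1%E : R -> \bar R) by exact: measurable_cst.
  have := @elaplace_shift _ al r (cst 1%E) m1' (fun=> lee01).
  by rewrite elaplace_cst// -EFinM mulrC => <-.
rewrite mulr0 adde0 -elaplace_cst//; apply: eq_integral => t.
by rewrite inE/= in_itv/= andbT => t0; rewrite aliveE// Hl ltry.
Qed.

Lemma measurable_discount : measurable_fun setT (fun omega => (discount omega)%:E).
Proof.
rewrite (_ : (fun _ => _) = fun omega => (1 - al%:E * occupation al alive omega)%E).
  apply: emeasurable_funB => //; apply: emeasurable_funM => //.
  exact: measurable_occupation.
apply/funext => omega; have H := discount_occupation omega.
have occ0 := occupation_ge0 al alive omega; have occ1 := occupation_le malive omega al0.
move: H occ0; case: occupation occ1 => [x|//|//] _.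
rewrite -EFinD => -[H] _; rewrite -EFinM -EFinB; congr EFin.
have -> : x = al^-1 - al^-1 * discount omega by apply/eqP; rewrite eq_sym subr_eq H.
by field; rewrite gt_eqF.
Qed.

Lemma integral_discount x (r : R) :
  (\int[start_law X x]_om occupation al alive om = (al^-1 * (1 - r))%:E)%E ->
  (\int[start_law X x]_om (discount om)%:E = r%:E)%E.
Proof.
move=> H; pose P : probability Omega R := start_law X x.
have : (\int[P]_om (occupation al alive om + (al^-1 * discount om)%:E))%E = (al^-1)%:E.
  under eq_integral do rewrite discount_occupation.
  by rewrite integral_cst//= [X in (_ * X)%E](@probability_setT _ _ _ P) mule1.
rewrite ge0_integralD//; last 4 first.
- by move=> om _; exact: occupation_ge0.
- exact: measurable_occupation.
- by move=> om _; rewrite lee_fin mulr_ge0 ?invr_ge0 ?(ltW al0) ?discount_ge0.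
- by under eq_fun do rewrite EFinM; apply: emeasurable_funM => //; exact: measurable_discount.
rewrite [X in (X + _)%E]H; under eq_integral do rewrite EFinM.
rewrite ge0_integralZl//; last 3 first.
- exact: measurable_discount.
- by move=> om _; rewrite lee_fin discount_ge0.
- by rewrite lee_fin invr_ge0 ltW.
have : (0 <= \int[P]_om (discount om)%:E)%E.
  by apply: integral_ge0 => om _; rewrite lee_fin discount_ge0.
rewrite -/P; case: (\int[P]_om _)%E => [y _|_|//].
  rewrite -EFinM -EFinD => -[] E; congr EFin.
  have : al^-1 * y = al^-1 * r by lra.
  by apply: mulfI; rewrite invr_eq0 gt_eqF.
by rewrite gt0_muley ?lte_fin ?invr_gt0.
Qed.

End Discount.

Section ResolventValues.
Variables (R : realType) (a b : nat -> R).
Hypothesis a0 : a 0%N = 0.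
Hypothesis a_gt0 : forall k, (1 <= k)%N -> 0 < a k.
Hypothesis b_gt0 : forall k, 0 < b k.
Hypothesis hregular : regular_boundary a b.
Variable pmin : R -> nat -> nat -> R.
Hypothesis hmin : minimal_Q_process a b pmin.
Variables (d : measure_display) (Omega : measurableType d).
Variable X : strong_markov_process R N_infty d Omega.
Variable kappa : R.
Hypothesis kappa0 : 0 <= kappa.
Hypothesis hX : associated a b kappa X.
Variable al : R.
Hypothesis al0 : 0 < al.

Local Notation mu := (bd_mu a b).
Local Notation Phi := (laplace pmin al).
Local Notation u := (u_ pmin al).
Local Notation mass_u := (bd_mass_u a b pmin al).
Local Notation D := (kappa + al * mass_u).

Let hQ : Q_process a b pmin. Proof. by case: hmin. Qed.

Lemma form_denom_gt0 : 0 < D.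
Proof. by rewrite ltr_wpDl// mulr_gt0//; exact: bd_mass_u_gt0. Qed.

(** By association the resolvent solves the weak equation, and so does every solution of the
    boundary value problem; [form_unique] identifies them. *)
Let resolvent_eq (v : nat -> R) (f : borelType N_infty -> R) phi l Bv Bf :
  (forall k, `|v k| <= Bv) -> (forall x, `|f x| <= Bf) ->
  (forall k, bd_gen a b v k = al * v k - f (Some k)) ->
  bd_flux a b v n @[n --> \oo] --> phi -> v n @[n --> \oo] --> l ->
  phi + kappa * l = 0 -> forall i, resolvent X al f (Some i) = v i.
Proof.
move=> vB fB v_gen v_flux v_lim v_bnd.
have mf : measurable_fun setT f.
  by move=> _ B mB; exact: measurable_N_infty.
have fL2 : in_L2 a b (fun k => f (Some k)).
  apply: (@le_lt_trans _ _ ((Bf ^+ 2)%:E * \sum_(0 <= k <oo) (mu k)%:E)%E).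
    rewrite -nneseriesZl => [|k _]; last by rewrite lee_fin ltW// bd_mu_gt0.
    apply: lee_nneseries => [k _ _|k _].
      by rewrite lee_fin; apply: mulr_ge0; [exact: sqr_ge0|rewrite ltW// bd_mu_gt0].
    rewrite -EFinM lee_fin ler_wpM2r//; first by rewrite ltW// bd_mu_gt0.
    rewrite -real_normK ?num_real// lerXn2r ?nnegrE//.
    by apply: le_trans (fB None).
  by rewrite lte_mul_pinfty// ?lee_fin ?sqr_ge0//; exact: bd_mu_summable.
have [GG Geq] := hX al0 mf (ex_intro _ Bf fB) fL2.
apply: (form_unique a_gt0 b_gt0 hregular al0 kappa0 GG _ Geq).
- exact: (form_solution_G_star a_gt0 b_gt0 hregular vB v_flux).
- move=> g gG.
  exact: (form_solution_eq a0 a_gt0 b_gt0 hregular vB (fun k => fB (Some k)) v_gen v_flux v_lim v_bnd gG).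
Qed.

Lemma resolvent_state j i :
  resolvent X al (fun x : borelType N_infty => \1_[set Some j] x) (Some i) =
  Phi i j + u i * (mu j * u j / D).
Proof.
(* The multiple of [u] that corrects [Phi]: with limit [cj] and flux -mu_j u_j + cj al [mass_u], the
   boundary condition reads cj D = mu_j u_j. *)
have D0 := form_denom_gt0; pose cj := mu j * u j / D.
rewrite (mulrC (u i)).
apply: (@resolvent_eq (fun k => Phi k j + cj * u k) _
  (- (mu j * u j) + cj * (al * mass_u)) cj (al^-1 + `|cj|) 1).
- move=> k; apply: le_trans (ler_normD _ _) _; apply: lerD.
    by rewrite ger0_norm; [exact: (laplace_le hQ al0)|exact: (laplace_ge0 hQ al0)].
  rewrite normrM -[leRHS]mulr1 ler_wpM2l// ger0_norm.
    exact: (u_le1 hmin al0).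
  exact: (u_ge0 hmin al0).
- by move=> x; rewrite indicE; case: (_ \in _); rewrite ?normr1 ?normr0.
- move=> k; have H1 := bd_gen_Phi a0 hmin al0 k j.
  have H2 := bd_gen_u a0 hmin al0 k.
  rewrite indicE (_ : (Some k \in [set Some j]) = (k == j)); last first.
    by apply/idP/eqP => [|->]; rewrite inE //=; case.
  by rewrite bd_gen_comb H1 H2; ring.
- have H1 := @bd_flux_Phi_cvg _ _ _ a0 a_gt0 b_gt0 hregular _ hmin _ al0 j.
  have H2 := @bd_flux_u_cvg _ _ _ a0 a_gt0 b_gt0 hregular _ hmin _ al0.
  under eq_fun do rewrite bd_flux_comb.
  by apply: cvgD => //; apply: cvgM => //; exact: cvg_cst.
- rewrite -[X in _ --> X](_ : 0 + cj * 1 = cj); last by ring.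
  apply: cvgD; first exact: (@Phi_cvg0 _ _ _ a0 a_gt0 b_gt0 hregular _ hmin _ al0).
  apply: cvgM; first exact: cvg_cst.
  exact: (@u_cvg1 _ _ _ a0 a_gt0 b_gt0 hregular _ hmin _ al0).
- by rewrite /cj; field; rewrite gt_eqF.
Qed.

Lemma resolvent_alive i :
  resolvent X al (fun=> 1) (Some i) = al^-1 * (1 - kappa * u i / D).
Proof.
(* The constant 1/al solves the equation with zero flux; adding [cu * u] restores the boundary
   condition, which reads cu D = - kappa / al. *)
have D0 := form_denom_gt0; pose cu := - (al^-1 * (kappa / D)).
have vE : (fun k => al^-1 * (1 - kappa * u k / D)) = (fun k => al^-1 + cu * u k).
  by apply/funext => k; rewrite /cu; ring.
apply: (@resolvent_eq (fun k => al^-1 * (1 - kappa * u k / D)) _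
  (- (al^-1 * (kappa / D) * (al * mass_u))) (al^-1 * (1 - kappa * 1 / D))
  (al^-1 * (1 + kappa / D)) 1).
- move=> k; have u0 := u_ge0 hmin al0 k; have u1 := u_le1 hmin al0 k.
  rewrite normrM ger0_norm ?invr_ge0 ?(ltW al0)// ler_wpM2l ?invr_ge0 ?(ltW al0)//.
  apply: le_trans (ler_normB _ _) _; rewrite normr1 lerD2l ger0_norm.
    by rewrite ler_wpM2r ?invr_ge0 ?(ltW D0)// -[leRHS]mulr1 ler_wpM2l.
  by rewrite divr_ge0 ?mulr_ge0 ?(ltW D0).
- by move=> x; rewrite normr1.
- move=> k; have H2 := bd_gen_u a0 hmin al0 k.
  by rewrite vE bd_gen_affine H2 /cu; field; rewrite !gt_eqF.
- have H2 := @bd_flux_u_cvg _ _ _ a0 a_gt0 b_gt0 hregular _ hmin _ al0.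
  rewrite vE; under eq_fun do rewrite bd_flux_affine.
  by rewrite -mulNr; apply: cvgM => //; exact: cvg_cst.
- apply: cvgM; first exact: cvg_cst.
  apply: cvgB; first exact: cvg_cst.
  apply: cvgM; last exact: cvg_cst.
  apply: cvgM; first exact: cvg_cst.
  exact: (@u_cvg1 _ _ _ a0 a_gt0 b_gt0 hregular _ hmin _ al0).
- by field; rewrite !gt_eqF.
Qed.

Lemma integral_occupation_state i j :
  (\int[start_law X (state i)]_om occupation al (path_in X [set state j]) om =
   (Phi i j + u i * (mu j * u j / D))%:E)%E.
Proof.
rewrite -resolvent_state; apply/esym.
apply: (@resolvent_indic _ _ _ X al _ [set state j] (Some i) al0).
- exact: open_state.
- exact: closed_state.
- move=> [y|] /=; rewrite !indicE; last by rewrite memNset.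
  congr (_%:R); congr nat_of_bool; apply/idP/idP; rewrite !inE; first by move=> ->.
  by case.
Qed.

Lemma integral_discount_state i :
  (\int[start_law X (state i)]_om (discount X al om)%:E = (kappa * u i / D)%:E)%E.
Proof.
apply: (integral_discount al0); rewrite -resolvent_alive.
rewrite (@resolvent_indic _ _ _ X al (fun=> 1) (~` [set trap]) (Some i) al0)//.
- by rewrite openC; exact: closed_trap.
- by rewrite closedC; exact: open_trap.
- move=> [y|] /=; rewrite indicE; first by rewrite mem_set.
  by rewrite memNset// => H; exact: H.
Qed.

End ResolventValues.

(** * The sequence of pieces *)

Section SequenceSpace.
Context {d : measure_display} {T : measurableType d}.

Definition cyl (As : seq (set T)) : set (sequences T) :=
  [set w | forall i, (i < size As)%N -> nth set0 As i (w i)].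

Definition seq_shift (w : sequences T) : sequences T := fun n => w n.+1.

Lemma measurable_coord n : measurable_fun setT (fun w : sequences T => w n).
Proof.
move=> _ B mB; rewrite setTI; apply: sub_sigma_algebra.
by exists n => //; exists B => //; rewrite setTI.
Qed.

Lemma measurable_seq_shift : measurable_fun setT seq_shift.
Proof.
apply: (measurability _ (erefl : @measurable _ (sequences T) = <<s cylinders T >>)).
move=> _ [_ [n _ [B mB <-]] <-]; rewrite !setTI.
have -> : seq_shift @^-1` ((fun w : nat -> T => w n) @^-1` B) =
  (fun w : sequences T => w n.+1) @^-1` B by [].
by rewrite -[X in measurable X]setTI; exact: measurable_coord.
Qed.

Lemma measurable_cyl As : (forall i, (i < size As)%N -> measurable (nth set0 As i)) ->
  measurable (cyl As).
Proof.
move=> mAs; rewrite (_ : cyl As =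
    \bigcap_(i in [set i | (i < size As)%N]) ((fun w : sequences T => w i) @^-1` nth set0 As i)).
  apply: bigcap_measurableType => i iAs.
  by rewrite -[X in measurable X]setTI; apply: measurable_coord => //; exact: mAs.
by apply/seteqP; split => w H i; exact: H.
Qed.

Definition cyls : set (set (sequences T)) :=
  [set cyl As | As in [set As | forall i, (i < size As)%N -> measurable (nth set0 As i)]].

Lemma cyls_generate : @measurable _ (sequences T) = <<s cyls >>.
Proof.
apply/seteqP; split.
  apply: smallest_sub; first exact: smallest_sigma_algebra.
  move=> _ [n _ [B mB <-]]; apply: sub_sigma_algebra; rewrite setTI.
  exists (rcons (nseq n setT) B).
    move=> i; rewrite size_rcons size_nseq ltnS nth_rcons size_nseq nth_nseq.
    by case: ltngtP => // _ _; exact: measurableT.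
  apply/seteqP; split => w.
    by move=> /(_ n); rewrite size_rcons size_nseq nth_rcons size_nseq ltnn eqxx; apply.
  move=> Bw i; rewrite size_rcons size_nseq ltnS nth_rcons size_nseq nth_nseq.
  by case: ltngtP => // ->.
apply: smallest_sub; first exact: sigma_algebra_measurable.
by move=> _ [As mAs <-]; exact: measurable_cyl.
Qed.

Lemma cyls_setI : setI_closed cyls.
Proof.
move=> _ _ [As mAs <-] [Bs mBs <-].
pose n := maxn (size As) (size Bs).
(* The shorter list is padded with the full set to reach the common length. *)
pose ext (s : seq (set T)) i := if (i < size s)%N then nth set0 s i else setT.
exists (mkseq (fun i => ext As i `&` ext Bs i) n).
  move=> i; rewrite size_mkseq => iLn; rewrite nth_mkseq//.
  by apply: measurableI; rewrite /ext; case: ifP => // H; [exact: mAs|exact: mBs].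
apply/seteqP; split => w.
  move=> H; split => i iA.
    have iLn : (i < n)%N by rewrite leq_max iA.
    by have := H i; rewrite size_mkseq nth_mkseq// /ext iA => /(_ iLn) [].
  have iLn : (i < n)%N by rewrite leq_max iA orbT.
  by have := H i; rewrite size_mkseq nth_mkseq// /ext iA => /(_ iLn) [].
move=> [HA HB] i; rewrite size_mkseq => iLn; rewrite nth_mkseq// /ext.
by split; case: ifP => // H; [exact: HA|exact: HB].
Qed.

End SequenceSpace.

(** Bundles the push-forward with its measure structure, the form in which the uniqueness theorems
    for measures take it. *)
Lemma pushforward_measure_ex (R : realType) d1 d2 (T1 : measurableType d1)
    (T2 : measurableType d2) (mu : {measure set T1 -> \bar R}) (f : T1 -> T2) :
  measurable_fun setT f ->
  exists m : {measure set T2 -> \bar R}, forall A, m A = mu (f @^-1` A).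
Proof.
move=> mf.
by exists (measure_function_pushforward__canonical__measure_function_Measure mu mf).
Qed.

Section PiecingLaw.
Context {R : realType} {d : measure_display} {Omega : measurableType d}.
Variable X : strong_markov_process R N_infty d Omega.
Variable pi : probability (borel_Delta N_infty) R.
Local Notation St := (borel_Delta N_infty).
Local Notation W := (Omega * St)%type.
Variable Pt : St -> probability (sequences W) R.
Hypothesis hPt : piecing_law X pi Pt.

(** The trap absorbs, so a path is constantly at the trap as soon as it starts there. *)
Lemma kill_kernelE omega : kill_kernel X pi omega =
  if `[< smp_path X 0 omega = trap >]
  then (dirac (trap : St) : probability _ R) else pi.
Proof.
rewrite /kill_kernel; congr (if _ then _ else _); apply/asboolP/asboolP => [|H t t0].
  by apply; rewrite lexx.
by apply: smp_trap H.
Qed.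

Lemma smp_law_start x : smp_law X x [set omega | smp_path X 0 omega = x] = 1%E.
Proof. exact: smp_normal. Qed.

Lemma smp_law_start_ne x (B : set Omega) : measurable B ->
  B `<=` [set omega | smp_path X 0 omega <> x] -> smp_law X x B = 0%E.
Proof.
move=> mB BE; pose P : probability Omega R := start_law X x.
have mS : measurable [set omega | smp_path X 0 omega = x].
  by have := measurable_path X [set x] (lexx 0).
have H : P (~` [set omega | smp_path X 0 omega = x]) = 0%E.
  by rewrite probability_setC// [X in (_ - X)%E](smp_law_start x) subee.
by apply/eqP; rewrite eq_le measure_ge0 andbT -H le_measure// inE//; exact: measurableC.
Qed.

Let mS : measurable [set omega | smp_path X 0 omega = trap].
Proof. by have := measurable_path X [set trap] (lexx 0). Qed.

Lemma kill_integral (A : set W) omega : measurable A ->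
  (\int[kill_kernel X pi omega]_y (\1_A (omega, y))%:E =
   if `[< smp_path X 0 omega = trap >] then (\1_A (omega, trap))%:E
   else pi (xsection A omega))%E.
Proof.
move=> mA; rewrite kill_kernelE.
have mo : measurable_fun setT (fun y : St => (\1_A (omega, y) : R)%:E).
  by move=> _ B _; exact: measurable_borel_Delta.
case: ifP => _; first by rewrite [LHS]integral_dirac// diracE mem_set// mul1e.
rewrite -[in RHS](setIT (xsection A omega)) -integral_indic//; last first.
  exact: measurable_xsection.
by apply: eq_integral => y _; rewrite !indicE mem_xsection.
Qed.

Lemma measurable_kill_integral (A : set W) : measurable A ->
  measurable_fun setT
    (fun omega => \int[kill_kernel X pi omega]_y (\1_A (omega, y))%:E)%E.
Proof.
move=> mA; rewrite (_ : (fun _ => _) = fun omega =>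
   if `[< smp_path X 0 omega = trap >] then (\1_A (omega, trap))%:E
   else pi (xsection A omega)); last by apply/funext => omega; exact: kill_integral.
apply: measurable_fun_ifT.
- apply: (measurable_fun_bool true); rewrite setTI (_ : _ @^-1` _ =
    [set omega | smp_path X 0 omega = trap])//.
  by apply/seteqP; split => omega /= /asboolP.
- apply/measurable_EFinP.
  exact: (measurableT_comp (f := (\1_A : W -> R)) (measurable_indic mA) (measurable_pair2 _)).
- exact: measurable_fun_xsection.
Qed.

Lemma Q_integral_cst (A : set W) (F : St -> \bar R) (c : R) x : measurable A ->
  0 <= c -> (forall z, A z -> F z.2 = c%:E) ->
  Q_integral X pi A F x = (c%:E * Q_integral X pi A (fun=> 1%E) x)%E.
Proof.
move=> mA c0 Fc; rewrite /Q_integral.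
have mk := measurable_kill_integral mA.
have mo omega : measurable_fun setT (fun y : St => (\1_A (omega, y) : R)%:E).
  by move=> _ B _; exact: measurable_borel_Delta.
transitivity (c%:E * \int[smp_law X x]_omega
    \int[kill_kernel X pi omega]_y (\1_A (omega, y))%:E)%E; last first.
  congr (_ * _)%E; apply: eq_integral => omega _.
  by apply: eq_integral => y _; rewrite mule1.
rewrite -ge0_integralZl//; last first.
  by move=> omega _; apply: integral_ge0 => y _; rewrite lee_fin.
apply: eq_integral => omega _; rewrite -ge0_integralZl//.
apply: eq_integral => y _; rewrite indicE.
have [yA|yA] := boolP ((omega, y) \in A); last by rewrite mul0e mule0.
by rewrite mul1e mule1; have := Fc _ (set_mem yA).
Qed.

Lemma piecing_fdd1 (A : set W) x : measurable A ->
  Pt x [set w | A (w 0%N)] = Q_integral X pi A (fun=> 1%E) x.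
Proof.
move=> mA; rewrite -[RHS]/(piecing_fdd X pi x [:: A]) -hPt.
  by congr (Pt x _); apply/seteqP; split => w /= => [Aw [|//]|/(_ 0%N)]; last apply.
by move=> [].
Qed.

(** Renewal at the first landing. As functions of [C] both sides are finite measures, and they agree
    on cylinders by [piecing_law]. With the landing point fixed at [s], the law of the continuation
    is a constant that leaves the integral. *)
Lemma piecing_markov x (A : set W) s (C : set (sequences W)) :
  measurable A -> measurable C ->
  Pt x [set w | [/\ A (w 0%N), (w 0%N).2 = s & C (seq_shift w)]] =
  (Pt x [set w | A (w 0%N) /\ (w 0%N).2 = s] * Pt s C)%E.
Proof.
move=> mA mC; pose A' := A `&` [set z : W | z.2 = s].
have mA' : measurable A'.
  apply: measurableI => //; rewrite (_ : [set z | _] = setT `*` [set s]).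
    by apply: measurableX => //; exact: measurable_borel_Delta.
  by apply/seteqP; split => z //= [].
pose A0 := [set w : sequences W | A' (w 0%N)].
have mA0 : measurable A0.
  by rewrite -[A0]setTI; exact: (measurable_coord (T := W) 0).
have c0 : 0 <= fine (Pt x A0) by rewrite fine_ge0.
have cE : (fine (Pt x A0))%:E = Pt x A0 by rewrite fineK// fin_num_measure.
pose m1 := pushforward (mrestr (Pt x) mA0) (@seq_shift _ W).
pose m2 := mscale (NngNum c0) (Pt s).
have m1E B : m1 B = Pt x (seq_shift @^-1` B `&` A0) by [].
have m2E B : m2 B = (Pt x A0 * Pt s B)%E by rewrite -cE.
transitivity (m1 C).
  by rewrite m1E; congr (Pt x _); apply/seteqP; split => [w [? ? ?]|w [? [? ?]]].
rewrite -m2E; apply: (measure_unique (@cyls _ W) (fun=> setT)) => //.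
- exact: cyls_generate.
- exact: cyls_setI.
- move=> _; exists [::] => //.
  by apply/seteqP; split.
- by rewrite bigcup_const.
- exact: measurable_seq_shift.
- move=> ? _ [As mAs <-]; rewrite [LHS]m1E [RHS]m2E.
  have mAAs i : (i < size (A' :: As))%N -> measurable (nth set0 (A' :: As) i).
    by case: i => //= i; exact: mAs.
  rewrite (_ : _ `&` _ = cyl (A' :: As)); last first.
    apply/seteqP; split => w.
      by move=> [H1 H2] [_|i] //= iAs; exact: H1.
    by move=> H; split; [move=> i iAs; exact: (H i.+1)|exact: (H 0%N)].
  have cylE y Bs : (forall i, (i < size Bs)%N -> measurable (nth set0 Bs i)) ->
      Pt y (cyl Bs) = piecing_fdd X pi y Bs by exact: hPt.
  rewrite [LHS]cylE// [LHS]/piecing_fdd /=.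
  have sE : piecing_fdd X pi s As = (fine (Pt s (cyl As)))%:E.
    by rewrite -cylE// fineK// fin_num_measure//; exact: measurable_cyl.
  rewrite (@Q_integral_cst A' (foldr (Q_integral X pi) (fun=> 1%E) As) (fine (Pt s (cyl As))))//.
  - by rewrite -piecing_fdd1// muleC fineK// fin_num_measure//; exact: measurable_cyl.
  - by rewrite fine_ge0.
  - by move=> z [_ /= ->].
- move=> ? _; apply: (@le_lt_trans _ _ 1%E); last exact: ltry.
  rewrite [X in (X <= _)%E]m1E; apply: probability_le1.
  by rewrite preimage_setT setTI.
Qed.

(** From [x <> trap] the first path almost surely does not start at the trap, so the kernel is
    almost surely [pi]: path and landing point are independent. *)
Lemma piecing_first_setX x (B : set Omega) (C : set St) : x <> trap -> measurable B ->
  Pt x [set w | B (w 0%N).1 /\ C (w 0%N).2] = (start_law X x B * pi C)%E.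
Proof.
move=> xt mB; have mC : measurable C by exact: measurable_borel_Delta.
have mBC : measurable (B `*` C) by exact: measurableX.
rewrite (piecing_fdd1 x mBC) /Q_integral; pose P : probability Omega R := start_law X x.
have picE : (fine (pi C))%:E = pi C by rewrite fineK// fin_num_measure.
transitivity (\int[P]_omega ((fine (pi C))%:E * (\1_B omega)%:E))%E.
  under eq_integral => omega _ do under eq_integral do rewrite mule1.
  apply: ge0_ae_eq_integral => //.
  - exact: measurable_kill_integral.
  - by apply: emeasurable_funM => //; apply/measurable_EFinP.
  - by move=> omega _; apply: integral_ge0 => y _; rewrite lee_fin.
  - by move=> omega _; rewrite -EFinM lee_fin mulr_ge0// fine_ge0.
  exists [set omega | smp_path X 0 omega = trap]; split => //.
    by apply: smp_law_start_ne => // omega /= ->; apply/nesym.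
  move=> omega /= H; apply: contrapT => ot; apply: H => _.
  rewrite kill_integral// asboolF// picE indicE.
  have [oB|oB] := boolP (omega \in B).
    rewrite mule1; congr (pi _); apply/seteqP; split => y; rewrite /xsection /= inE.
      by case.
    by split => //=; exact: set_mem.
  rewrite mule0 (_ : xsection _ _ = set0) ?measure0//.
  rewrite -subset0 => y; rewrite /xsection /= inE => -[/= oB' _].
  by rewrite mem_set in oB.
rewrite ge0_integralZl//; last 2 first.
- by apply/measurable_EFinP.
- by rewrite lee_fin fine_ge0.
by rewrite integral_indic// setIT picE muleC.
Qed.

Lemma piecing_first x (A : set W) : x <> trap -> measurable A ->
  Pt x [set w | A (w 0%N)] = (start_law X x \x pi)%E A.
Proof.
move=> xt mA; pose P : probability Omega R := start_law X x.
have [m mE] := pushforward_measure_ex (Pt x) (@measurable_coord _ W 0).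
rewrite -[LHS]mE; apply/esym.
apply: (@product_measure_unique _ _ _ _ _ P pi m) => // B C mB mC.
by rewrite mE -[RHS](piecing_first_setX C xt mB).
Qed.

Let first_shift (w : sequences W) : W * sequences W := (w 0%N, seq_shift w).

Let measurable_first_shift : measurable_fun setT first_shift.
Proof.
by apply: measurable_fun_pair; [exact: measurable_coord|exact: measurable_seq_shift].
Qed.

(** The first path, the landing point and the continuation are factored by Tonelli's theorem, once
    their joint law is known to be a product on the event that the landing point is [s]. *)
Lemma piecing_expectation x s (f : Omega -> \bar R) (G : sequences W -> \bar R) :
  x <> trap -> measurable_fun setT f -> (forall omega, 0 <= f omega)%E ->
  measurable_fun setT G -> (forall w, 0 <= G w)%E ->
  (\int[Pt x]_(w in [set w | (w 0%N).2 = s]) (f (w 0%N).1 * G (seq_shift w)) =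
   (\int[start_law X x]_omega f omega) * pi [set s] * \int[Pt s]_w G w)%E.
Proof.
move=> xt mf f0 mG G0; pose P : probability Omega R := start_law X x.
pose M : probability W R := (P \x pi)%E.
pose D := [set z : W * sequences W | z.1.2 = s].
have ms : measurable [set s : St] by exact: measurable_borel_Delta.
pose D1 := [set z : W | z.2 = s].
have mD1 : measurable D1.
  rewrite (_ : D1 = setT `*` [set s]); first exact: measurableX.
  by apply/seteqP; split => z //= [].
have mD : measurable D.
  rewrite (_ : D = D1 `*` setT); first exact: measurableX.
  by apply/seteqP; split => z //= [].
pose F (z : W * sequences W) : \bar R := (f z.1.1 * G z.2)%E.
have F0 z : (0 <= F z)%E by rewrite mule_ge0.
have mF : measurable_fun setT F.
  apply: emeasurable_funM.
    apply: (measurableT_comp mf); apply: (measurableT_comp measurable_fst).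
    exact: measurable_fst.
  by apply: (measurableT_comp mG); exact: measurable_snd.
have [m mE] := pushforward_measure_ex (Pt x) measurable_first_shift.
transitivity (\int[m]_(z in D) F z)%E.
  transitivity (\int[pushforward (Pt x) first_shift]_(z in D) F z)%E.
    rewrite (ge0_integral_pushforward measurable_first_shift)//.
    exact: measurable_funTS.
  by apply: eq_measure_integral => A mA _; rewrite mE.
(* The law of the continuation is [Pt s] only on [D], so both measures are restricted to [D] before
   the uniqueness theorem is applied to rectangles. *)
have mM A : measurable A -> A `<=` D -> m A = (M \x Pt s)%E A.
  move=> mA AD.
  have mrE (n : {measure set (W * sequences W) -> \bar R}) : mrestr n mD A = n A.
    by rewrite /mrestr setIidl.
  rewrite -mrE -[RHS]mrE.
  apply: (measure_unique [set A `*` B | A in @measurable _ W & B in @measurable _ (sequences W)] (fun=> setT)) => //.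
  - exact: measurable_prod_measurableType.
  - move=> _ _ [A1 mA1 [B1 mB1 <-]] [A2 mA2 [B2 mB2 <-]].
    exists (A1 `&` A2); first exact: measurableI.
    exists (B1 `&` B2); first exact: measurableI.
    by rewrite setXI.
  - by move=> _; exists setT => //; exists setT => //; rewrite setXTT.
  - by rewrite bigcup_const.
  - move=> _ [B mB [C mC <-]].
    change (m (B `*` C `&` D) = (M \x Pt s)%E (B `*` C `&` D)); rewrite mE.
    rewrite (_ : B `*` C `&` D = (B `&` D1) `*` C); last first.
      by apply/seteqP; split => [[z1 z2]|[z1 z2]] /= [[]].
    have mBD : measurable (B `&` D1) by exact: measurableI.
    rewrite [RHS](product_measure1E M (Pt s) mBD mC).
    rewrite -[X in (X * _)%E](piecing_first xt mBD) -[RHS](piecing_markov x s mB mC).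
    by congr (Pt x _); apply/seteqP; split => w /=; [move=> [[]]|move=> []].
  - move=> _; change (m (setT `&` D) < +oo)%E; rewrite setTI mE.
    apply: (@le_lt_trans _ _ 1%E); last exact: ltry.
    by apply: probability_le1; rewrite -[X in measurable X]setTI; exact: measurable_first_shift.
rewrite (eq_measure_integral (M \x Pt s)%E mM) integral_mkcond.
pose g (z : W) : \bar R := (f z.1 * (\1_D1 z)%:E)%E.
have g0 z : (0 <= g z)%E by rewrite mule_ge0// lee_fin.
have mg : measurable_fun setT g.
  apply: emeasurable_funM; first by apply: (measurableT_comp mf); exact: measurable_fst.
  by apply/measurable_EFinP; exact: measurable_indic.
transitivity (\int[M \x Pt s]_z (g z.1 * G z.2))%E.
  apply: eq_integral => z _; rewrite patchE /g indicE.
  have -> : (z \in D) = (z.1 \in D1) by apply/idP/idP; rewrite !inE.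
  by case: ifP => _; rewrite ?mule1// mule0 mul0e.
rewrite (@fubini_tonelli1 _ _ _ _ _ M (Pt s) (fun z => g z.1 * G z.2)%E); last 2 first.
- apply: emeasurable_funM; first by apply: (measurableT_comp mg); exact: measurable_fst.
  by apply: (measurableT_comp mG); exact: measurable_snd.
- by move=> z; rewrite mule_ge0.
transitivity (\int[M]_z (g z * \int[Pt s]_w G w))%E.
  by apply: eq_integral => z _; rewrite /fubini_F/= ge0_integralZl.
rewrite ge0_integralZr//; last by apply: integral_ge0.
congr (_ * _)%E.
rewrite (@fubini_tonelli1 _ _ _ _ _ P pi g)// /fubini_F.
transitivity (\int[P]_omega (f omega * pi [set s]))%E.
  apply: eq_integral => omega _; rewrite /g/= ge0_integralZl//; last first.
    by move=> _ B _; exact: measurable_borel_Delta.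
  congr (_ * _)%E; rewrite -[in RHS](setIT [set s]) -integral_indic//.
by rewrite ge0_integralZr.
Qed.

(** Enumerates the countable state space, to write events as countable unions over the landing
    point; numbers that code no state give the trap. *)
Definition enum_state (n : nat) : St :=
  if @unpickle (option (option nat)) n is Some s then s else trap.

Lemma enum_stateK (s : St) : enum_state (@pickle (option (option nat)) s) = s.
Proof. by rewrite /enum_state pickleK. Qed.

(** There are countably many landing points, and [piecing_markov] makes the contribution of each a
    multiple of a null probability. *)
Lemma piecing_null x (C : St -> set (sequences W)) :
  (forall s, measurable (C s)) -> (forall s, Pt s (C s) = 0%E) ->
  (Pt x).-negligible [set w | C (w 0%N).2 (seq_shift w)].
Proof.
move=> mC C0; apply: (@negligibleS _ _ _ _ (\bigcup_n [set w : sequences W |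
   [/\ setT (w 0%N), (w 0%N).2 = enum_state n & C (enum_state n) (seq_shift w)]])).
  move=> w /= Cw; exists (@pickle (option (option nat)) (w 0%N).2) => //.
  by split => //; rewrite enum_stateK.
apply: negligible_bigcup => n; apply/negligibleP; last first.
  apply: etrans (@piecing_markov x setT (enum_state n) _ measurableT (mC _)) _.
  by rewrite C0 mule0.
have m1 : measurable [set w : sequences W | (w 0%N).2 = enum_state n].
  rewrite -[X in measurable X]setTI.
  apply: (measurableT_comp (f := snd) measurable_snd (@measurable_coord _ W 0)
     measurableT (Y := [set enum_state n])).
  exact: measurable_borel_Delta.
have m2 : measurable (seq_shift @^-1` C (enum_state n)).
  by rewrite -[X in measurable X]setTI; exact: measurable_seq_shift.
rewrite (_ : [set w | _] = [set w : sequences W | (w 0%N).2 = enum_state n] `&`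
    seq_shift @^-1` C (enum_state n)); first exact: measurableI.
by apply/seteqP; split => w [].
Qed.

End PiecingLaw.

(** * Paths of the pieced-out process *)

Section PiecedPaths.
Context {R : realType} {d : measure_display} {Omega : measurableType d}.
Variable X : strong_markov_process R N_infty d Omega.
Local Notation W := (Omega * borel_Delta N_infty)%type.
Implicit Types w : sequences W.
Local Notation zeta w n := (lifetime X (w n%N).1).
Local Notation S w n := (life_sum X w n%N).

Lemma life_sum0 w : S w 0 = 0%E.
Proof. by rewrite /life_sum big_geq. Qed.

Lemma life_sumS w n : S w n.+1 = (zeta w 0 + S (seq_shift w) n)%E.
Proof. by rewrite /life_sum big_nat_recl. Qed.

Lemma life_sum_recr w n : S w n.+1 = (S w n + zeta w n)%E.
Proof. by rewrite /life_sum big_nat_recr. Qed.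

Lemma life_sum_ge0 w n : (0 <= S w n)%E.
Proof. by apply: sume_ge0 => i _; exact: lifetime_ge0. Qed.

Lemma life_sum_le w m n : (m <= n)%N -> (S w m <= S w n)%E.
Proof.
elim: n => [|n IH]; first by rewrite leqn0 => /eqP ->.
rewrite leq_eqVlt => /predU1P[->//|/IH H]; apply: le_trans H _.
by rewrite life_sum_recr leeDl// lifetime_ge0.
Qed.

(** The filter [P] selects an initial segment of indices, so up to its last index the filtered
    partial sums are ordinary life sums, and a strict inequality against the series is already
    decided by one of them. *)
Lemma lt_total_life w t : 0 <= t -> (t%:E < total_life X w)%E <->
  exists n, (forall j, (j < n)%N -> zeta w j != 0%E) /\ (t%:E < S w n.+1)%E.
Proof.
move=> t0; pose P i := `[< forall j, (j < i)%N -> zeta w j != 0%E >].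
have PS n : P n -> \sum_(0 <= i < n.+1 | P i) zeta w i = S w n.+1.
  move=> /asboolP Pn; rewrite /life_sum big_nat_cond [RHS]big_nat_cond.
  apply: eq_bigl => i; case: (ltnP i n.+1) => //= iLn.
  by apply/asboolP => j ji; apply: Pn; exact: leq_trans ji _.
split=> [tl|[n [Pn tS]]]; last first.
  apply: lt_le_trans tS _; rewrite -PS; last exact/asboolP.
  by apply: nneseries_lim_ge => i _ _; exact: lifetime_ge0.
have [N tN] : exists N, (t%:E < \sum_(0 <= i < N | P i) zeta w i)%E.
  apply: contrapT => H; move: tl; rewrite ltNge => /negP; apply.
  apply: lime_le.
    by apply: is_cvg_nneseries => i _ _; exact: lifetime_ge0.
  apply: nearW => N; rewrite leNgt; apply/negP => tN; apply: H; by exists N.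
elim: N tN => [|N IH]; first by rewrite big_geq// lte_fin ltNge t0.
have [PN|PN] := boolP (P N).
  by rewrite PS// => tS; exists N; split => //; exact/asboolP.
by rewrite big_mkcond/= big_nat_recr//= (negbTE PN) adde0 -big_mkcond/=.
Qed.

Lemma in_piece_uniq w t m n : in_piece X w t m -> in_piece X w t n -> m = n.
Proof.
have H k l : (k < l)%N -> in_piece X w t k -> in_piece X w t l -> False.
  move=> kl [_ tk] [[l0|lt] _]; first by rewrite l0 in kl.
  by have := lt_le_trans lt (le_trans tk (life_sum_le w kl)); rewrite ltxx.
move=> hm hn; have [mn|nm|//] := ltngtP m n; first by case: (H _ _ mn hm hn).
by case: (H _ _ nm hn hm).
Qed.

Lemma in_piece_exists w t : 0 <= t -> (t%:E < total_life X w)%E ->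
  exists n, in_piece X w t n.
Proof.
move=> t0 /(lt_total_life w t0) [n [_ tS]].
have ex : exists n, (t%:E <= S w n.+1)%E by exists n; exact: ltW.
case: (ex_minnP ex) => -[|k] tk kmin; [exists 0%N|exists k.+1]; split => //.
  by left.
by right; rewrite ltNge; apply/negP => /kmin; rewrite ltnn.
Qed.

Lemma Y_tilde_in_piece w t n : (t%:E < total_life X w)%E -> in_piece X w t n ->
  Y_tilde X t w = Y_dot X (t - fine (S w n)) (w n).
Proof.
move=> tl tn; rewrite /Y_tilde leNgt tl/=.
have H : in_piece X w t (xget 0%N (in_piece X w t)).
  by apply: (@xgetPex _ 0%N (in_piece X w t)); exists n.
by rewrite (in_piece_uniq H tn).
Qed.

Lemma Y_tilde_stateP w t j : 0 <= t -> Y_tilde X t w = state j <->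
  (t%:E < total_life X w)%E /\
  exists n, in_piece X w t n /\ Y_dot X (t - fine (S w n)) (w n) = state j.
Proof.
move=> t0; split=> [H|[tl [n [tn Hn]]]]; last by rewrite (Y_tilde_in_piece tl tn).
have tl : (t%:E < total_life X w)%E.
  by rewrite ltNge; apply/negP => tl; move: H; rewrite /Y_tilde tl.
split => //; have [n tn] := in_piece_exists t0 tl.
by exists n; split => //; rewrite -(Y_tilde_in_piece tl tn).
Qed.

Lemma Y_tilde_first w t : 0 <= t -> (t%:E < zeta w 0)%E ->
  Y_tilde X t w = smp_path X t (w 0%N).1.
Proof.
move=> t0 tz; have S1 : S w 1 = zeta w 0 by rewrite life_sum_recr life_sum0 add0e.
rewrite (@Y_tilde_in_piece w t 0).
- by rewrite life_sum0 subr0 /Y_dot tz.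
- by apply/(lt_total_life w t0); exists 0%N; split => //; rewrite S1.
- by split; [left|rewrite S1 ltW].
Qed.

Lemma Y_tilde_dead w t : 0 <= t -> zeta w 0 = 0%E -> Y_tilde X t w = trap.
Proof.
move=> t0 z0; rewrite /Y_tilde; case: (leP (total_life X w)) => // /(lt_total_life w t0).
move=> [[|n] [H]].
  by rewrite life_sum_recr life_sum0 add0e z0 lte_fin ltNge t0.
by have := H 0%N isT; rewrite z0 eqxx.
Qed.

Section Shift.
Variables (w : sequences W) (r : R).
Hypotheses (zr : zeta w 0 = r%:E) (r0 : 0 < r).

Lemma total_life_shift t : r <= t ->
  (t%:E < total_life X w)%E <-> ((t - r)%:E < total_life X (seq_shift w))%E.
Proof.
move=> rt; have t0 : 0 <= t by rewrite (le_trans _ rt)// ltW.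
have tr0 : 0 <= t - r by rewrite subr_ge0.
split=> [/(lt_total_life w t0) [[|n] [Hn]]|/(lt_total_life _ tr0) [n [Hn tS]]].
- by rewrite life_sum_recr life_sum0 add0e zr lte_fin ltNge rt.
- rewrite life_sumS zr -lteBlDl// -EFinB => tS.
  by apply/(lt_total_life _ tr0); exists n; split => // j jn; exact: (Hn j.+1).
- apply/(lt_total_life w t0); exists n.+1; split.
    by case=> [|j] jn; [rewrite zr eqe gt_eqF|exact: Hn].
  by rewrite life_sumS zr -lteBlDl// -EFinB.
Qed.

Lemma in_piece_shift t n : r < t ->
  in_piece X w t n.+1 <-> in_piece X (seq_shift w) (t - r) n.
Proof.
move=> rt; rewrite /in_piece (life_sumS w n) (life_sumS w n.+1) zr -leeBlDl// -EFinB.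
have rS : (S (seq_shift w) n < (t - r)%:E)%E = (r%:E + S (seq_shift w) n < t%:E)%E.
  by rewrite EFinB lteBrDl.
rewrite rS; split=> -[H1 H2]; split => //.
  by case: H1 => // H; right.
by right; case: H1 => // ->; rewrite life_sum0 adde0 lte_fin.
Qed.

(** The inequality is strict because at [t = r] the first piece is still in charge and shows its
    landing point, whereas the shifted sequence shows the start of the next path. *)
Lemma Y_tilde_shift t : r < t -> Y_tilde X t w = Y_tilde X (t - r) (seq_shift w).
Proof.
move=> rt; have tr0 : 0 <= t - r by rewrite subr_ge0 ltW.
have t0 : 0 <= t by rewrite ltW// (lt_trans r0).
have [tl|tl] := leP (total_life X (seq_shift w)) (t - r)%:E.
  rewrite [RHS]/Y_tilde tl /Y_tilde leNgt; case: ifP => // /negbFE.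
  by move=> /(total_life_shift (ltW rt)); rewrite ltNge tl.
have tl' : (t%:E < total_life X w)%E by apply/(total_life_shift (ltW rt)).
have [n tn] := in_piece_exists tr0 tl.
have tn' : in_piece X w t n.+1 by apply/(in_piece_shift n rt).
rewrite (Y_tilde_in_piece tl tn) (Y_tilde_in_piece tl' tn').
congr (Y_dot X _ _); rewrite life_sumS zr.
have Sfin : S (seq_shift w) n \is a fin_num.
  rewrite ge0_fin_numE ?life_sum_ge0//; case: tn => [[->|H] _].
    by rewrite life_sum0.
  exact: lt_trans H (ltry _).
by rewrite fineD//= opprD addrA.
Qed.

End Shift.

Lemma path_state_right t omega j : 0 <= t -> exists2 e, 0 < e &
  forall r, t <= r -> r < t + e ->
    (smp_path X r omega = state j <-> smp_path X t omega = state j).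
Proof.
move=> t0; have [H|H] := pselect (smp_path X t omega = state j).
  have [e e0 He] := @path_open_right _ _ _ X t omega [set state j] t0 (@open_state j) H.
  by exists e => // r tr re; split => // _; exact: He.
have oC : open (~` [set (state j : S_Delta N_infty)]).
  by rewrite openC; exact: closed_state.
have [e e0 He] := @path_open_right _ _ _ X t omega _ t0 oC H.
by exists e => // r tr re; split => // Hr; case: (He r tr re).
Qed.

(* Almost surely each piece starts where the previous one was sent. *)
Definition consistent w := forall n, smp_path X 0 (w n.+1).1 = (w n).2.

Lemma Y_tilde_first_right w j t : 0 <= t -> (t%:E < zeta w 0)%E ->
  exists2 e, 0 < e & forall r, t <= r -> r < t + e ->
    (Y_tilde X r w = state j <-> smp_path X t (w 0%N).1 = state j).
Proof.
move=> t0 tz; have [e e0 He] := path_state_right (w 0%N).1 j t0.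
have [e1 e10 He1] : exists2 e1, 0 < e1 & forall r, r < t + e1 -> (r%:E < zeta w 0)%E.
  move: tz; case: (zeta w 0) => [z|_|//].
    rewrite lte_fin => tz; exists (z - t); first by rewrite subr_gt0.
    by move=> r; rewrite addrC subrK lte_fin.
  by exists 1 => // r _; exact: ltry.
exists (Num.min e e1); first by rewrite lt_min e0.
move=> r tr; rewrite -ltrBlDl lt_min !ltrBlDl => /andP[h1 h2].
by rewrite Y_tilde_first ?(le_trans t0)//; [exact: He|exact: He1].
Qed.

(** Induction on the piece that contains [t], by shifting. The critical case is [t] at the end of
    the first piece: consistency makes the landing point the start of the next path, whose lifetime
    is positive because [t < total_life]. *)
Lemma Y_tilde_right w j t : consistent w -> 0 <= t -> exists2 e, 0 < e &
  forall r, t <= r -> r < t + e ->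
    (Y_tilde X r w = state j <-> Y_tilde X t w = state j).
Proof.
move=> cw t0; have [tl|tl] := leP (total_life X w) t%:E.
  exists 1 => // r tr _; rewrite /Y_tilde tl.
  by rewrite (le_trans tl)// lee_fin.
have [n] := in_piece_exists t0 tl.
elim: n w t cw t0 tl => [|n IH] w t cw t0 tl tn.
  have [_] := tn; rewrite life_sum_recr life_sum0 add0e le_eqVlt => /predU1P[tz|tz].
    have r0 : 0 < t.
      rewrite lt_neqAle t0 andbT; apply/negP => /eqP t00.
      by move: tl; rewrite -t00 => /(lt_total_life w (lexx 0)) [[|n] [H]];
        [rewrite life_sum_recr life_sum0 add0e -tz -t00 ltxx|
         have := H 0%N isT; rewrite -tz -t00 eqxx].
    have z1 : (0%:E < zeta (seq_shift w) 0)%E.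
      have /(total_life_shift (esym tz) r0 (lexx t)) := tl.
      rewrite subrr => /(lt_total_life _ (lexx 0)) [[|n] [H]].
        by rewrite life_sum_recr life_sum0 add0e.
      by move=> _; rewrite lt_neqAle lifetime_ge0 andbT eq_sym; exact: H.
    have [e e0 He] := Y_tilde_first_right j (lexx 0) z1.
    exists e => // r; rewrite le_eqVlt => /predU1P[<-//|tr] re.
    rewrite (Y_tilde_shift (esym tz) r0 tr).
    have -> : Y_tilde X t w = smp_path X 0 (seq_shift w 0%N).1.
      rewrite (Y_tilde_in_piece tl tn) life_sum0 subr0 /Y_dot -tz ltxx.
      by rewrite /seq_shift cw.
    apply: He; first by rewrite subr_ge0 ltW.
    by rewrite add0r ltrBlDl.
  have [e e0 He] := Y_tilde_first_right j t0 tz.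
  by exists e => // r tr re; rewrite (Y_tilde_first t0 tz); exact: He.
have [[//|St] tS] := tn.
have [r zr] : exists r, zeta w 0 = r%:E.
  have : (zeta w 0 < +oo)%E.
    apply: le_lt_trans (ltry t); apply: le_trans (ltW St).
    by rewrite life_sumS leeDl// life_sum_ge0.
  move=> H; exists (fine (zeta w 0)); rewrite fineK// ge0_fin_numE//.
  exact: lifetime_ge0.
have r0 : 0 < r.
  rewrite -lte_fin -zr lt_neqAle lifetime_ge0 andbT; apply/negP => /eqP z0.
  move: tl => /(lt_total_life w t0) [[|k] [H]].
    by rewrite life_sum_recr life_sum0 add0e -z0 lte_fin ltNge t0.
  by have := H 0%N isT; rewrite -z0 eqxx.
have rt : r < t.
  rewrite -lte_fin -zr; apply: le_lt_trans St.
  by rewrite life_sumS leeDl// life_sum_ge0.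
have [e e0 He] : exists2 e, 0 < e & forall s, t - r <= s -> s < t - r + e ->
    (Y_tilde X s (seq_shift w) = state j <-> Y_tilde X (t - r) (seq_shift w) = state j).
  apply: IH.
  - by move=> k; exact: cw.
  - by rewrite subr_ge0 ltW.
  - by have /(total_life_shift zr r0 (ltW rt)) := tl.
  - by apply/(in_piece_shift zr n rt).
exists e => // s ts se.
rewrite (Y_tilde_shift zr r0 (lt_le_trans rt ts)) (Y_tilde_shift zr r0 rt).
by apply: He; [rewrite lerB|rewrite addrAC ltrBlDr subrK].
Qed.

End PiecedPaths.

Section PiecedMeasurability.
Context {R : realType} {d : measure_display} {Omega : measurableType d}.
Variable X : strong_markov_process R N_infty d Omega.
Local Notation W := (Omega * borel_Delta N_infty)%type.
Local Notation T := (R * sequences W)%type.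

Definition pieced_in (j : nat) : set T :=
  [set z | 0 <= z.1 /\ Y_tilde X z.1 z.2 = state j].

Let measurable_zeta n : measurable_fun setT (fun w : sequences W => lifetime X (w n).1).
Proof.
apply: (measurableT_comp (measurable_lifetime X)).
apply: (measurableT_comp (f := fst) measurable_fst).
exact: measurable_coord.
Qed.

Let measurable_life_sum n : measurable_fun setT (fun w : sequences W => life_sum X w n).
Proof.
by apply: emeasurable_sum => i _; exact: measurable_zeta.
Qed.

Let mfst : measurable_fun setT (fun z : T => z.1%:E).
Proof. by apply/measurable_EFinP; exact: measurable_fst. Qed.

Let mz n : measurable_fun setT (fun z : T => lifetime X (z.2 n).1).
Proof. by apply: (measurableT_comp (measurable_zeta n)); exact: measurable_snd. Qed.

Let ms n : measurable_fun setT (fun z : T => life_sum X z.2 n).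
Proof. by apply: (measurableT_comp (measurable_life_sum n)); exact: measurable_snd. Qed.

Let mage n : measurable_fun setT (fun z : T => z.1 - fine (life_sum X z.2 n)).
Proof.
apply: measurable_funB; first exact: measurable_fst.
exact: (measurableT_comp (fine_measurable measurableT) (ms n)).
Qed.

(** [Y_tilde_stateP] written with countable set operations; [D n] separates the two branches of
    [Y_dot], a living path and a landing point. *)
Lemma measurable_pieced_in j : measurable (pieced_in j).
Proof.
have m0 : measurable [set z : T | 0 <= z.1].
  rewrite (_ : [set z : T | _] = `[0, +oo[ `*` setT); first exact: measurableX.
  by apply/seteqP; split => z /=; rewrite in_itv/= andbT // => -[].
have mlt (f g : T -> \bar R) : measurable_fun setT f -> measurable_fun setT g ->
    measurable [set z | (f z < g z)%E].
  by move=> mf mg; rewrite -[X in measurable X]setTI; exact: measurable_lte.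
have mle (f g : T -> \bar R) : measurable_fun setT f -> measurable_fun setT g ->
    measurable [set z | (f z <= g z)%E].
  by move=> mf mg; rewrite -[X in measurable X]setTI; exact: measurable_lee.
pose alive := \bigcup_n ((\bigcap_(i in [set i | (i < n)%N])
    [set z : T | lifetime X (z.2 i).1 != 0%E]) `&`
    [set z : T | (z.1%:E < life_sum X z.2 n.+1)%E]).
have malive : measurable alive.
  apply: bigcupT_measurable => n; apply: measurableI; last exact: mlt.
  apply: bigcap_measurableType => i _.
  rewrite -[X in measurable X]setTI; apply: emeasurable_neq => //; exact: measurable_cst.
pose P n := ([set z : T | n = 0%N] `|` [set z : T | (life_sum X z.2 n < z.1%:E)%E])
   `&` [set z : T | (z.1%:E <= life_sum X z.2 n.+1)%E].
have mP n : measurable (P n).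
  apply: measurableI; last exact: mle.
  apply: measurableU; last exact: mlt.
  have [->|/eqP n0] := eqVneq n 0%N.
    by rewrite (_ : [set _ | _] = setT)//; apply/seteqP; split.
  by rewrite (_ : [set _ | _] = set0)//; apply/seteqP; split.
pose age n (z : T) : R * Omega := (z.1 - fine (life_sum X z.2 n), (z.2 n).1).
have mw n : measurable_fun setT (fun z : T => z.2 n).
  by apply: (measurableT_comp (@measurable_coord _ W n)); exact: measurable_snd.
have mageo n : measurable_fun setT (age n).
  apply: measurable_fun_pair => //.
  by apply: (measurableT_comp (f := fst) measurable_fst).
pose D n := (age n @^-1` path_in X [set state j]) `|`
  ([set z : T | (lifetime X (z.2 n).1 <= (z.1 - fine (life_sum X z.2 n))%:E)%E] `&`
   [set z : T | (z.2 n).2 = state j]).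
have mD n : measurable (D n).
  apply: measurableU.
    rewrite -[X in measurable X]setTI; apply: mageo => //.
    by apply: measurable_path_joint; [exact: open_state|exact: closed_state].
  apply: measurableI.
    by apply: mle => //; apply/measurable_EFinP.
  rewrite -[X in measurable X]setTI.
  apply: (measurableT_comp (f := snd) measurable_snd (mw n) measurableT (Y := [set state j])).
  exact: measurable_borel_Delta.
rewrite (_ : pieced_in j = [set z : T | 0 <= z.1] `&` alive `&` \bigcup_n (P n `&` D n)).
  apply: measurableI; first exact: measurableI.
  by apply: bigcupT_measurable => n; exact: measurableI.
have aliveE (z : T) : 0 <= z.1 -> alive z <-> (z.1%:E < total_life X z.2)%E.
  move=> z0; split=> [[n _ [H tS]]|/(lt_total_life X z.2 z0) [n [H tS]]].
    by apply/(lt_total_life X z.2 z0); exists n.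
  by exists n.
have PE n z : P n z <-> in_piece X z.2 z.1 n by split; case.
have DE n z : 0 <= z.1 -> in_piece X z.2 z.1 n ->
    D n z <-> Y_dot X (z.1 - fine (life_sum X z.2 n)) (z.2 n) = state j.
  move=> z0 zn; have age0 : 0 <= z.1 - fine (life_sum X z.2 n).
    rewrite subr_ge0; case: zn => [[->|H] _]; first by rewrite life_sum0.
    have := life_sum_ge0 X z.2 n; move: H; case: (life_sum X z.2 n) => [s|//|//].
    by rewrite lte_fin => /ltW.
  rewrite /Y_dot; case: (ltP _%:E) => [lz|zl].
    split=> [[[_ //]|[/= zl _]]|H]; last by left.
    by have := lt_le_trans lz zl; rewrite ltxx.
  split=> [[[_ /= H]|[_ //]]|H]; last by right.
  by have /(lifetime_le X _ age0) := zl; rewrite H.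
apply/seteqP; split=> z.
  move=> [z0 /(Y_tilde_stateP X z.2 j z0) [zl [n [zn Hn]]]].
  split; first by split => //; exact/aliveE.
  by exists n => //; split; [exact/PE|exact/(DE n z z0 zn)].
move=> [[z0 /(aliveE z z0) zl] [n _ [/PE zn Hn]]]; split => //.
apply/(Y_tilde_stateP X z.2 j z0); split => //; exists n; split => //.
exact/(DE n z z0 zn).
Qed.

End PiecedMeasurability.

Section Recursion.
Context {R : realType} {d : measure_display} {Omega : measurableType d}.
Variable X : strong_markov_process R N_infty d Omega.
Variables (al : R) (j : nat).
Hypothesis al0 : 0 < al.
Local Notation W := (Omega * borel_Delta N_infty)%type.
Local Notation H := (occupation al (pieced_in X j)).
Local Notation H0 := (occupation al (path_in X [set state j])).

(** A path that starts at the trap has lifetime 0 and discount 1, yet the pieced-out process is dead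
    from then on; the indicator removes this case. *)
Definition restart (omega : Omega) : \bar R :=
  ((discount X al omega)%:E * (\1_[set om | smp_path X 0 om <> trap] omega)%:E)%E.

Lemma restart_ge0 omega : (0 <= restart omega)%E.
Proof. by rewrite mule_ge0// lee_fin ?discount_ge0. Qed.

Let malive : measurable [set om | smp_path X 0 om <> trap].
Proof. exact: (measurable_path X (~` [set trap]) (lexx 0)). Qed.

Lemma measurable_restart : measurable_fun setT restart.
Proof.
apply: emeasurable_funM; first exact: measurable_discount.
by apply/measurable_EFinP; exact: measurable_indic.
Qed.

Lemma integral_restart x : x <> trap ->
  (\int[start_law X x]_om restart om = \int[start_law X x]_om (discount X al om)%:E)%E.
Proof.
move=> xt; pose P : probability Omega R := start_law X x.
change (\int[P]_om restart om = \int[P]_om (discount X al om)%:E)%E.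
apply: ge0_ae_eq_integral => //.
- exact: measurable_restart.
- exact: measurable_discount.
- by move=> om _; exact: restart_ge0.
- by move=> om _; rewrite lee_fin discount_ge0.
exists [set om | smp_path X 0 om = trap]; split => //.
- by have := measurable_path X [set trap] (lexx 0).
- apply: smp_law_start_ne => [|om /= ->]; last exact/nesym.
  by have := measurable_path X [set trap] (lexx 0).
- move=> om /= nE; apply: contrapT => ot; apply: nE => _.
  by rewrite /restart indicE mem_set// mule1.
Qed.

Lemma pieced_in_E t w : 0 <= t ->
  \1_(pieced_in X j) (t, w) = \1_[set state j] (Y_tilde X t w) :> R.
Proof.
move=> t0; rewrite !indicE; congr (_%:R); congr nat_of_bool.
by apply/idP/idP; rewrite !inE /pieced_in/=; [move=> []|split].
Qed.

Lemma path_in_E t om : 0 <= t ->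
  \1_(path_in X [set state j]) (t, om) = \1_[set state j] (smp_path X t om) :> R.
Proof.
move=> t0; rewrite !indicE; congr (_%:R); congr nat_of_bool.
by apply/idP/idP; rewrite !inE /path_in/=; [move=> []|split].
Qed.

Let measurable_pieced w : measurable_fun setT (fun t => (\1_(pieced_in X j) (t, w) : R)%:E).
Proof.
have mB := @measurable_pieced_in _ _ _ X j; apply/measurable_EFinP.
by apply: (measurableT_comp (f := (\1_(pieced_in X j) : R * sequences W -> R))).
Qed.

Let measurable_pathed om :
  measurable_fun setT (fun t => (\1_(path_in X [set state j]) (t, om) : R)%:E).
Proof.
have mB := measurable_path_joint X (@open_state j) (@closed_state j).
apply/measurable_EFinP.
by apply: (measurableT_comp (f := (\1_(path_in X [set state j]) : R * Omega -> R))).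
Qed.

(** The renewal equation path by path. With zero lifetime nothing follows, with infinite lifetime
    the discount is 0, and with lifetime [r] the time integral is split at [r] and its tail
    shifted. *)
Lemma occupation_recursion w :
  H w = (H0 (w 0%N).1 + restart (w 0%N).1 * H (seq_shift w))%E.
Proof.
have z0 := lifetime_ge0 X (w 0%N).1.
have deadE t : (lifetime X (w 0%N).1 <= t%:E)%E -> smp_path X t (w 0%N).1 = trap.
  move=> zt; have t0 : 0 <= t by rewrite -lee_fin (le_trans z0).
  exact/(lifetime_le X _ t0).
have [zz|znz] := eqVneq (lifetime X (w 0%N).1) 0%E.
  rewrite /restart indicE memNset/=; last first.
    by move=> H; apply: H; apply/lifetime_eq0.
  rewrite mule0 mul0e adde0; apply: eq_integral => t.
  rewrite inE/= in_itv/= andbT => t0; rewrite pieced_in_E// path_in_E//.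
  by rewrite Y_tilde_dead// deadE// zz lee_fin.
rewrite /restart indicE mem_set/=; last by move=> /lifetime_eq0/eqP; apply/negP.
rewrite mule1 /discount.
have firstE t : 0 <= t -> (t%:E < lifetime X (w 0%N).1)%E ->
    \1_(pieced_in X j) (t, w) = \1_(path_in X [set state j]) (t, (w 0%N).1) :> R.
  by move=> t0 tz; rewrite pieced_in_E// path_in_E// Y_tilde_first.
have pge0 t : (0 <= (\1_(pieced_in X j) (t, w) : R)%:E)%E by rewrite lee_fin.
case zE : (lifetime X (w 0%N).1) z0 znz => [r| |]// z0 znz; last first.
  rewrite mul0e adde0; apply: eq_integral => t.
  by rewrite inE/= in_itv/= andbT => t0; rewrite firstE// zE ltry.
have r0 : 0 < r by rewrite lt_neqAle eq_sym -lee_fin z0 andbT -eqe.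
rewrite /occupation (elaplace_split al (ltW r0)) => [|//|t _]; last 2 first.
- exact: measurable_funTS.
- by rewrite lee_fin.
rewrite [in RHS](elaplace_split al (ltW r0)) => [|//|t _]; last 2 first.
- exact: measurable_funTS.
- by rewrite lee_fin.
rewrite [X in (_ = _ + X + _)%E]integral0_eq ?adde0; last first.
  move=> t; rewrite /= in_itv/= andbT => rt.
  rewrite path_in_E ?(le_trans (ltW r0))// deadE ?zE ?lee_fin//.
  by rewrite indicE memNset ?mule0.
congr (_ + _)%E.
  apply: eq_integral => t; rewrite inE/= in_itv/= => /andP[t0 tr].
  by rewrite firstE// zE lte_fin.
rewrite -elaplace_shift//.
(* The single time [r], where the shift identity may fail, is discarded as a null set. *)
rewrite -!integral_itv_obnd_cbnd.
  apply: eq_integral => t; rewrite inE/= in_itv/= andbT => rt.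
  have tr0 : 0 <= t - r by rewrite subr_ge0 ltW.
  rewrite pieced_in_E ?(le_trans (ltW r0) (ltW rt))// pieced_in_E//.
  by rewrite (Y_tilde_shift zE r0 rt).
- apply: measurable_elaplace; apply: measurable_funTS.
  exact: (measurableT_comp (measurable_pieced (seq_shift w)) (measurable_shift_fun r)).
- by apply: measurable_elaplace; exact: measurable_funTS.
Qed.

End Recursion.

(** * The renewal equation *)

Section PiecedExpectation.
Context {R : realType} {d : measure_display} {Omega : measurableType d}.
Variable X : strong_markov_process R N_infty d Omega.
Variable pi : probability (borel_Delta N_infty) R.
Local Notation St := (borel_Delta N_infty).
Local Notation W := (Omega * St)%type.
Variable Pt : St -> probability (sequences W) R.
Hypothesis hPt : piecing_law X pi Pt.

(** [kill_kernel] is a probability in either case, so this covers the start at the trap, which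
    [piecing_first] excludes. *)
Lemma piecing_marginal x (B : set Omega) : measurable B ->
  Pt x [set w | B (w 0%N).1] = start_law X x B.
Proof.
move=> mB; pose P : probability Omega R := start_law X x.
have mBT : measurable (B `*` [set: St]) by exact: measurableX.
rewrite (_ : [set w : sequences W | B (w 0%N).1] =
  [set w : sequences W | (B `*` [set: St]) (w 0%N)]); last first.
  by apply/seteqP; split => w /=; [|case].
rewrite (piecing_fdd1 hPt x mBT) /Q_integral.
transitivity (\int[P]_om (\1_B om)%:E)%E; last by rewrite integral_indic// setIT.
apply: eq_integral => om _.
transitivity (\int[kill_kernel X pi om]_y (cst (\1_B om : R)%:E y))%E.
  apply: eq_integral => y _; rewrite mule1 !indicE.
  congr (_%:R%:E); congr nat_of_bool; apply/idP/idP; rewrite !inE//=.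
  by case.
by rewrite integral_cst//= probability_setT mule1.
Qed.

Lemma measurable_first_path : measurable_fun setT (fun w : sequences W => (w 0%N).1).
Proof. by apply: (measurableT_comp (f := fst) measurable_fst); exact: measurable_coord. Qed.

Lemma piecing_integral_first x (f : Omega -> \bar R) :
  measurable_fun setT f -> (forall om, 0 <= f om)%E ->
  (\int[Pt x]_w f (w 0%N).1 = \int[start_law X x]_om f om)%E.
Proof.
move=> mf f0; have [m mE] := pushforward_measure_ex (Pt x) measurable_first_path.
transitivity (\int[m]_om f om)%E; last first.
  by apply: eq_measure_integral => A mA _; rewrite mE; exact: piecing_marginal.
transitivity (\int[pushforward (Pt x) (fun w : sequences W => (w 0%N).1)]_om f om)%E.
  by rewrite (ge0_integral_pushforward measurable_first_path).
apply: eq_measure_integral; first exact: measurable_first_path.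
by move=> mf1 A mA _; rewrite mE.
Qed.

Let mstart (x : St) : measurable [set om | smp_path X 0 om <> x].
Proof. exact: (measurable_path X (~` [set x]) (lexx 0)). Qed.

Lemma piecing_start x : Pt x [set w | smp_path X 0 (w 0%N).1 <> x] = 0%E.
Proof.
rewrite (piecing_marginal x (mstart x)).
exact: smp_law_start_ne.
Qed.

(** A mismatch after the first piece is null because each path starts at its prescribed point almost
    surely. Shifting the sequence turns [bad n.+1] into [bad n], so [piecing_null] carries the
    induction. *)
Lemma piecing_consistent x : (Pt x).-negligible [set w | ~ consistent X w].
Proof.
pose bad n := [set w : sequences W | smp_path X 0 (w n.+1).1 <> (w n).2].
have bad0 y n : (Pt y).-negligible (bad n).
  elim: n y => [|n IH] y.
    apply: (@negligibleS _ _ _ _ _ _ _ (piecing_null hPt y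
        (C := fun s => [set w | smp_path X 0 (w 0%N).1 <> s]) _ _)).
    - by [].
    - move=> s; rewrite -[X in measurable X]setTI.
      exact: (measurable_first_path measurableT (mstart s)).
    - exact: piecing_start.
  have mbad m : measurable (bad m).
    pose M (s : St) := [set w : sequences W | smp_path X 0 (w m.+1).1 <> s] `&`
      [set w : sequences W | (w m).2 = s].
    have mM s : measurable (M s).
      apply: measurableI; rewrite -[X in measurable X]setTI.
        apply: (measurableT_comp (f := fst) measurable_fst (@measurable_coord _ W m.+1)
          measurableT (Y := [set om | smp_path X 0 om <> s])).
        exact: mstart.
      apply: (measurableT_comp (f := snd) measurable_snd (@measurable_coord _ W m)
          measurableT (Y := [set s])).
      exact: measurable_borel_Delta.
    rewrite (_ : bad m = \bigcup_n M (enum_state n)).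
      by apply: bigcupT_measurable => k.
    apply/seteqP; split => w; last by move=> [k _ [/= H E]]; rewrite /bad/= E.
    by move=> H; exists (@pickle (option (option nat)) (w m).2) => //; rewrite enum_stateK.
  have bad00 s : Pt s (bad n) = 0%E. by exact: (proj1 (negligibleP (Pt s) (mbad n)) (IH s)).
  exact: (piecing_null hPt y (C := fun=> bad n) (fun=> mbad n) bad00).
apply: negligibleS (negligible_bigcup (bad0 x)) => w /= cw.
by apply: contrapT => H; apply: cw => n; apply: contrapT => Hn; apply: H; exists n.
Qed.

End PiecedExpectation.

Lemma nneseries_recl0 (R : realType) (f : nat -> \bar R) : (forall k, 0 <= f k)%E ->
  (\sum_(0 <= k <oo) f k = f 0%N + \sum_(0 <= k <oo) f k.+1)%E.
Proof.
move=> f0; rewrite nneseries_recl//; congr (_ + _)%E.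
rewrite -[RHS](nneseries_shift 1) => [|k]; last exact: f0.
rewrite [RHS]nneseries_recl//= => [|k _]; last by case: ifP.
rewrite add0e eseries_cond [RHS]eseries_cond; apply: eq_eseriesr => k.
by move=> /= k1; rewrite k1 subn1 prednK.
Qed.

Section PiecedRecursion.
Context {R : realType} {d : measure_display} {Omega : measurableType d}.
Variable X : strong_markov_process R N_infty d Omega.
Variable pi : probability (borel_Delta N_infty) R.
Local Notation St := (borel_Delta N_infty).
Local Notation W := (Omega * St)%type.
Variable Pt : St -> probability (sequences W) R.
Hypothesis hPt : piecing_law X pi Pt.
Variables (al : R) (j : nat).
Hypothesis al0 : 0 < al.
Local Notation H := (occupation al (pieced_in X j)).
Local Notation H0 := (occupation al (path_in X [set state j])).

Definition pieced_resolvent (x : St) : \bar R := (\int[Pt x]_w H w)%E.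

Let mH : measurable_fun setT H.
Proof. by apply: measurable_occupation; exact: measurable_pieced_in. Qed.

Lemma pieced_resolvent_ge0 x : (0 <= pieced_resolvent x)%E.
Proof. by apply: integral_ge0 => w _; exact: occupation_ge0. Qed.

Lemma pieced_resolvent_le x : (pieced_resolvent x <= (al^-1)%:E)%E.
Proof.
apply: (@le_trans _ _ (\int[Pt x]_w (al^-1)%:E)%E).
  apply: ge0_le_integral => //.
  - by move=> w _; exact: occupation_ge0.
  - move=> w _; apply: occupation_le => //; exact: measurable_pieced_in.
by rewrite integral_cst//= probability_setT mule1.
Qed.

Lemma pieced_resolvent_trap : pieced_resolvent trap = 0%E.
Proof.
rewrite -(integral0 (Pt trap) setT); apply: ge0_ae_eq_integral => //.
  by move=> w _; exact: occupation_ge0.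
exists [set w : sequences W | smp_path X 0 (w 0%N).1 <> trap]; split.
- rewrite -[X in measurable X]setTI.
  have mB := measurable_path X (~` [set trap]) (lexx 0).
  exact: (measurable_first_path measurableT mB).
- exact: piecing_start hPt trap.
- move=> w /= nE wt; apply: nE => _; apply: integral0_eq => t.
  rewrite /= in_itv/= andbT => t0; rewrite pieced_in_E// Y_tilde_dead//; last exact/lifetime_eq0.
  by rewrite indicE memNset ?mule0.
Qed.

(** The trap and infinity come first, so that their two terms can be peeled off the series over
    landing points. *)
Let e (n : nat) : St :=
  match n with 0%N => trap | 1%N => Some None | k.+2 => state k end.

Let e_inj : injective e.
Proof. by move=> [|[|m]] [|[|n]] //= [->]. Qed.

(** The integral of [occupation_recursion], split by the landing point. The trap contributes
    nothing; the term of infinity is kept until [pi] is shown to give it no mass. *)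
Lemma pieced_recursion x : x <> trap -> (pieced_resolvent x =
  \int[start_law X x]_om H0 om + \int[start_law X x]_om (discount X al om)%:E *
  (pi [set (Some None : St)] * pieced_resolvent (Some None) +
   \sum_(0 <= k <oo) pi [set state k] * pieced_resolvent (state k)))%E.
Proof.
move=> xt; rewrite {1}/pieced_resolvent.
have mH0 : measurable_fun setT H0.
  apply: measurable_occupation; apply: measurable_path_joint.
    exact: open_state.
  exact: closed_state.
have mr := measurable_restart X al0.
have m0 : measurable_fun setT (fun w : sequences W => (w 0%N).1).
  exact: measurable_first_path.
under eq_integral do rewrite occupation_recursion//.
rewrite ge0_integralD//; last 4 first.
- by move=> w _; exact: occupation_ge0.
- exact: (measurableT_comp mH0 m0).
- by move=> w _; rewrite mule_ge0 ?restart_ge0 ?occupation_ge0.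
- apply: emeasurable_funM; first exact: (measurableT_comp mr m0).
  exact: (measurableT_comp mH (@measurable_seq_shift _ _)).
rewrite (piecing_integral_first hPt x mH0) => [|om]; last exact: occupation_ge0.
congr (_ + _)%E.
pose F n := [set w : sequences W | (w 0%N).2 = e n].
have FT : [set: sequences W] = \bigcup_n F n.
  apply/seteqP; split => // w _; case E : (w 0%N).2 => [[k|]|].
  - by exists k.+2.
  - by exists 1%N.
  - by exists 0%N.
rewrite FT ge0_integral_bigcup//; last 4 first.
- move=> n; rewrite -[X in measurable X]setTI.
  apply: (measurableT_comp (f := snd) measurable_snd (@measurable_coord _ W 0)
      measurableT (Y := [set e n])).
  exact: measurable_borel_Delta.
- rewrite -FT; apply: emeasurable_funM; first exact: (measurableT_comp mr m0).
  exact: (measurableT_comp mH (@measurable_seq_shift _ _)).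
- by move=> w _; rewrite mule_ge0 ?restart_ge0 ?occupation_ge0.
- by move=> m n _ _ [w [/= Em En]]; apply: e_inj; rewrite -Em.
under eq_eseriesr => n _.
  rewrite (piecing_expectation hPt (e n) xt mr (restart_ge0 X al) mH (occupation_ge0 al _)).
  rewrite integral_restart// -muleA -/(pieced_resolvent _).
over.
have h0 : (0 <= \int[start_law X x]_om (discount X al om)%:E)%E.
  by apply: integral_ge0 => om _; rewrite lee_fin discount_ge0.
have pr0 n : (0 <= pi [set e n] * pieced_resolvent (e n))%E.
  by rewrite mule_ge0 ?measure_ge0 ?pieced_resolvent_ge0.
have hfin : (\int[start_law X x]_om (discount X al om)%:E)%E \is a fin_num.
  rewrite ge0_fin_numE//; apply: (@le_lt_trans _ _ 1%E); last exact: ltry.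
  apply: (@le_trans _ _ (\int[start_law X x]_om 1)%E); last first.
    by rewrite integral_cst//= probability_setT mul1e.
  apply: ge0_le_integral => //.
  - by move=> om _; rewrite lee_fin discount_ge0.
  - exact: measurable_discount.
  - move=> om _; rewrite lee_fin /discount; have := lifetime_ge0 X om.
    case: (lifetime X om) => // r; rewrite lee_fin => r0.
    by rewrite -expR0 ler_expR mulNr oppr_le0 mulr_ge0// ltW.
rewrite -(fineK hfin) nneseriesZl ?fine_ge0//; last by move=> n _; exact: pr0.
congr (_ * _)%E; rewrite (nneseries_recl0 pr0) (nneseries_recl0 (fun k => pr0 k.+1)).
by rewrite (_ : pieced_resolvent (e 0) = 0%E) ?mule0 ?add0e//; exact: pieced_resolvent_trap.
Qed.

End PiecedRecursion.

Section PiecedTransition.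
Context {R : realType} {d : measure_display} {Omega : measurableType d}.
Variable X : strong_markov_process R N_infty d Omega.
Variable pi : probability (borel_Delta N_infty) R.
Local Notation St := (borel_Delta N_infty).
Local Notation W := (Omega * St)%type.
Variable Pt : St -> probability (sequences W) R.
Hypothesis hPt : piecing_law X pi Pt.
Variables (x : St) (j : nat).

(** As a section of a measurable set of the product space, this is measurable in [t] on the whole
    line. *)
Definition pieced_prob (t : R) : \bar R := Pt x (xsection (pieced_in X j) t).

Lemma pieced_probE t : 0 <= t ->
  pieced_prob t = Pt x [set w | Y_tilde X t w = state j].
Proof.
move=> t0; rewrite /pieced_prob; congr (Pt x _); apply/seteqP.
by split=> w; rewrite /xsection/= inE /pieced_in/=; [move=> []|split].
Qed.

Let mpieced t : measurable (xsection (pieced_in X j) t).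
Proof. by apply: measurable_xsection; exact: measurable_pieced_in. Qed.

Lemma pieced_prob_fin t : pieced_prob t \is a fin_num.
Proof. by rewrite /pieced_prob fin_num_measure//; exact: mpieced. Qed.

Lemma measurable_pieced_prob : measurable_fun setT pieced_prob.
Proof. by apply: measurable_fun_xsection; exact: measurable_pieced_in. Qed.

Lemma pieced_resolventE al : pieced_resolvent X Pt al j x = elaplace al pieced_prob.
Proof.
by rewrite /pieced_resolvent (integral_occupation al (measurable_pieced_in X j)).
Qed.

(** Along a sequence decreasing to [t] the indicators are eventually constant on consistent
    sequences, hence almost surely; dominated convergence does the rest. *)
Lemma pieced_prob_right t : 0 <= t ->
  fine (pieced_prob s) @[s --> t^'+] --> fine (pieced_prob t).
Proof.
move=> t0; apply/cvg_at_rightP => u [ut ucvg].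
apply: (@fine_cvg _ _ _ _ (fun n => pieced_prob (u n))).
rewrite fineK ?pieced_prob_fin//.
pose f s (w : sequences W) : \bar R := (\1_(xsection (pieced_in X j) s) w : R)%:E.
have fE s : (\int[Pt x]_w f s w = pieced_prob s)%E.
  by rewrite integral_indic ?setIT//; exact: mpieced.
have mf s : measurable_fun setT (f s).
  by apply/measurable_EFinP; apply: measurable_indic; exact: mpieced.
rewrite -fE (_ : (fun n => pieced_prob (u n)) = fun n => (\int[Pt x]_w f (u n) w)%E); last first.
  by apply/funext => n /=; rewrite fE.
have aec : {ae Pt x, forall w, setT w -> f (u n) w @[n --> \oo] --> f t w}.
  have [N [mN N0 cN]] := piecing_consistent hPt x; exists N; split => // w /= nE.
  apply: cN => /= cw; apply: nE => _.
  have [e e0 He] := Y_tilde_right j cw t0.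
  have te : t < t + e by rewrite ltrDl.
  have ue := cvgr_lt _ ucvg _ te.
  apply: cvg_near_cst; near=> n.
  have un : u n < t + e.
    by near: n; exact: ue.
  congr (_%:R%:E); congr nat_of_bool.
  have un0 : 0 <= u n by rewrite (le_trans t0)// ltW// ut.
  rewrite !mem_xsection; apply/idP/idP; rewrite !inE => -[_ /= Y]; split => //=.
    by apply/(He (u n)) => //; rewrite ltW// ut.
  by apply/(He (u n)) => //; rewrite ltW// ut.
have [] // := @dominated_convergence _ _ _ (Pt x) setT measurableT
  (fun n => f (u n)) (f t) (cst 1%E) (fun n => mf (u n)) (mf t) aec.
  exact: finite_measure_integrable_cst.
by apply: aeW => w n _ /=; rewrite lee_fin indicE; case: (_ \in _); rewrite ?normr1 ?normr0.
Unshelve. all: by end_near. Qed.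

End PiecedTransition.

(** * Uniqueness of Laplace transforms *)

Section PeakKernel.
Variable R : realType.

(** The N-th power of this function, times exp(-t), is a finite combination of exponentials, so a
    function with vanishing Laplace transform integrates to 0 against it. As N grows these powers
    concentrate at the maximum. *)
Definition peak (p t : R) : R := expR (- p * t) * (1 - expR (- t)).

(** The quantitative form of exp(-y) > 1 - y away from 0. The gaps [e1] and [e2] at eta and -eta can
    only grow further out, by convexity. *)
Lemma expR_gap (eta : R) : 0 < eta ->
  exists2 e, 0 < e & forall y : R, eta <= `|y| -> 1 - expR (- y) - y <= - e.
Proof.
move=> eta0; pose e1 := expR (- eta) + eta - 1; pose e2 := expR eta - eta - 1.
have e10 : 0 < e1.
  by have := @expR_gt1Dx R (- eta); rewrite oppr_eq0 gt_eqF// => /(_ isT); rewrite /e1; lra.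
have e20 : 0 < e2.
  by have := @expR_gt1Dx R eta; rewrite gt_eqF// => /(_ isT); rewrite /e2; lra.
exists (Num.min e1 e2); first by rewrite lt_min e10.
move=> y; rewrite lerNr; have [y0|y0] := leP 0 y => ye; rewrite ge_min; apply/orP.
  left; rewrite ger0_norm// in ye.
  have -> : - y = - eta + - (y - eta) by ring.
  rewrite expRD; have H := expR_ge1Dx (- (y - eta)); have := expR_gt0 (- eta).
  have : expR (- eta) <= 1 by rewrite -expR0 ler_expR oppr_le0 ltW.
  by rewrite /e1; set q := expR (- eta) => q1 q0; nra.
right; rewrite ltr0_norm// in ye.
have -> : - y = eta + - (y + eta) by ring.
rewrite expRD; have H := expR_ge1Dx (- (y + eta)).
have : 1 <= expR eta by rewrite -expR0 ler_expR ltW.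
by rewrite /e2; set q := expR eta => q1; nra.
Qed.

(** With y = t - t1 and the chosen [p], the ratio of [peak p t] to [peak p t1] is exp(-p y) (1 + p
    (1 - exp(-y))). By 1 + x <= exp x it is at most exp(p (1 - exp(-y) - y)), where [expR_gap]
    applies. *)
Lemma peak_gap (t1 eta : R) : 0 < t1 -> 0 < eta ->
  exists p r : R, [/\ 0 < p, 0 < r, r < peak p t1 &
    forall t, 0 <= t -> eta <= `|t - t1| -> peak p t <= r].
Proof.
move=> t10 eta0; have [e e0 He] := expR_gap eta0.
pose x1 := expR (- t1).
have x10 : 0 < x1 by exact: expR_gt0.
have x11 : x1 < 1 by rewrite -expR0 ltr_expR oppr_lt0.
(* With this exponent [peak p] is maximal at [t1]. *)
pose p := x1 / (1 - x1).
have x1' : 0 < 1 - x1 by rewrite subr_gt0.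
have p0 : 0 < p by rewrite divr_gt0.
have k0 : 0 < peak p t1 by rewrite mulr_gt0 ?expR_gt0.
exists p, (peak p t1 * expR (- (p * e))); split => //.
- by rewrite mulr_gt0 ?expR_gt0.
- by rewrite -[ltRHS]mulr1 ltr_pM2l// -expR0 ltr_expR oppr_lt0 mulr_gt0.
- move=> t t0 /He; set y := t - t1 => ye.
  have -> : peak p t = expR (- p * t1) * (1 - x1) *
      (expR (- (p * y)) * (1 + p * (1 - expR (- y)))).
    have -> : 1 + p * (1 - expR (- y)) = (1 - x1 * expR (- y)) / (1 - x1).
      by rewrite /p; field; rewrite gt_eqF.
    rewrite /peak (_ : - p * t = - p * t1 + - (p * y)); last by rewrite /y; ring.
    rewrite (_ : - t = - t1 + - y) ?expRD -/x1; last by rewrite /y; ring.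
    by field; rewrite gt_eqF.
  rewrite /peak -/x1 ler_pM2l ?mulr_gt0 ?expR_gt0//.
  apply: le_trans (ler_wpM2l (expR_ge0 _) (expR_ge1Dx _)) _.
  by rewrite -expRD ler_expR; nra.
Qed.

End PeakKernel.

Section LaplaceUniqueness.
Variable R : realType.
Local Notation leb := (@lebesgue_measure R).
Variables (f : R -> R) (M : R).
Hypothesis mf : measurable_fun setT f.
Hypothesis fM : forall t, 0 <= t -> `|f t| <= M.

Let mexpR (g : R -> R) (al : R) : measurable_fun setT g ->
  measurable_fun setT (fun t : R => expR (- al * t) * g t).
Proof. by move=> mg; apply: measurable_funM => //; exact: measurable_expRM. Qed.

Lemma integrable_exp_bounded (g : R -> R) (K al : R) : 0 < al ->
  measurable_fun setT g -> (forall t, 0 <= t -> `|g t| <= K) ->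
  leb.-integrable `[0, +oo[ (fun t => (expR (- al * t) * g t)%:E).
Proof.
move=> al0 mg gK; have K0 : 0 <= K by exact: le_trans (gK 0 (lexx _)).
have H : leb.-integrable `[0, +oo[ (fun t => (K * expR (- al * t))%:E).
  apply/integrableP; split.
    apply/measurable_EFinP/measurable_funTS; apply: measurable_funM => //.
    exact: measurable_expRM.
  rewrite (_ : (\int[leb]_(t in `[0%R, +oo[) _)%E = (K%:E * elaplace al (cst 1%E))%E).
    by rewrite elaplace_cst// -EFinM ltry.
  rewrite -elaplaceZ//; apply: eq_integral => t _.
  by rewrite mule1 abse_EFin ger0_norm ?mulr_ge0 ?expR_ge0// mulrC.
apply: le_integrable H => //; first by apply/measurable_EFinP/measurable_funTS; exact: mexpR.
move=> t; rewrite /= in_itv/= andbT => t0; rewrite lee_fin !normrM mulrC.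
by rewrite ler_wpM2r// (ger0_norm K0) gK.
Qed.

Let mpow N : measurable_fun setT (fun t : R => (1 - expR (- t)) ^+ N * f t).
Proof.
apply: measurable_funM => //; apply: measurable_funX; apply: measurable_funB => //.
rewrite (_ : (fun t => _) = fun t => expR (- 1 * t)); first exact: measurable_expRM.
by apply/funext => t; rewrite mulN1r.
Qed.

Let powM N t : 0 <= t -> `|(1 - expR (- t)) ^+ N * f t| <= M.
Proof.
move=> t0; have e0 := expR_ge0 (- t).
have e1 : expR (- t) <= 1 by rewrite -expR0 ler_expR oppr_le0.
rewrite normrM -[leRHS]mul1r ler_pM ?fM// normrX exprn_ile1 ?normr_ge0//.
by rewrite ger0_norm; lra.
Qed.

Hypothesis lap0 : forall al, 0 < al ->
  \int[leb]_(t in `[0, +oo[) (expR (- al * t) * f t) = 0.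

(** Each further factor 1 - exp(-t) turns the integral into a difference of the integrals at [al]
    and [al + 1]. *)
Let lap_pow N al : 0 < al ->
  \int[leb]_(t in `[0, +oo[) (expR (- al * t) * ((1 - expR (- t)) ^+ N * f t)) = 0.
Proof.
elim: N al => [|N IH] al al0.
  by rewrite -[RHS](lap0 al0); apply: eq_Rintegral => t _; rewrite expr0 mul1r.
have al10 : 0 < al + 1 by rewrite addr_gt0.
transitivity (\int[leb]_(t in `[0, +oo[)
   (expR (- al * t) * ((1 - expR (- t)) ^+ N * f t) -
    expR (- (al + 1) * t) * ((1 - expR (- t)) ^+ N * f t))).
  apply: eq_Rintegral => t _.
  rewrite (_ : - (al + 1) * t = - al * t + - t) ?expRD ?exprS; last by ring.
  by ring.
rewrite RintegralB//; last 2 first.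
- exact: integrable_exp_bounded al0 (mpow N) (powM N).
- exact: integrable_exp_bounded al10 (mpow N) (powM N).
by rewrite !IH// subrr.
Qed.

(** If c > 0, then f > c/2 on an interval to the right of [t0], and the peak is placed inside it.
    The N-th power then collects at least a constant times r1^N near the peak, while outside the
    interval it loses at most a constant times r2^N with r2 < r1. The total being 0 for all N is a
    contradiction. *)
Lemma laplace_right_limit_le0 t0 c : 0 <= t0 -> f s @[s --> t0^'+] --> c -> c <= 0.
Proof.
move=> t00 fc; rewrite leNgt; apply/negP => c0.
have c20 : 0 < c / 2 by rewrite divr_gt0.
have [de /= de0 Hde] : exists2 e : R, 0 < e & forall t, t0 < t -> t < t0 + e -> c / 2 < f t.
  have c2 : c / 2 < c by lra.
  have [e /= e0 He] := cvgr_gt _ fc _ c2.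
  by exists e => // t tt te; apply: He => //=; rewrite distrC gtr0_norm ?subr_gt0// ltrBlDl.
(* The peak sits at the midpoint of the interval where f exceeds c/2, so that the interval is
   exactly |t - t1| < eta. *)
pose eta := de / 2; pose t1 := t0 + eta.
have eta0 : 0 < eta by rewrite divr_gt0.
have t10 : 0 < t1 by rewrite ltr_wpDl.
have fI t : `|t - t1| < eta -> c / 2 < f t.
  by rewrite ltr_norml /t1 /eta => /andP[h1 h2]; apply: Hde; lra.
have [p [r2 [p0 r20 r2k Hr2]]] := peak_gap t10 eta0.
pose r1 := (peak p t1 + r2) / 2.
have r21 : r2 < r1 by rewrite /r1; lra.
have r10 : 0 < r1 by rewrite (lt_trans r20).
have pc : continuous (peak p).
  move=> t; apply: cvgM.
    apply: continuous_comp; last exact: continuous_expR.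
    by apply: continuousM => //; exact: cst_continuous.
  apply: cvgB; first exact: cvg_cst.
  by apply: continuous_comp; [exact: continuousN|exact: continuous_expR].
have [e1 /= e10 He1] : exists2 e : R, 0 < e & forall t, `|t - t1| < e -> r1 < peak p t.
  have r1k : r1 < peak p t1 by rewrite /r1; lra.
  have [e /= e0 He] := cvgr_gt _ (pc t1) _ r1k.
  by exists e => // t te; apply: He => //=; rewrite distrC.
pose L := Num.min e1 eta / 2.
have L0 : 0 < L by rewrite divr_gt0// lt_min e10.
have Le1 : L < e1.
  by have : Num.min e1 eta <= e1 by [rewrite ge_min lexx]; rewrite /L; lra.
have Leta : L < eta.
  by have : Num.min e1 eta <= eta by [rewrite ge_min lexx orbT]; rewrite /L; lra.
have inJ t : t \in `[t1, t1 + L] -> `|t - t1| <= L.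
  by rewrite in_itv/= => /andP[h1 h2]; rewrite ger0_norm ?subr_ge0// lerBlDl.
pose w := expR (- (t1 + L)); have w0 : 0 < w by exact: expR_gt0.
pose J := `[t1, t1 + L]%classic : set R.
have M0 : 0 <= M by exact: le_trans (fM (lexx 0)).
pose B := \int[leb]_(t in `[0, +oo[) (expR (- 1 * t) * 1).
have iB : leb.-integrable `[0, +oo[ (fun t => (expR (- 1 * t) * 1)%:E).
  by apply: (@integrable_exp_bounded (cst 1) 1) => // t _; rewrite normr1.
have mJ : measurable J by exact: measurable_itv.
have JE : (\int[leb]_(t in `[0%R, +oo[) (\1_J t)%:E = L%:E)%E.
  rewrite integral_indic//= setIidl => [|t]; last first.
    by rewrite /J /= !in_itv/= andbT => /andP[+ _]; exact: le_trans (ltW t10).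
  by rewrite lebesgue_measure_itv/= lte_fin ltrDl L0 -EFinB addrC addKr.
have iJ : leb.-integrable `[0, +oo[ (fun t => (\1_J t : R)%:E).
  apply/integrableP; split.
    by apply/measurable_EFinP; exact: measurable_indic.
  under eq_integral do rewrite gee0_abs ?lee_fin//.
  by rewrite JE ltry.
have iZ (k : R) (g : R -> R) : leb.-integrable `[0, +oo[ (fun t => (g t)%:E) ->
    leb.-integrable `[0, +oo[ (fun t => (k * g t)%:E).
  by move=> ig; apply: (@integrableZl _ _ _ leb _ _ k _ ig).
have key N : c / 2 * w * r1 ^+ N * L <= M * r2 ^+ N * B.
  (* The additional 1 in the exponent leaves a factor exp(-t), which bounds the loss over the
     half-line by a constant [B] independent of [N]. *)
  have alN : 0 < p * N%:R + 1 by rewrite ltr_wpDl// mulr_ge0// ltW.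
  have H := lap_pow N alN.
  rewrite -subr_le0 -[leRHS]H.
  have -> : c / 2 * w * r1 ^+ N * L - M * r2 ^+ N * B =
     \int[leb]_(t in `[0, +oo[) (c / 2 * w * r1 ^+ N * \1_J t -
        M * r2 ^+ N * (expR (- 1 * t) * 1)).
    rewrite RintegralB//; last 2 first.
    - exact: iZ iJ.
    - exact: iZ iB.
    rewrite !RintegralZl//; congr (_ * _ - _).
    by rewrite /Rintegral JE.
  apply: le_Rintegral => //.
  - by apply: (@integrableB _ _ _ leb _ _ _ _ (iZ _ _ iJ) (iZ _ _ iB)).
  - exact: integrable_exp_bounded alN (mpow N) (powM N).
  move=> t; rewrite /= in_itv/= andbT => t0'.
  have -> : expR (- (p * N%:R + 1) * t) * ((1 - expR (- t)) ^+ N * f t) =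
      expR (- t) * peak p t ^+ N * f t.
    rewrite /peak exprMn -expRM_natr.
    rewrite (_ : - (p * N%:R + 1) * t = - t + - p * t * N%:R) ?expRD; last by ring.
    by ring.
  rewrite mulr1 mulN1r.
  have pk0 : 0 <= peak p t.
    by rewrite mulr_ge0 ?expR_ge0// subr_ge0 -expR0 ler_expR oppr_le0.
  have [tI|tI] := ltP `|t - t1| eta.
    have ft := fI t tI.
    have h1 : 0 <= M * r2 ^+ N * expR (- t).
      by rewrite !mulr_ge0 ?expR_ge0 ?exprn_ge0// ltW.
    apply: (@le_trans _ _ (c / 2 * w * r1 ^+ N * \1_J t)); first by rewrite lerBlDr lerDl.
    rewrite indicE; have [tJ|tJ] := boolP (t \in J); last first.
      by rewrite mulr0 mulr_ge0 ?(ltW (lt_trans c20 ft))// mulr_ge0 ?expR_ge0// exprn_ge0.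
    rewrite mulr1 [leRHS]mulrC -mulrA; apply: ler_pM => //.
    - exact: ltW.
    - by rewrite mulr_ge0 ?(ltW w0)// exprn_ge0// ltW.
    - exact: ltW.
    have tJ' : t \in `[t1, t1 + L] by move: tJ; rewrite inE.
    apply: ler_pM.
    - exact: ltW.
    - by rewrite exprn_ge0// ltW.
    - by move: tJ'; rewrite in_itv/= ler_expR lerN2 => /andP[].
    - rewrite lerXn2r ?nnegrE// ltW// He1//.
      exact: le_lt_trans (inJ t tJ') Le1.
  rewrite indicE memNset ?mulr0 ?sub0r; last first.
    by move=> /inJ /(le_lt_trans)/(_ Leta); rewrite ltNge tI.
  rewrite lerNl -mulrN.
  have h2 : - f t <= M by rewrite (le_trans _ (fM t0'))// -normrN ler_norm.
  apply: (@le_trans _ _ (expR (- t) * peak p t ^+ N * M)).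
    by rewrite ler_wpM2l// mulr_ge0 ?expR_ge0// exprn_ge0.
  rewrite [leLHS]mulrC [in leRHS]mulrAC -mulrA ler_wpM2l// ler_wpM2l ?expR_ge0//.
  by rewrite lerXn2r ?nnegrE// ?Hr2// ltW.
have key2 N : c / 2 * w * L <= M * B * (r2 / r1) ^+ N.
  rewrite expr_div_n [leRHS]mulrA ler_pdivlMr ?exprn_gt0// mulrAC [leRHS]mulrAC.
  exact: key.
have c1 : (fun N : nat => M * B * (r2 / r1) ^+ N) @ \oo --> M * B * 0.
  apply: cvgM; first exact: cvg_cst.
  apply: cvg_expr; rewrite ger0_norm; first by rewrite ltr_pdivrMr// mul1r.
  exact: divr_ge0 (ltW r20) (ltW r10).
have : c / 2 * w * L <= M * B * 0.
  apply: (ler_cvg_to (cvg_cst (c / 2 * w * L)) c1).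
  by apply: nearW => N; exact: key2.
by rewrite mulr0 leNgt mulr_gt0// mulr_gt0.
Qed.

End LaplaceUniqueness.

Lemma laplace_right_continuous_eq0 (R : realType) (f : R -> R) (M : R) :
  measurable_fun setT f -> (forall t, 0 <= t -> `|f t| <= M) ->
  (forall al, 0 < al ->
    \int[lebesgue_measure]_(t in `[0, +oo[) (expR (- al * t) * f t) = 0) ->
  (forall t, 0 <= t -> f s @[s --> t^'+] --> f t) ->
  forall t, 0 <= t -> f t = 0.
Proof.
move=> mf fM f0 fr t t0; apply/eqP; rewrite eq_le.
rewrite (laplace_right_limit_le0 mf fM f0 t0 (fr t t0))/= -oppr_le0.
have mfN : measurable_fun setT (- f) by exact: measurableT_comp.
have fMN s : 0 <= s -> `|(- f) s| <= M by move=> s0; rewrite normrN fM.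
apply: (laplace_right_limit_le0 mfN fMN _ t0); last exact: cvgN (fr t t0).
move=> al al0; transitivity (-1 * \int[lebesgue_measure]_(t in `[0, +oo[)
    (expR (- al * t) * f t)); last by rewrite f0// mulr0.
rewrite -RintegralZl//; last exact: integrable_exp_bounded al0 mf fM.
by apply: eq_Rintegral => s _; rewrite mulN1r -mulrN.
Qed.

(** * Comparison with Feller's formula *)

Section NuSum.
Variable R : realType.
Variable nu : {measure set nat -> \bar R}.
Hypothesis nu_fin : (nu [set: nat] < +oo)%E.

Lemma nu_setT : nu [set: nat] = (\sum_(0 <= k <oo) nu [set k])%E.
Proof.
rewrite (_ : [set: nat] = \bigcup_k [set k]); last first.
  by apply/seteqP; split => // k _; exists k.
rewrite measure_bigcup// => [|i k _ _ [x [/= -> ->]]//].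
by apply: eq_eseriesl => k; rewrite in_setT.
Qed.

Lemma nu_set1_fin k : nu [set k] \is a fin_num.
Proof.
rewrite ge0_fin_numE//; apply: le_lt_trans nu_fin.
by apply: le_measure; rewrite ?inE.
Qed.

Definition nu_sum (x : nat -> R) : R :=
  fine (\sum_(0 <= k <oo) nu [set k] * (x k)%:E)%E.

Lemma nu_sumE x K : (forall k, 0 <= x k <= K) ->
  (nu_sum x)%:E = (\sum_(0 <= k <oo) nu [set k] * (x k)%:E)%E.
Proof.
move=> xK; rewrite /nu_sum fineK// ge0_fin_numE; last first.
  by apply: nneseries_ge0 => k _ _; rewrite mule_ge0// lee_fin; case/andP: (xK k).
have K0 : 0 <= K by have /andP[] := xK 0%N; exact: le_trans.
apply: (@le_lt_trans _ _ (\sum_(0 <= k <oo) K%:E * nu [set k])%E).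
  apply: lee_nneseries => [k _ _|k _].
    by rewrite mule_ge0// lee_fin; case/andP: (xK k).
  by rewrite muleC lee_wpmul2r// lee_fin; case/andP: (xK k).
by rewrite nneseriesZl// -nu_setT lte_mul_pinfty// ?lee_fin.
Qed.

Lemma nu_sum_ge0 x : (forall k, 0 <= x k) -> 0 <= nu_sum x.
Proof.
by move=> x0; rewrite fine_ge0// nneseries_ge0// => k _ _; rewrite mule_ge0// lee_fin.
Qed.

Lemma nu_sum1 : nu_sum (fun=> 1) = fine (nu [set: nat]).
Proof.
by rewrite /nu_sum nu_setT; congr fine; apply: eq_eseriesr => k _; exact: mule1.
Qed.

Lemma nu_sum_comb x y K c : 0 <= c -> (forall k, 0 <= x k <= K) ->
  (forall k, 0 <= y k <= K) -> nu_sum (fun k => x k + c * y k) = nu_sum x + c * nu_sum y.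
Proof.
move=> c0 xK yK; apply: EFin_inj; rewrite EFinD EFinM (nu_sumE xK) (nu_sumE yK).
have K0 : 0 <= K by have /andP[] := xK 0%N; exact: le_trans.
rewrite (@nu_sumE _ (K + c * K)) => [|k]; last first.
  have /andP[x0 x1] := xK k; have /andP[y0 y1] := yK k.
  by rewrite addr_ge0 ?mulr_ge0//= lerD// ler_wpM2l.
rewrite -nneseriesZl => [|k _]; last by rewrite mule_ge0// lee_fin; case/andP: (yK k).
rewrite -nneseriesD.
- apply: eq_eseriesr => k _; rewrite EFinD EFinM muleDr//; first by rewrite muleCA.
    exact: nu_set1_fin.
- by move=> k _; rewrite mule_ge0// lee_fin; case/andP: (xK k).
- by move=> k _; rewrite !mule_ge0// lee_fin//; case/andP: (yK k).
Qed.

End NuSum.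

Lemma state_mass (R : realType) (pi : probability (borel_Delta N_infty) R) :
  (pi [set trap] + pi [set (Some None : borel_Delta N_infty)] +
   \sum_(0 <= k <oo) pi [set state k] = 1)%E.
Proof.
have mB (B : set (borel_Delta N_infty)) : measurable B by exact: measurable_borel_Delta.
rewrite -(@probability_setT _ _ _ pi).
rewrite (_ : [set: borel_Delta N_infty] =
    ([set trap] `|` [set Some None]) `|` \bigcup_k [set state k]); last first.
  apply/seteqP; split => // -[[k|]|] _; [by right; exists k|by left; right|by left; left].
rewrite measureU//; last first.
  by apply/seteqP; split => // s [[->|->] [k _]].
rewrite measureU//; last by apply/seteqP; split => // s [->].
congr (_ + _ + _)%E; rewrite [RHS](@measure_bigcup _ _ _ pi setT).
- by apply: eq_eseriesl => k; rewrite in_setT.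
- by [].
- by move=> i k _ _ [x [/= -> []]].
Qed.

Section FellerResolvent.
Variables (R : realType) (a b : nat -> R).
Hypothesis a0 : a 0%N = 0.
Hypothesis a_gt0 : forall k, (1 <= k)%N -> 0 < a k.
Hypothesis b_gt0 : forall k, 0 < b k.
Hypothesis hregular : regular_boundary a b.
Variable pmin : R -> nat -> nat -> R.
Hypothesis hmin : minimal_Q_process a b pmin.
Variables (nu : {measure set nat -> \bar R}) (gamma beta : R).
Hypothesis nu_fin : (nu [set: nat] < +oo)%E.
Hypothesis gamma0 : 0 <= gamma.
Hypothesis beta0 : 0 < beta.
Let m := fine (nu [set: nat]) + gamma.
Let kappa := m / beta.
Variables (d : measure_display) (Omega : measurableType d).
Variable X : strong_markov_process R N_infty d Omega.
Hypothesis hX : associated a b kappa X.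
Variable pi : probability (borel_Delta N_infty) R.
Hypothesis hpi : m != 0 ->
  (forall k : nat, pi [set state k] = (fine (nu [set k]) / m)%:E) /\
  pi [set trap] = (gamma / m)%:E.
Variable Pt : borel_Delta N_infty -> probability (sequences (Omega * borel_Delta N_infty)%type) R.
Hypothesis hPt : piecing_law X pi Pt.
Variable al : R.
Hypothesis al0 : 0 < al.

Local Notation mu := (bd_mu a b).
Local Notation Phi := (laplace pmin al).
Local Notation u := (u_ pmin al).
Local Notation mass_u := (bd_mass_u a b pmin al).
Local Notation D := (kappa + al * mass_u).

Let hQ : Q_process a b pmin. Proof. by case: hmin. Qed.

Let m0 : 0 <= m. Proof. by rewrite addr_ge0// fine_ge0. Qed.

Let kappa0 : 0 <= kappa. Proof. by rewrite divr_ge0// ltW. Qed.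

Let D0 : 0 < D.
Proof. exact: (form_denom_gt0 a0 a_gt0 b_gt0 hregular hmin kappa0 al0). Qed.

Let u01 k : 0 <= u k <= 1.
Proof. by rewrite (u_ge0 hmin al0) (u_le1 hmin al0). Qed.

Let Phi_bnd j k : 0 <= Phi k j <= al^-1.
Proof. by rewrite (laplace_ge0 hQ al0) (laplace_le hQ al0). Qed.

Lemma mass_uE : fine (\sum_(0 <= k <oo) (mu k * u k)%:E)%E = mass_u.
Proof.
have cv := series_mu_u_cvg a_gt0 b_gt0 hregular hmin al0.
rewrite (_ : (\sum_(0 <= k <oo) (mu k * u k)%:E)%E =
   limn (fun n => (series (fun k => mu k * u k) n)%:E)).
  by rewrite EFin_lim.
by congr (limn _); apply/funext => n; rewrite /series/= sumEFin.
Qed.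

(** Since |nu| + gamma = beta kappa, Feller's denominator is precisely the coefficient of the
    unknown e when the renewal equation is solved. *)
Lemma feller_denominatorE :
  feller_denominator a b pmin nu gamma beta al = beta * D - nu_sum nu u.
Proof.
rewrite /feller_denominator mass_uE.
change (fine _) with (nu_sum nu (fun k => 1 - u k)).
have -> : nu_sum nu (fun k => 1 - u k) = fine (nu [set: nat]) - nu_sum nu u.
  apply/eqP; rewrite -subr_eq opprK eq_sym -nu_sum1 -[X in _ + X]mul1r.
  rewrite -(@nu_sum_comb _ _ nu_fin _ _ 1)//.
    by apply/eqP; congr nu_sum; apply/funext => k; rewrite mul1r subrK.
  by move=> k; have /andP[h1 h2] := u01 k; rewrite subr_ge0 h2 lerBlDr lerDl.
by rewrite /kappa /m; field; rewrite gt_eqF.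
Qed.

Lemma feller_denominator_gt0 : 0 < feller_denominator a b pmin nu gamma beta al.
Proof.
rewrite /feller_denominator mass_uE ltr_wpDl//.
  rewrite addr_ge0//; apply: (@nu_sum_ge0 _ nu) => k.
  by rewrite subr_ge0; case/andP: (u01 k).
by rewrite !mulr_gt0//; exact: (bd_mass_u_gt0 a0 a_gt0 b_gt0 hregular hmin al0).
Qed.

(** All terms of the renewal equation apart from Phi(k, j) are multiples of u(k), so the solution is
    Phi(k, j) + e u(k). Integrating against [nu] yields beta D e = beta mu_j u_j + nu(Phi(., j)) + e
    nu(u), to be solved for e. *)
Lemma pieced_resolvent_state i j : pieced_resolvent X Pt al j (state i) =
  (Phi i j + u i * (feller_numerator a b pmin nu beta al j /
                    feller_denominator a b pmin nu gamma beta al))%:E.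
Proof.
have rho_ge0 := pieced_resolvent_ge0 X Pt al j.
have rho_le := pieced_resolvent_le X Pt j al0.
have rho_fin x : pieced_resolvent X Pt al j x \is a fin_num.
  by rewrite ge0_fin_numE// (le_lt_trans (rho_le x))// ltry.
pose rho k := fine (pieced_resolvent X Pt al j (state k)).
have rhoE k : (rho k)%:E = pieced_resolvent X Pt al j (state k) by rewrite /rho fineK.
have rho_bnd k : 0 <= rho k <= al^-1 by rewrite -!lee_fin rhoE rho_ge0 rho_le.
have [e [De eE]] : exists e, beta * D * e = beta * mu j * u j +
    (nu_sum nu (fun k => Phi k j) + e * nu_sum nu u) /\
    forall k, rho k = Phi k j + e * u k.
  have [z [z0 mz zE]] : exists z, [/\ 0 <= z, m * z = nu_sum nu rho &
      forall k, rho k = Phi k j + u k * (mu j * u j / D) + kappa * u k / D * z].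
    have rec k := @pieced_recursion _ _ _ _ _ _ hPt al j al0 (state k) (fun H => ltac:(by [])).
    have {}rec k : (rho k)%:E = ((Phi k j + u k * (mu j * u j / D))%:E +
        (kappa * u k / D)%:E *
        (pi [set (Some None : borel_Delta N_infty)] * pieced_resolvent X Pt al j (Some None) +
         \sum_(0 <= k <oo) pi [set state k] * pieced_resolvent X Pt al j (state k)))%E.
      rewrite rhoE rec.
      rewrite (integral_occupation_state a0 a_gt0 b_gt0 hregular hmin kappa0 hX al0).
      by rewrite (integral_discount_state a0 a_gt0 b_gt0 hregular hmin kappa0 hX al0).
    (* For [m = 0] both [kappa] and [nu] vanish, so that the factor before the bracket is 0 and z =
       0 satisfies both conditions. *)
    have [m00|mn0] := eqVneq m 0.
      have kap : kappa = 0 by rewrite /kappa m00 mul0r.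
      have nT0 : nu [set: nat] = 0%E.
        have := fine_ge0 (measure_ge0 nu [set: nat]); move: m00 gamma0; rewrite /m => h1 h2 h3.
        rewrite -(fineK (_ : nu [set: nat] \is a fin_num)) ?ge0_fin_numE//.
        by congr EFin; lra.
      exists 0; split => //.
        rewrite mulr0 /nu_sum eseries0// => k _ _.
        rewrite (_ : nu [set k] = 0%E) ?mul0e//.
        by apply/eqP; rewrite eq_le measure_ge0 andbT -nT0; apply: le_measure; rewrite ?inE.
      move=> k; apply: EFin_inj; rewrite rec kap.
      by rewrite !mul0r mul0e adde0 addr0.
    have m_gt0 : 0 < m by rewrite lt_neqAle eq_sym mn0.
    have [piS piT] := hpi mn0.
    have piE : (\sum_(0 <= k <oo) pi [set state k] = (fine (nu [set: nat]) / m)%:E)%E.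
      rewrite mulrC EFinM fineK ?ge0_fin_numE// nu_setT.
      rewrite -nneseriesZl//; apply: eq_eseriesr => k _.
      by rewrite piS mulrC EFinM fineK// nu_set1_fin.
    (* The masses of the trap and of the states of [nat] already add up to 1. *)
    have pi0 : pi [set (Some None : borel_Delta N_infty)] = 0%E.
      have := state_mass pi; rewrite piT piE.
      have := measure_ge0 pi [set (Some None : borel_Delta N_infty)].
      case: (pi [set _]) => [r|//|//] _ [] H; congr EFin.
      have : gamma / m + fine (nu [set: nat]) / m = 1.
        by rewrite -mulrDl addrC divff.
      by lra.
    exists (nu_sum nu rho / m); split.
    - by rewrite divr_ge0// nu_sum_ge0// => k; case/andP: (rho_bnd k).
    - by rewrite mulrC divfK.
    move=> k; apply: EFin_inj; rewrite rec pi0 mul0e add0e [in RHS]EFinD [in RHS]EFinM.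
    congr (_ + _ * _)%E.
    rewrite mulrC EFinM (nu_sumE nu_fin rho_bnd) -nneseriesZl => [|l _].
      apply: eq_eseriesr => l _; rewrite -rhoE piS mulrC EFinM -muleA fineK//.
      exact: nu_set1_fin.
    by rewrite mule_ge0// lee_fin; case/andP: (rho_bnd l).
  pose e := (mu j * u j + kappa * z) / D.
  have eE k : rho k = Phi k j + e * u k.
    by rewrite zE /e; field; rewrite gt_eqF.
  have e0 : 0 <= e.
    have muj : 0 <= mu j by rewrite ltW// bd_mu_gt0.
    have /andP[uj _] := u01 j.
    by rewrite /e divr_ge0 ?(ltW D0)// addr_ge0// mulr_ge0.
  exists e; split => //.
  have <- : nu_sum nu rho = nu_sum nu (fun k => Phi k j) + e * nu_sum nu u.
    rewrite -(@nu_sum_comb _ _ nu_fin _ _ (al^-1 + 1) e e0).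
    - by congr nu_sum; apply/funext => k; rewrite eE.
    - by move=> k; have /andP[h1 h2] := Phi_bnd j k; rewrite h1 ler_wpDr.
    - by move=> k; have /andP[h1 h2] := u01 k; rewrite h1 ler_wpDl// invr_ge0 ltW.
  (* Multiplying the definition of e by beta D produces beta kappa z = m z, the [nu]-integral of
     [rho]; this closes the equation. *)
  have kb : beta * kappa = m by rewrite /kappa mulrC divfK// gt_eqF.
  rewrite -mz -kb mulrAC -mulrA (mulrC e) /e mulrC divfK ?gt_eqF//; ring.
rewrite -rhoE eE mulrC; congr (_ + _ * _)%:E.
have d0 := feller_denominator_gt0.
apply/(canRL (mulfK (lt0r_neq0 d0))).
rewrite feller_denominatorE /feller_numerator.
change (fine _) with (nu_sum nu (fun k => Phi k j)).
by rewrite mulrBr mulrC De; ring.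
Qed.

End FellerResolvent.

Theorem theorem8p1 (R : realType) (a b : nat -> R)
  (ha0 : a 0%N = 0) (ha : forall k, (1 <= k)%N -> 0 < a k)
  (hb : forall k, 0 < b k)
  (hregular : regular_boundary a b)
  (pmin : R -> nat -> nat -> R) (hmin : minimal_Q_process a b pmin)
  (nu : {measure set nat -> \bar R}) (gamma beta : R)
  (p : R -> nat -> nat -> R)
  (hp : feller_Q_process a b pmin nu gamma beta p)
  (hnu : (nu [set: nat] < +oo)%E) (hbeta : 0 < beta)
  (m : R) (hm : m = fine (nu [set: nat]) + gamma)
  (kappa : R) (hkappa : kappa = m / beta)
  (d : measure_display) (Omega : measurableType d)
  (X : strong_markov_process R N_infty d Omega)
  (hX : associated a b kappa X)
  (pi : probability (borel_Delta N_infty) R)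
  (hpi : m != 0 ->
     (forall k : nat, pi [set state k] = (fine (nu [set k]) / m)%:E) /\
     pi [set trap] = (gamma / m)%:E) :
  piecing_out_transition p X pi.
Proof.
move=> Pt hPt t i j t0.
have [[gamma0 _ _ _] hQ feller] := hp; rewrite hkappa hm in hX; rewrite hm in hpi.
pose F s := fine (pieced_prob X Pt (state i) j s).
have FE s : (F s)%:E = pieced_prob X Pt (state i) j s by rewrite fineK// pieced_prob_fin.
have F01 s : 0 <= F s <= 1.
  by rewrite -!lee_fin FE measure_ge0 probability_le1//; apply: measurable_xsection;
     exact: measurable_pieced_in.
(* The absolute value gives a difference measurable on the whole line, where [p] at negative times
   is arbitrary. *)
pose g s := F s - p `|s| i j.
have mF : measurable_fun setT F.
  exact: (measurableT_comp (fine_measurable measurableT) (measurable_pieced_prob X Pt (state i) j)).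
have mp : measurable_fun setT (fun s : R => p `|s| i j).
  by apply: continuous_measurable_fun; exact: (@Q_process_continuous _ _ _ _ hQ i j).
have p01 (s : R) : 0 <= p `|s| i j <= 1.
  by rewrite (Q_process_ge0 hQ)//= (Q_process_le1 hQ).
have F1 s : 0 <= s -> `|F s| <= 1 by move=> _; have /andP[h1 h2] := F01 s; rewrite ger0_norm.
have p1 (s : R) : 0 <= s -> `|p `|s| i j| <= 1.
  by move=> _; have /andP[h1 h2] := p01 s; rewrite ger0_norm.
have g0 : forall s, 0 <= s -> g s = 0.
  apply: (@laplace_right_continuous_eq0 _ g 1).
  - exact: measurable_funB.
  - by move=> s _; have := F01 s; have := p01 s; rewrite /g ler_norml; lra.
  - move=> al al0; under eq_Rintegral do rewrite mulrBr.
    rewrite RintegralB//; last 2 first.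
    - exact: integrable_exp_bounded al0 mF F1.
    - exact: integrable_exp_bounded al0 mp p1.
    apply/eqP; rewrite subr_eq0; apply/eqP.
    transitivity (laplace p al i j); last first.
      apply: eq_Rintegral => s; rewrite inE/= in_itv/= andbT => s0.
      by rewrite ger0_norm.
    apply: EFin_inj; rewrite feller//.
    rewrite -(pieced_resolvent_state ha0 ha hb hregular hmin hnu gamma0 hbeta hX hpi hPt al0).
    rewrite pieced_resolventE /Rintegral fineK.
      by apply: eq_integral => s _; rewrite EFinM FE.
    by apply: integrable_fin_num => //; exact: integrable_exp_bounded al0 mF F1.
  - move=> s s0; apply: cvgB; first exact: (pieced_prob_right hPt s0).
    apply: cvg_at_right_filter.
    exact: (@Q_process_continuous _ _ _ _ hQ i j s).
rewrite -(pieced_probE X Pt (state i) j t0) -FE; congr EFin.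
by have := g0 t t0; rewrite /g ger0_norm// => /eqP; rewrite subr_eq0 => /eqP.
Qed.
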